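(* Let $k$ be a field of arbitrary characteristic, let $Q_0\subset\mathbb{P}^2_k=\mathrm{Proj}(k[x,y,z])$ be the smooth conic defined by $q_0=xz+y^2=0$, let $S_0=\mathbb{P}^2_k\setminus Q_0$, let $p_0=[0:0:1]\in Q_0$ and let \[ \rho_{0}:S_{0}\rightarrow\mathbb{A}_{k}^{1}=\mathrm{Spec}(k[t]),\quad[x:y:z]\mapsto\frac{x^{2}}{q_{0}}. \] Then the following hold: 1) The group $\mathrm{Aut}_{k}(S_{0})$ is isomorphic to the free product of $\mathrm{Aut}(\mathbb{P}_{k}^{2},Q_{0})|_{S_{0}}$ and $\mathrm{Aut}(S_{0},\rho_{0})$ amalgamated along their intersection. 2) The group $\mathrm{Aut}(\mathbb{P}_{k}^{2},Q_{0})\subset\mathrm{PGL}_{3}(k)$ is isomorphic to $\mathrm{PGL}_{2}(k)$, generated by the following automorphisms: a) $[x:y:z]\mapsto[x:y+bx:z-2by-b^{2}x]$, $b\in k$, b) $[x:y:z]\mapsto[ax:y:a^{-1}z]$, $a\in k^{*}$, c) $[x:y:z]\mapsto[z:-y:x]$. 3) The group $\mathrm{Aut}(S_{0},\rho_{0})$ is generated by the restrictions to $S_{0}$ of birational endomorphisms of $\mathbb{P}_{k}^{2}$ of the form \[ [x:y:z]\mapsto\left[x:\ y+s\left(\tfrac{x^{2}}{q_{0}}\right)x:\ z-2y\,s\left(\tfrac{x^{2}}{q_{0}}\right)-x\,s\left(\tfrac{x^{2}}{q_{0}}\right)^{2}\right],\qquad s\in k[t], \] and of the elements of the subgroup $\mathrm{Aut}(\mathbb{P}_k^{2},Q_{0},p_{0})$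 of $\mathrm{Aut}(\mathbb{P}_{k}^{2},Q_{0})$ consisting of automorphisms fixing the point $p_{0}\in Q_{0}$.
   Context: $\mathrm{Aut}_k(S_0)$ is the group of $k$-automorphisms of $S_0$. $\mathrm{Aut}(\mathbb{P}^2_k,Q_0)$ is the group of $k$-automorphisms of $\mathbb{P}^2_k$ preserving $Q_0$, and $\mathrm{Aut}(\mathbb{P}^2_k,Q_0)|_{S_0}$ is its image in $\mathrm{Aut}_k(S_0)$ by restriction. $\mathrm{Aut}(S_0,\rho_0)$ is the group of $k$-automorphisms of $S_0$ preserving $\rho_0$ globally, that is, automorphisms $\Psi\in\mathrm{Aut}_k(S_0)$ for which there exists $\psi_{\rho_0}\in\mathrm{Aut}(\mathbb{A}^1_k)$ such that $\rho_0\circ\Psi=\psi_{\rho_0}\circ\rho_0$. (The morphism $\rho_0$ is the $\mathbb{A}^1$-fibration induced by the pencil of conics generated by $Q_0$ and twice its tangent line $\{x=0\}$ at $p_0$.) *)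

(* Defs.v *)
From HB Require Import structures.
From mathcomp Require Import all_boot all_order all_algebra.
From mathcomp Require Import mpoly.
From mathcomp Require Import boolp classical_sets.

Set Implicit Arguments.
Unset Strict Implicit.
Unset Printing Implicit Defensive.

Import GRing.Theory.
Local Open Scope ring_scope.
Local Open Scope classical_set_scope.
Local Open Scope quotient_scope.

Section Groups.
Local Open Scope group_scope.

Definition is_subgroup (G : groupType) (H : set G) : Prop :=
  [/\ H 1, forall a b, H a -> H b -> H (a * b) & forall a, H a -> H a^-1].

Definition subgroup_gen (G : groupType) (S : set G) : set G :=
  [set a | forall H : set G, is_subgroup H -> S `<=` H -> H a].

Definition subgroup_iso (G L : groupType) (H : set G) : Prop :=
  exists f : L -> G,
    [/\ {morph f : a b / a * b}, injective f & range f = H].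

Definition morph_on (G L : groupType) (H : set G) (f : G -> L) : Prop :=
  forall a b, H a -> H b -> f (a * b) = f a * f b.

(* The canonical map H1 *_(H1 `&` H2) H2 -> G is an isomorphism: G, with the
   inclusions of H1 and H2, is the pushout of H1 <- H1 `&` H2 -> H2 in the
   category of groups.  The values of f1 outside H1 and of f2 outside H2 are
   irrelevant. *)
Definition is_amalgam (G : groupType) (H1 H2 : set G) : Prop :=
  [/\ is_subgroup H1, is_subgroup H2 &
    forall (L : groupType) (f1 f2 : G -> L),
      morph_on H1 f1 -> morph_on H2 f2 ->
      (forall a, H1 a -> H2 a -> f1 a = f2 a) ->
      exists! h : G -> L,
        [/\ {morph h : a b / a * b},
            forall a, H1 a -> h a = f1 a & forall a, H2 a -> h a = f2 a]].

End Groups.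

Section ProjectiveLinearGroup.
Variables (k : fieldType) (n : nat).

Record GLmx := MkGLmx { GLmx_val :> 'M[k]_n; GLmx_unit : GLmx_val \in unitmx }.

HB.instance Definition _ := [isSub for GLmx_val].
HB.instance Definition _ := [Choice of GLmx by <:].

Fact GLmx_one_subproof : (1%:M : 'M[k]_n) \in unitmx.
Proof. exact: unitmx1. Qed.
Definition GLmx_one := MkGLmx GLmx_one_subproof.

Fact GLmx_mul_subproof (M N : GLmx) : (M *m N) \in unitmx.
Proof. by rewrite unitmx_mul !GLmx_unit. Qed.
Definition GLmx_mul (M N : GLmx) := MkGLmx (GLmx_mul_subproof M N).

Fact GLmx_inv_subproof (M : GLmx) : invmx M \in unitmx.
Proof. by rewrite unitmx_inv GLmx_unit. Qed.
Definition GLmx_inv (M : GLmx) := MkGLmx (GLmx_inv_subproof M).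

Fact GLmx_mulA : associative GLmx_mul.
Proof. by move=> M N K; apply: val_inj; rewrite /= mulmxA. Qed.
Fact GLmx_mul1 : left_id GLmx_one GLmx_mul.
Proof. by move=> M; apply: val_inj; rewrite /= mul1mx. Qed.
Fact GLmx_mulr1 : right_id GLmx_one GLmx_mul.
Proof. by move=> M; apply: val_inj; rewrite /= mulmx1. Qed.
Fact GLmx_mulV : left_inverse GLmx_one GLmx_inv GLmx_mul.
Proof. by move=> M; apply: val_inj; rewrite /= mulVmx ?GLmx_unit. Qed.
Fact GLmx_mulrV : right_inverse GLmx_one GLmx_inv GLmx_mul.
Proof. by move=> M; apply: val_inj; rewrite /= mulmxV ?GLmx_unit. Qed.

HB.instance Definition _ := isGroup.Build GLmx
  GLmx_mulA GLmx_mul1 GLmx_mulr1 GLmx_mulV GLmx_mulrV.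

Definition proportional (M N : GLmx) : bool :=
  `[< exists2 c : k, c != 0 & GLmx_val M = c *: GLmx_val N >].

Fact proportional_refl : reflexive proportional.
Proof. by move=> M; apply/asboolP; exists 1; rewrite ?oner_neq0 ?scale1r. Qed.

Fact proportional_symW (M N : GLmx) : proportional M N -> proportional N M.
Proof.
move=> /asboolP[c c0 e]; apply/asboolP; exists c^-1; first by rewrite invr_eq0.
by rewrite e scalerA mulVf ?scale1r.
Qed.

Fact proportional_sym : ssrbool.symmetric proportional.
Proof. by move=> M N; apply/idP/idP => /proportional_symW. Qed.

Fact proportional_trans : transitive proportional.
Proof.
move=> N M K /asboolP[c c0 e] /asboolP[d d0 e']; apply/asboolP.
by exists (c * d); rewrite ?mulf_neq0 // e e' scalerA.
Qed.

Canonical proportional_equiv :=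
  EquivRel proportional proportional_refl proportional_sym proportional_trans.

Definition PGL : Type := {eq_quot proportional}.

HB.instance Definition _ := Choice.copy PGL {eq_quot proportional}.

Definition PGL_class (M : GLmx) : PGL := \pi_{eq_quot proportional} M.
Definition PGL_repr (g : PGL) : GLmx := repr (g : {eq_quot proportional}).

Lemma PGL_reprK : cancel PGL_repr PGL_class.
Proof. by move=> g; rewrite /PGL_class /PGL_repr reprK. Qed.

Lemma PGL_classP (M N : GLmx) : reflect
  (exists2 c : k, c != 0 & GLmx_val M = c *: GLmx_val N)
  (PGL_class M == PGL_class N).
Proof. by rewrite /PGL_class eqmodE /=; exact: asboolP. Qed.

Lemma PGL_repr_class (M : GLmx) : exists2 c : k, c != 0 &
  GLmx_val (PGL_repr (PGL_class M)) = c *: GLmx_val M.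
Proof. by apply/PGL_classP; rewrite PGL_reprK. Qed.

Definition PGL_one : PGL := PGL_class 1%g.
Definition PGL_mul (g h : PGL) : PGL :=
  PGL_class (PGL_repr g * PGL_repr h)%g.
Definition PGL_inv (g : PGL) : PGL := PGL_class (PGL_repr g)^-1%g.

Lemma PGL_classM (M N : GLmx) :
  PGL_mul (PGL_class M) (PGL_class N) = PGL_class (M * N)%g.
Proof.
apply/eqP/PGL_classP.
have [c c0 ec] := PGL_repr_class M; have [d d0 ed] := PGL_repr_class N.
exists (c * d); first by rewrite mulf_neq0.
by rewrite /= ec ed -scalemxAl -scalemxAr scalerA.
Qed.

Fact PGL_mulA : associative PGL_mul.
Proof.
move=> f g h; rewrite -(PGL_reprK f) -(PGL_reprK g) -(PGL_reprK h).
by rewrite !PGL_classM mulgA.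
Qed.
Fact PGL_mul1 : left_id PGL_one PGL_mul.
Proof. by move=> g; rewrite -(PGL_reprK g) PGL_classM mul1g. Qed.
Fact PGL_mulr1 : right_id PGL_one PGL_mul.
Proof. by move=> g; rewrite -(PGL_reprK g) PGL_classM mulg1. Qed.
Fact PGL_mulV : left_inverse PGL_one PGL_inv PGL_mul.
Proof. by move=> g; rewrite -{2}(PGL_reprK g) PGL_classM mulVg. Qed.
Fact PGL_mulrV : right_inverse PGL_one PGL_inv PGL_mul.
Proof. by move=> g; rewrite -{1}(PGL_reprK g) PGL_classM mulgV. Qed.

HB.instance Definition _ := isGroup.Build PGL
  PGL_mulA PGL_mul1 PGL_mulr1 PGL_mulV PGL_mulrV.

End ProjectiveLinearGroup.

Section AutSpec.
Variables (k : fieldType) (A : comAlgType k).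

(* The k-automorphisms of the affine scheme Spec A.  An automorphism Psi is
   given by its comorphism Psi^*, a k-algebra automorphism of A; its inverse is
   kept as a (uniquely determined) field.  Composition is that of maps of
   schemes, so it reverses that of comorphisms: (Phi Psi)^* = Psi^* Phi^*. *)
Record autSpec := MkAutSpec {
  comorph : A -> A;
  comorphV : A -> A;
  comorph_linear : linear comorph;
  comorph_monoid : monoid_morphism comorph;
  comorphK : cancel comorph comorphV;
  comorphVK : cancel comorphV comorph }.

HB.instance Definition _ := gen_eqMixin autSpec.
HB.instance Definition _ := gen_choiceMixin autSpec.

Lemma autSpec_eq (Phi Psi : autSpec) : comorph Phi =1 comorph Psi -> Phi = Psi.
Proof.
case: Phi Psi => [f f' lf mf fK f'K] [g g' lg mg gK g'K] /= /funext efg.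
subst g; have e : f' = g' by apply/funext => a; rewrite -{1}(g'K a) fK.
by subst g'; congr MkAutSpec; exact: Prop_irrelevance.
Qed.

Definition autSpec_one : autSpec.
Proof. by exists id id. Defined.

Definition autSpec_mul (Phi Psi : autSpec) : autSpec.
Proof.
exists (comorph Psi \o comorph Phi) (comorphV Phi \o comorphV Psi).
- by move=> c a b; rewrite /= !comorph_linear.
- have [f1 fM] := comorph_monoid Phi; have [g1 gM] := comorph_monoid Psi.
  by split=> [|a b] /=; rewrite ?f1 ?g1 ?fM ?gM.
- by move=> a /=; rewrite !comorphK.
- by move=> a /=; rewrite !comorphVK.
Defined.

Definition autSpec_inv (Psi : autSpec) : autSpec.
Proof.
exists (comorphV Psi) (comorph Psi).
- move=> c a b; apply: (can_inj (@comorphK Psi)).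
  by rewrite comorph_linear !comorphVK.
- have [f1 fM] := comorph_monoid Psi.
  split=> [|a b]; apply: (can_inj (@comorphK Psi));
    by rewrite ?f1 ?fM !comorphVK.
- exact: comorphVK.
- exact: comorphK.
Defined.

Fact autSpec_mulA : associative autSpec_mul.
Proof. by move=> f g h; apply: autSpec_eq. Qed.
Fact autSpec_mul1 : left_id autSpec_one autSpec_mul.
Proof. by move=> f; apply: autSpec_eq. Qed.
Fact autSpec_mulr1 : right_id autSpec_one autSpec_mul.
Proof. by move=> f; apply: autSpec_eq. Qed.
Fact autSpec_mulV : left_inverse autSpec_one autSpec_inv autSpec_mul.
Proof. by move=> f; apply: autSpec_eq => a /=; rewrite comorphVK. Qed.
Fact autSpec_mulrV : right_inverse autSpec_one autSpec_inv autSpec_mul.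
Proof. by move=> f; apply: autSpec_eq => a /=; rewrite comorphK. Qed.

HB.instance Definition _ := isGroup.Build autSpec
  autSpec_mulA autSpec_mul1 autSpec_mulr1 autSpec_mulV autSpec_mulrV.

End AutSpec.

Section ComplementOfTheConic.
Variable k : fieldType.

Local Notation "f %:F" := (@FracField.tofrac _ f).
Local Notation P := {mpoly k[3]}.
Local Notation K := {fraction {mpoly k[3]}}.

Definition px : P := 'X_(@Ordinal 3 0 isT).
Definition py : P := 'X_(@Ordinal 3 1 isT).
Definition pz : P := 'X_(@Ordinal 3 2 isT).

Definition q0 : P := px * pz + py ^+ 2.

Fact X_homog (i : 'I_3) : ('X_i : P) \is 1.-homog.
Proof. by rewrite dhomogX /= mdeg1. Qed.

Lemma q0_homog : q0 \is 2.-homog.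
Proof.
apply: rpredD; first by apply: (dhomogM (X_homog _) (X_homog _)).
exact: (dhomogMn 2 (X_homog _)).
Qed.

Lemma q0_neq0 : q0 != 0.
Proof.
apply/eqP => /(congr1 (fun p : P => p.@[fun i => (i == 1%N :> nat)%:R])).
rewrite /q0 meval0 mevalD mevalM !mevalXU expr2 mevalM !mevalXU /=.
by rewrite mul0r mul1r add0r => /eqP; rewrite oner_eq0.
Qed.

(* S_0 = D_+(q0) is the affine open subscheme of Proj k[x, y, z] whose ring of
   functions is the degree 0 part of the localization k[x, y, z]_{q0}, here
   realized inside the fraction field of k[x, y, z]. *)
Definition OS0_pred : {pred K} := fun f =>
  `[< exists n (p : P), p \is (2 * n).-homog /\ f = p%:F / q0%:F ^+ n >].

Lemma q0F_neq0 : q0%:F != 0 :> K.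
Proof. by rewrite tofrac_eq0 q0_neq0. Qed.

Lemma q0X_homog n : q0 ^+ n \is (2 * n).-homog.
Proof.
exact: dhomogMn q0_homog.
Qed.

Fact OS0_subring : subring_closed OS0_pred.
Proof.
split.
- by apply/asboolP; exists 0%N, 1; rewrite muln0 dhomog1 tofrac1 divr1.
- move=> f g /asboolP[n [p [hp ->]]] /asboolP[m [r [hr ->]]]; apply/asboolP.
  exists (n + m)%N, (p * q0 ^+ m - r * q0 ^+ n); split.
    apply: rpredB; rewrite mulnDr; first by rewrite dhomogM ?q0X_homog.
    by rewrite addnC dhomogM ?q0X_homog.
  rewrite tofracB !tofracM !tofracXn exprD invfM mulrBl.
  have qn := expf_neq0 n q0F_neq0; have qm := expf_neq0 m q0F_neq0.
  congr (_ - _); first by rewrite mulrACA divff // mulr1.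
  by rewrite [X in _ = _ * _ * X]mulrC mulrACA divff // mulr1.
- move=> f g /asboolP[n [p [hp ->]]] /asboolP[m [r [hr ->]]]; apply/asboolP.
  exists (n + m)%N, (p * r); split; first by rewrite mulnDr dhomogM.
  by rewrite tofracM exprD invfM mulrACA.
Qed.

HB.instance Definition _ := GRing.isSubringClosed.Build K OS0_pred OS0_subring.

Record OS0 := MkOS0 { OS0_val :> K; OS0_valP : OS0_val \in OS0_pred }.

HB.instance Definition _ := [isSub for OS0_val].
HB.instance Definition _ := [Choice of OS0 by <:].
HB.instance Definition _ := [SubChoice_isSubComNzRing of OS0 by <:].

Definition constK (c : k) : K := (c%:MP : P)%:F.

HB.instance Definition _ :=
  GRing.RMorphism.copy constK (@FracField.tofrac P \o @mpolyC 3 k).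

Fact OS0_const_subproof (c : k) : constK c \in OS0_pred.
Proof.
apply/asboolP; exists 0%N, c%:MP; rewrite muln0 divr1; split=> //.
by rewrite -alg_mpolyC rpredZ ?dhomog1.
Qed.
Definition OS0_const (c : k) : OS0 := MkOS0 (OS0_const_subproof c).

Definition OS0_scale (c : k) (f : OS0) : OS0 := OS0_const c * f.

Fact OS0_scaleA a b f : OS0_scale a (OS0_scale b f) = OS0_scale (a * b) f.
Proof. by apply: val_inj; rewrite /= mulrA /constK mpolyCM tofracM. Qed.
Fact OS0_scale1 : left_id 1 OS0_scale.
Proof. by move=> f; apply: val_inj; rewrite /= /constK mpolyC1 tofrac1 mul1r. Qed.
Fact OS0_scaleDr : right_distributive OS0_scale +%R.
Proof. by move=> a f g; rewrite /OS0_scale mulrDr. Qed.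
Fact OS0_scaleDl f : {morph OS0_scale^~ f : a b / a + b}.
Proof.
by move=> a b; apply: val_inj; rewrite /= /constK mpolyCD tofracD mulrDl.
Qed.

HB.instance Definition _ := GRing.Zmodule_isLmodule.Build k OS0
  OS0_scaleA OS0_scale1 OS0_scaleDr OS0_scaleDl.

Fact OS0_scaleAl (a : k) (f g : OS0) : a *: (f * g) = (a *: f) * g.
Proof. exact: mulrA. Qed.

HB.instance Definition _ := GRing.Lmodule_isLalgebra.Build k OS0 OS0_scaleAl.
HB.instance Definition _ := GRing.Lalgebra_isComAlgebra.Build k OS0.

Definition AutS0 : groupType := autSpec OS0.

Definition AutA1 : groupType := autSpec {poly k}.

Fact x2q0_subproof : px%:F ^+ 2 / q0%:F \in OS0_pred.
Proof.
apply/asboolP; exists 1%N, (px ^+ 2); rewrite tofracXn expr1; split=> //.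
exact: (dhomogMn 2 (X_homog _)).
Qed.
Definition x2q0 : OS0 := MkOS0 x2q0_subproof.

(* The comorphism k[t] -> O(S_0), t |-> x^2 / q0, of rho_0 : S_0 -> A^1. *)
Definition rho0 : {poly k} -> OS0 := horner_alg x2q0.

(* rho_0 o Psi = psi o rho_0, written on comorphisms. *)
Definition AutS0_rho0 : set AutS0 :=
  [set Psi | exists psi : AutA1,
     forall p : {poly k}, comorph Psi (rho0 p) = rho0 (comorph psi p)].

(* The value of p at the coordinates F of a rational map [F_0 : F_1 : F_2]. *)
Definition subst_rat (F : 3.-tuple K) (p : P) : K := mmap constK (tnth F) p.

(* Psi is the restriction to S_0 of the rational map [F_0 : F_1 : F_2] from P^2
   to itself: the function p / q0^n is pulled back to p(F) / q0(F)^n. *)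
Definition restricts_to (F : 3.-tuple K) (Psi : AutS0) : Prop :=
  forall n (p : P) (f : OS0),
    p \is (2 * n).-homog -> OS0_val f = p%:F / q0%:F ^+ n ->
    OS0_val (comorph Psi f) = subst_rat F p / subst_rat F q0 ^+ n.

(* The projective coordinates of v |-> M v, on column vectors v = (x, y, z). *)
Definition lin_forms (M : GLmx k 3) : 3.-tuple P :=
  [tuple \sum_j M i j *: 'X_j | i < 3].

(* g is the linear automorphism [F_0 : F_1 : F_2] of P^2. *)
Definition given_by (g : PGL k 3) (F : 3.-tuple P) : Prop :=
  exists2 M, g = PGL_class M & lin_forms M = F.

Definition AutP2_Q0 : set (PGL k 3) :=
  [set g | exists2 M, g = PGL_class M &
     exists2 c : k, c != 0 & q0 \mPo lin_forms M = c *: q0].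

Definition p0 : 'cV[k]_3 := \col_i (i == 2 :> nat)%:R.

Definition AutP2_Q0_p0 : set (PGL k 3) :=
  AutP2_Q0 `&` [set g | exists2 M, g = PGL_class M &
     exists2 c : k, c != 0 & GLmx_val M *m p0 = c *: p0].

Definition restrict_S0 (H : set (PGL k 3)) : set AutS0 :=
  [set Psi | exists2 g, H g & exists2 F, given_by g F &
     restricts_to [tuple of map (@FracField.tofrac P) F] Psi].

Definition unip_map (b : k) : 3.-tuple P :=
  [tuple px; py + b *: px; pz - (2 * b) *: py - (b ^+ 2) *: px].

Definition torus_map (a : k) : 3.-tuple P :=
  [tuple a *: px; py; a^-1 *: pz].

Definition swap_map : 3.-tuple P := [tuple pz; - py; px].

Definition fibre_map (s : {poly k}) : 3.-tuple K :=
  let: sv := (map_poly constK s).[px%:F ^+ 2 / q0%:F] in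
  [tuple px%:F; py%:F + sv * px%:F;
         pz%:F - 2 * py%:F * sv - px%:F * sv ^+ 2].

End ComplementOfTheConic.

Arguments AutS0_rho0 : clear implicits.
Arguments AutP2_Q0 : clear implicits.
Arguments AutP2_Q0_p0 : clear implicits.

(* Main.v *)
(* Write u = x^2/q_0 and Y = y/x, so that O(S_0) is contained in k[u, u^-1, Y].
   Giving u and Y weights, the leading part of F = Phi^*(u) is, for an
   automorphism Phi, rigid: conjugating the translations Y |-> Y + T by Phi
   yields automorphisms of O(S_0)[T] fixing F, and their leading terms form a
   polynomial curve T |-> (al : be) on which the leading form of F is constant.
   For the weights (1, 0) this forces the form to be u^n times a constant or
   times c (Y - r)^(4n); an element of Aut(P^2, Q_0) reduces the second case to
   the first.  For the slope of the Newton polygon of F, b/a in lowest terms, one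
   obtains a curve be^a - r G al^(a + 4b) = h with h a nonzero constant, which is
   impossible if a > 1 (by Mason's argument with derivatives along T, or along u
   in the wild case); if a = 1 a fibred automorphism Y |-> Y + r u^b lowers n.  By
   induction F becomes a polynomial in u, so Aut(S_0) is generated by the two
   factors.  Conversely the letters of a reduced word exchange the two shapes of
   leading form, the fibred letters multiplying n by 1 + 4b, so a reduced word
   never fixes u. *)

Require Import Defs.
From HB Require Import structures.
From mathcomp Require Import all_boot all_order all_algebra.
From mathcomp Require Import mpoly.
From mathcomp Require Import boolp classical_sets.
From mathcomp Require Import ring zify.

Set Implicit Arguments.
Unset Strict Implicit.
Unset Printing Implicit Defensive.

(** * Amalgamated products *)

(** The obstacle is the arbitrary field. In positive characteristic an additive group action is not
    determined by a derivation, so the whole polynomial action in T is degenerated. Moreover k may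
    be finite or imperfect, so no special point is chosen: everything happens at a generic point of
    the plane, with leading coefficients in L = k(u, Y), a field in which k is algebraically closed.
    A leading form is then a single element of L, and the independence of u and Y recovers its
    coefficients. The number 4 is the degree of the rational normal quartic. O(S_0) is generated by
    five functions with leading forms u, uY, ..., uY^4; the limits of their images satisfy the
    equations of the cone over the quartic, whence the shape G al^(4 - l) be^l. The degree given to
    T is the extreme one for which some limit still depends on T, so the limit curve is not
    constant. This is what makes it rigid: at T = infinity every nonconstant factor of the form has
    to vanish at one and the same ratio, which is algebraic over k and hence lies in k. *)

Section Amalgam.
Local Open Scope group_scope.
Variables (G : groupType) (H1 H2 : set G).
Implicit Types (w : seq (bool * G)) (b : bool) (x y z g : G).

Definition factor b : set G := if b then H1 else H2.

Definition word_prod w : G := foldr (fun l g => l.2 * g) 1 w.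

Fixpoint is_word w : Prop := if w is l :: t then factor l.1 l.2 /\ is_word t else True.

(** The second condition says that no letter lies in the amalgamated intersection. The empty word is
    reduced. *)
Fixpoint reduced w : Prop := if w is l :: t then
  [/\ factor l.1 l.2, ~ factor (~~ l.1) l.2, (if t is l' :: _ then l'.1 != l.1 else true)
    & reduced t] else True.

Lemma word_prod_cat w w' : word_prod (w ++ w') = word_prod w * word_prod w'.
Proof. by elim: w => [|l t IH] /=; rewrite ?mul1g // IH mulgA. Qed.

Lemma is_word_cat w w' : is_word w -> is_word w' -> is_word (w ++ w').
Proof. by move=> + h'; elim: w => [|l t IH] //= [hl /IH]. Qed.

Hypotheses (sub1 : is_subgroup H1) (sub2 : is_subgroup H2).

Lemma factor_subgroup b : is_subgroup (factor b).
Proof. by case: b. Qed.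

Definition word_inv w := rev [seq (l.1, l.2^-1) | l <- w].

Lemma is_word_inv w : is_word w -> is_word (word_inv w).
Proof.
elim: w => [|l t IH] //= [hl /IH ht]; rewrite /word_inv /= rev_cons -cats1.
by apply: is_word_cat => //; split=> //; have [_ _] := factor_subgroup l.1; apply.
Qed.

Lemma word_prod_inv w : word_prod (word_inv w) = (word_prod w)^-1.
Proof.
elim: w => [|l t IH] /=; first by rewrite invg1.
by rewrite /word_inv /= rev_cons -cats1 word_prod_cat IH /= mulg1 invgM.
Qed.

Definition generated : set G := [set g | exists2 w, is_word w & word_prod w = g].

Lemma generated_subgroup : is_subgroup generated.
Proof.
split; first by exists [::].
- move=> _ _ [w hw <-] [w' hw' <-]; exists (w ++ w'); first exact: is_word_cat.
  exact: word_prod_cat.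
- move=> _ [w hw <-]; exists (word_inv w); first exact: is_word_inv.
  exact: word_prod_inv.
Qed.

Hypothesis generation : forall g, generated g.
Hypothesis reduced_neq1 : forall w, reduced w -> w <> [::] -> word_prod w <> 1.

Section UniversalProperty.
Variables (L : groupType) (f1 f2 : G -> L).
Hypotheses (f1M : morph_on H1 f1) (f2M : morph_on H2 f2)
  (f12 : forall a, H1 a -> H2 a -> f1 a = f2 a).

Definition factor_map b := if b then f1 else f2.
Arguments factor_map : simpl never.
Local Notation f := factor_map.

Definition word_image w : L := foldr (fun l (v : L) => f l.1 l.2 * v) 1 w.

Let fM b x y : factor b x -> factor b y -> f b (x * y) = f b x * f b y.
Proof. by case: b; [exact: f1M|exact: f2M]. Qed.

Let f_eq b b' x : factor b x -> factor b' x -> f b x = f b' x.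
Proof. by case: b b' => [] [] // h h'; rewrite /factor_map f12. Qed.

Let f1E b : f b 1 = 1.
Proof.
have [h1 _ _] := factor_subgroup b.
by apply: (mulgI (f b 1)); rewrite -fM // !mulg1.
Qed.

Lemma word_image_cat w w' : word_image (w ++ w') = word_image w * word_image w'.
Proof. by elim: w => [|l t IH] /=; rewrite ?mul1g // IH mulgA. Qed.

Lemma word_image_inv w : is_word w -> word_image (word_inv w) = (word_image w)^-1.
Proof.
elim: w => [|l t IH] /=; first by rewrite invg1.
move=> [hl /IH ht]; rewrite /word_inv /= rev_cons -cats1 word_image_cat ht /= mulg1 invgM.
have [_ _ hV] := factor_subgroup l.1; congr (_ * _).
by apply: (mulgI (f l.1 l.2)); rewrite -fM ?mulgV ?f1E //; exact: hV.
Qed.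

(** An element of the intersection is carried in front of the reduced word, because a new letter on
    its left, from either factor, can absorb it. The image in L is carried along, since it is not
    yet known to depend on the product alone. *)
Lemma normal_form w : is_word w -> exists c w', [/\ factor true c, factor false c, reduced w',
  word_prod w = c * word_prod w' & word_image w = f true c * word_image w'].
Proof.
have [h11 _ _] := sub1; have [h21 _ _] := sub2.
elim: w => [|[b x] t IH] /=.
  by move=> _; exists 1, [::]; split=> //=; rewrite ?mul1g // mulg1 (f1E true).
move=> [hx /IH[c [w' [c1 c2 rw -> ->]]]].
have cb b' : factor b' c by case: b'.
have [_ bM _] := factor_subgroup b.
have hy := bM _ _ hx (cb b); set y := x * c in hy.
have eW : f b x * (f true c * word_image w') = f b y * word_image w'.
  by rewrite /y fM // mulgA (f_eq (cb true) (cb b)).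
have both z : factor b z -> factor (~~ b) z -> factor true z /\ factor false z.
  by case: (b).
rewrite eW mulgA -/y; clearbody y.
(* The letter y may fall into the intersection and become the carried element; otherwise it is put
   in front, unless the word starts in the same factor, when the two letters merge and the question
   arises again for their product. *)
have [hy'|hy'] := pselect (factor (~~ b) y).
  have [y1 y2] := both y hy hy'.
  by exists y, w'; split=> //; rewrite (f_eq hy y1).
have single t' : (if t' is l' :: _ then l'.1 != b else true) -> reduced t' ->
    exists c0 w0, [/\ factor true c0, factor false c0, reduced w0,
    y * word_prod t' = c0 * word_prod w0 & f b y * word_image t' = f true c0 * word_image w0].
  move=> alt rt; exists 1, ((b, y) :: t'); split=> //=; first by split=> //; case: (t') alt.
    by rewrite mul1g.
  by rewrite (f1E true) mul1g.
case: w' rw {eW} => [|[b' z] w''] rw; first exact: single.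
have [eb|nb] := eqVneq b' b; last by apply: single.
move: rw => /= [hz hz' alt rw]; rewrite eb in hz hz' alt.
have hyz := bM _ _ hy hz.
have [e|ne] := pselect (factor (~~ b) (y * z)).
  have [z1 z2] := both _ hyz e; exists (y * z), w''; split=> //; first by rewrite mulgA.
  by rewrite eb mulgA -fM // (f_eq hyz z1).
exists 1, ((b, y * z) :: w''); split=> //=; first by rewrite mul1g mulgA.
by rewrite (f1E true) mul1g eb mulgA fM.
Qed.

(** If the reduced part were nonempty, the carried element could be absorbed into its first letter,
    giving a nonempty reduced word of product 1 against [reduced_neq1]. *)
Lemma word_image1 w : is_word w -> word_prod w = 1 -> word_image w = 1.
Proof.
move=> /normal_form[c [w' [c1 c2 rw -> ->]]].
case: w' rw => [_|[b z] t] /=; first by rewrite mulg1 => ->; rewrite (f1E true) mulg1.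
move=> [hz hz' alt rt] e; exfalso.
have cb b' : factor b' c by case: b'.
apply: (@reduced_neq1 ((b, c * z) :: t)) => //=; last by rewrite -mulgA.
have [_ bM _] := factor_subgroup b; have [_ bM' bV'] := factor_subgroup (~~ b).
split=> //; first exact: bM.
by move=> h; apply: hz'; rewrite -[z](mulKg c); apply: bM' => //; exact: bV'.
Qed.

Lemma word_image_eq w w' : is_word w -> is_word w' -> word_prod w = word_prod w' ->
  word_image w = word_image w'.
Proof.
move=> hw hw' e; have hV := is_word_inv hw'.
have := word_image1 (is_word_cat hw hV).
rewrite word_prod_cat word_prod_inv e mulgV word_image_cat word_image_inv // => /(_ erefl) h.
by rewrite -[word_image w]mulg1 -(mulVg (word_image w')) mulgA h mul1g.
Qed.

Lemma amalgam_universal : exists! h : G -> L, [/\ {morph h : a b / a * b},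
  forall a, H1 a -> h a = f1 a & forall a, H2 a -> h a = f2 a].
Proof.
have /choice[wd wdP] : forall g, exists w, is_word w /\ word_prod w = g.
  by move=> g; have [w hw e] := generation g; exists w.
have hE w : is_word w -> word_image (wd (word_prod w)) = word_image w.
  by move=> hw; have [h1 h2] := wdP (word_prod w); exact: word_image_eq.
exists (fun g => word_image (wd g)); split.
  split=> [a b|a ha|a ha].
  - have [ha ea] := wdP a; have [hb eb] := wdP b.
    by rewrite -{1}ea -{1}eb -word_prod_cat hE ?word_image_cat //; exact: is_word_cat.
  - by have := @hE [:: (true, a)] (conj ha I); rewrite /= !mulg1.
  - by have := @hE [:: (false, a)] (conj ha I); rewrite /= !mulg1.
move=> h [hM h1 h2]; apply/funext => g; have [hw e] := wdP g; rewrite -{2}e.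
have hone : h 1 = 1 by apply: (mulgI (h 1)); rewrite -hM !mulg1.
elim: (wd g) hw => [|[b x] t IH] /=; first by rewrite hone.
by move=> [hx /IH ->]; rewrite hM; congr (_ * _); case: b hx => hx; [rewrite (h1 _ hx)|rewrite (h2 _ hx)].
Qed.

End UniversalProperty.

Lemma amalgam_of_reduced : is_amalgam H1 H2.
Proof. by split=> // L f1 f2 h1 h2 h12; exact: amalgam_universal. Qed.

End Amalgam.

Import Order.TTheory GRing.Theory Num.Theory.
Local Open Scope ring_scope.
Local Open Scope classical_set_scope.

(** * Rational functions and derivations *)

Section FractionField.
Variable R : idomainType.
Local Notation "f %:F" := (@FracField.tofrac _ f).

Lemma fraction_numden (x : {fraction R}) :
  x = (\n_(repr x))%:F / (\d_(repr x))%:F.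
Proof.
have d0 : (\d_(repr x))%:F != 0 by rewrite tofrac_eq0 denom_ratioP.
apply: (mulIf d0); rewrite divfK // -{1}[x]reprK.
move: (repr x) d0 => r _; unlock FracField.tofrac.
rewrite -[LHS]FracField.pi_mul; apply/eqmodP; rewrite /= FracField.equivfE.
rewrite /FracField.mulf !numden_Ratio ?mulf_neq0 ?oner_eq0 ?denom_ratioP //.
by rewrite !mulr1 mulrC.
Qed.

Lemma fraction_ind (P : {fraction R} -> Prop) :
  (forall n d, d != 0 -> P (n%:F / d%:F)) -> forall x, P x.
Proof. by move=> h x; rewrite (fraction_numden x); apply/h/denom_ratioP. Qed.

Lemma eq_fraction (n d n' d' : R) : d != 0 -> d' != 0 ->
  (n%:F / d%:F == n'%:F / d'%:F) = (n * d' == n' * d).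
Proof.
by move=> d0 d0'; rewrite eqr_div ?tofrac_eq0 // -!tofracM tofrac_eq.
Qed.

End FractionField.

Section RationalFunctions.
Variable F : fieldType.
Local Notation "f %:F" := (@FracField.tofrac _ f).
Local Notation F_X := {fraction {poly F}}.

Lemma fraction_coprime (x : F_X) :
  exists n d : {poly F}, [/\ d != 0, coprimep n d & x = n%:F / d%:F].
Proof.
elim/fraction_ind: x => n d d0.
have g0 : gcdp n d != 0 by rewrite gcdp_eq0 negb_and d0 orbT.
have d0' : d %/ gcdp n d != 0 by rewrite dvdp_div_eq0 ?dvdp_gcdr.
exists (n %/ gcdp n d), (d %/ gcdp n d); split=> //.
  by apply: coprimep_div_gcd; rewrite d0 orbT.
have := divpK (dvdp_gcdr n d); have := divpK (dvdp_gcdl n d).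
move: (gcdp n d) (n %/ gcdp n d) (d %/ gcdp n d) d0' => g n' d' d0' en ed.
by apply/eqP; rewrite eq_fraction // -en -ed mulrAC -mulrA.
Qed.

Definition const_frac (c : F) : F_X := (c%:P)%:F.
HB.instance Definition _ :=
  GRing.RMorphism.copy const_frac (@FracField.tofrac {poly F} \o polyC).

Let cancel_aux (K : fieldType) (a b c d : K) :
  d != 0 -> a * b * c = c * d * (a * (b / d)).
Proof. by move=> d0; field. Qed.

(** The rational root theorem over F[X]: clearing denominators in p(n/d) = 0 shows that d divides a
    power of n, so d is constant by coprimality. A nonconstant polynomial substituted in a nonzero p
    does not give 0. *)
Lemma algebraic_rational_function (x : F_X) (p : {poly F}) :
  p != 0 -> (map_poly const_frac p).[x] = 0 -> exists c, x = const_frac c.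
Proof.
have [n [d [d0 co ->]]] := fraction_coprime x => p0 px0.
have d0F : d%:F != 0 by rewrite tofrac_eq0.
have size_p : (size p).-1.+1 = size p by rewrite prednK ?size_poly_gt0.
have e : \sum_(i < size p) p`_i *: n ^+ i * d ^+ ((size p).-1 - i) = 0.
  apply/eqP; rewrite -tofrac_eq0; apply/eqP.
  rewrite -[RHS](mulr0 (d%:F ^+ (size p).-1)) -px0 horner_coef.
  rewrite size_map_poly mulr_sumr rmorph_sum; apply: eq_bigr => i _.
  rewrite coef_map expr_div_n /= -mul_polyC !tofracM !tofracXn /const_frac /=.
  have le_i : (i <= (size p).-1)%N by rewrite -ltnS size_p.
  rewrite -{2}(subnK le_i) exprD.
  have di : d%:F ^+ i != 0 by rewrite expf_neq0.
  exact: cancel_aux.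
have dvd_d : d %| n ^+ (size p).-1.
  have : d %| \sum_(i < size p) p`_i *: n ^+ i * d ^+ ((size p).-1 - i).
    by rewrite e dvdp0.
  rewrite -size_p big_ord_recr /= subnn expr0 mulr1 dvdp_addr.
    by rewrite dvdpZr // -/(lead_coef p) lead_coef_eq0.
  apply: (big_ind (fun q => d %| q)) => [|q r dq dr|i _]; rewrite ?dvdp0 //.
    exact: dvdp_add.
  by rewrite dvdp_mull // -{1}[d]expr1 dvdp_exp2l // subn_gt0.
have : size d == 1.
  rewrite -(dvdp1 d) -(@Gauss_dvdpr _ 1 (n ^+ (size p).-1)) ?mulr1 //.
  by rewrite coprimep_sym; exact: coprimep_expl.
move=> /size_poly1P[c c0 ed].
have en : n%:F / d%:F = (c^-1 *: n)%:F.
  apply: (mulIf d0F); rewrite divfK // ed -tofracM mulrC mul_polyC scalerA.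
  by rewrite divff ?scale1r.
rewrite {}en {e dvd_d co d0 d0F ed} in px0 *; set q := c^-1 *: n in px0 *.
have : p \Po q == 0.
  rewrite -tofrac_eq0 -px0 /comp_poly -horner_map /= -map_poly_comp.
  exact/eqP.
case: (leqP (size q) 1) => [/size1_polyC ->|q1]; first by exists q`_0.
by rewrite comp_poly_eq0 // (negbTE p0).
Qed.

End RationalFunctions.

Section FractionDerivation.
Variable F : fieldType.
Local Notation "f %:F" := (@FracField.tofrac _ f).
Local Notation F_X := {fraction {poly F}}.

(** The quotient rule on the representative chosen by [repr]; [frac_derivE] shows that any other
    fraction may be used. *)
Definition frac_deriv (x : F_X) : F_X :=
  let n := \n_(repr x) in let d := \d_(repr x) in
  (n^`() * d - n * d^`())%:F / (d ^+ 2)%:F.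

Lemma frac_derivE (n d : {poly F}) : d != 0 ->
  frac_deriv (n%:F / d%:F) = (n^`() * d - n * d^`())%:F / (d ^+ 2)%:F.
Proof.
move=> d0; rewrite /frac_deriv.
have := fraction_numden (n%:F / d%:F).
move: (\n_ _) (\d_ _) (denom_ratioP (repr (n%:F / d%:F))) => n1 d1 d10.
move=> /eqP; rewrite eq_fraction // => /eqP e.
apply/eqP; rewrite eq_fraction ?expf_neq0 //; apply/eqP.
have e' : n^`() * d1 + n * d1^`() = n1^`() * d + n1 * d^`().
  by rewrite -!derivM e.
move: (n^`()) (n1^`()) (d^`()) (d1^`()) e' => n' n1' d' d1' e'.
have -> : (n1' * d1 - n1 * d1') * d ^+ 2
    = (n1' * d) * (d1 * d) - (n1 * d) * d1' * d by ring.
have -> : n1' * d = n' * d1 + n * d1' - n1 * d' by rewrite e' addrK.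
have -> : (n' * d1 + n * d1' - n1 * d') * (d1 * d) - n1 * d * d1' * d
   = n' * d1 ^+ 2 * d + n * d1 * d * d1' - (n1 * d) * d' * d1
       - (n1 * d) * d1' * d by ring.
by rewrite -e; ring.
Qed.

Lemma frac_deriv_const (c : F) : frac_deriv (const_frac c) = 0.
Proof.
rewrite /const_frac /= -[_%:F]divr1 -[1]tofrac1 frac_derivE ?oner_eq0 //.
by rewrite derivC derivE mul0r mulr0 subrr tofrac0 mul0r.
Qed.

Lemma frac_derivX : frac_deriv 'X%:F = 1.
Proof.
rewrite -['X%:F]divr1 -{1}[1]tofrac1 frac_derivE ?oner_eq0 //.
by rewrite derivX (derivC 1) mulr1 mulr0 subr0 expr1n tofrac1 divr1.
Qed.

Let addE (K : fieldType) (a b c d : K) :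
  b != 0 -> d != 0 -> a / b + c / d = (a * d + c * b) / (b * d).
Proof. by move=> b0 d0; field; apply/andP. Qed.

Lemma frac_derivD : {morph frac_deriv : x y / x + y}.
Proof.
move=> x y; elim/fraction_ind: x => n d d0; elim/fraction_ind: y => m e e0.
have d0F : d%:F != 0 by rewrite tofrac_eq0.
have e0F : e%:F != 0 by rewrite tofrac_eq0.
have d0F2 : (d ^+ 2)%:F != 0 by rewrite tofrac_eq0 expf_neq0.
have e0F2 : (e ^+ 2)%:F != 0 by rewrite tofrac_eq0 expf_neq0.
rewrite (addE _ _ d0F e0F) -!tofracM -tofracD.
rewrite (frac_derivE _ d0) (frac_derivE _ e0) (frac_derivE _ (mulf_neq0 d0 e0)).
rewrite (addE _ _ d0F2 e0F2) -!tofracM -tofracD.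
by congr (_%:F / _%:F); rewrite ?derivD ?derivM; ring.
Qed.

Lemma frac_derivM (x y : F_X) :
  frac_deriv (x * y) = frac_deriv x * y + x * frac_deriv y.
Proof.
elim/fraction_ind: x => n d d0; elim/fraction_ind: y => m e e0.
have d0F : d%:F != 0 by rewrite tofrac_eq0.
have e0F : e%:F != 0 by rewrite tofrac_eq0.
have mulE (a b a' b' : F_X) : a / b * (a' / b') = (a * a') / (b * b').
  by rewrite invfM mulrACA.
have d0F2 : (d ^+ 2)%:F != 0 by rewrite tofrac_eq0 expf_neq0.
have e0F2 : (e ^+ 2)%:F != 0 by rewrite tofrac_eq0 expf_neq0.
rewrite mulE -!tofracM.
rewrite (frac_derivE _ d0) (frac_derivE _ e0) (frac_derivE _ (mulf_neq0 d0 e0)).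
rewrite !mulE -!tofracM.
rewrite (addE _ _ (_ : (d ^+ 2 * e)%:F != 0) (_ : (d * e ^+ 2)%:F != 0));
  rewrite ?tofrac_eq0 ?mulf_neq0 ?expf_neq0 //.
rewrite -!tofracM -tofracD; apply/eqP.
rewrite eq_fraction ?mulf_neq0 ?expf_neq0 ?mulf_neq0 //; apply/eqP.
by rewrite !derivM; ring.
Qed.

End FractionDerivation.

(** * Polynomial curves on which a form is constant *)

Section PolynomialCurves.
Variable L : fieldType.
Implicit Types (p q al be G : {poly L}).

(** A point of the affine cone over the rational normal quartic with values in L[T]. The ratio be /
    al is P_1 / P_0 in lowest terms, and unique factorization in L[T] gives the rest without any
    root extraction. *)
Lemma veronese_parametrization (P : nat -> {poly L}) :
  P 0%N != 0 -> P 0%N * P 2%N = P 1%N ^+ 2 -> P 0%N * P 3%N = P 1%N * P 2%N ->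
  P 0%N * P 4%N = P 2%N ^+ 2 ->
  exists G al be, [/\ coprimep al be, al != 0 &
    forall l, (l <= 4)%N -> P l = G * al ^+ (4 - l) * be ^+ l].
Proof.
move=> P00 e2 e3 e4.
have g0 : gcdp (P 0%N) (P 1%N) != 0 by rewrite gcdp_eq0 negb_and P00.
have := divpK (dvdp_gcdr (P 0%N) (P 1%N)).
have := divpK (dvdp_gcdl (P 0%N) (P 1%N)).
have : coprimep (P 0%N %/ gcdp (P 0%N) (P 1%N)) (P 1%N %/ gcdp (P 0%N) (P 1%N)).
  by rewrite coprimep_div_gcd // P00.
set g := gcdp _ _ in g0 *; move: (P 0%N %/ g) (P 1%N %/ g) => al be co ea eb.
have al0 : al != 0 by apply: contraNneq P00 => al0; rewrite -ea al0 mul0r.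
(* By coprimality each relation yields one more factor al: the gcd g of P_0 and P_1 becomes al g1,
   then al^2 g2, then al^3 G, so that P_0 = g al ends as G al^4. *)
have dvd_al q r : al * q = r * be -> exists s, r = al * s.
  move=> e; have : al %| r * be by rewrite -e dvdp_mulr.
  by rewrite Gauss_dvdpl // => /divpK <-; eexists; rewrite mulrC.
have {}e2 : al * P 2%N = (g * be) * be.
  by apply: (mulIf g0); rewrite mulrAC ea e2 -eb; ring.
have [gb1 egb] := dvd_al _ _ e2.
have [g1 eg1] : exists s, g = al * s by apply: (dvd_al gb1).
have P2E : P 2%N = g1 * be ^+ 2.
  by apply: (mulfI al0); rewrite e2 eg1; ring.
have g10 : g1 != 0 by apply: contraNneq g0 => z; rewrite eg1 z mulr0.
have {}e3 : al * P 3%N = (g1 * be ^+ 2) * be.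
  by apply: (mulIf g0); rewrite mulrAC ea e3 -eb P2E; ring.
have [gb2 egb2] := dvd_al _ _ e3.
have [gb3 egb3] : exists s, g1 * be = al * s.
  by apply: (dvd_al gb2); rewrite -egb2; ring.
have [g2 eg2] : exists s, g1 = al * s by apply: (dvd_al gb3).
have P3E : P 3%N = g2 * be ^+ 3.
  by apply: (mulfI al0); rewrite e3 eg2; ring.
have {}e4 : al * P 4%N = g2 * be ^+ 3 * be.
  have ag : al * g1 != 0 by rewrite mulf_neq0.
  by apply: (mulIf ag); rewrite -eg1 mulrAC ea e4 P2E eg1 eg2; ring.
have [b1 eb1] := dvd_al _ _ e4.
have [b2 eb2] : exists s, g2 * be ^+ 2 = al * s.
  by apply: (dvd_al b1); rewrite -eb1; ring.
have [b3 eb3] : exists s, g2 * be = al * s.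
  by apply: (dvd_al b2); rewrite -eb2; ring.
have [G eG] : exists s, g2 = al * s by apply: (dvd_al b3).
exists G, al, be; split=> //; case=> [|[|[|[|[|//]]]]] _.
- by rewrite -ea eg1 eg2 eG; ring.
- by rewrite -eb eg1 eg2 eG; ring.
- by rewrite P2E eg2 eG; ring.
- by rewrite P3E eG; ring.
- by apply: (mulfI al0); rewrite e4 eG; ring.
Qed.

Definition is_const p := (size p <= 1)%N.

Lemma is_constM p q : p * q != 0 -> is_const (p * q) -> is_const p /\ is_const q.
Proof.
rewrite mulf_eq0 negb_or => /andP[p0 q0]; rewrite /is_const size_mul //.
move: p0 q0; rewrite -!size_poly_gt0; case: (size p) (size q) => [//|a] [//|b] _ _.
by rewrite addSn addnS /= => h; split; lia.
Qed.

Lemma is_constX p n : (0 < n)%N -> is_const (p ^+ n) -> is_const p.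
Proof.
case: n => // n _; have [->|p0] := eqVneq p 0; first by rewrite /is_const size_poly0.
by rewrite exprS => /is_constM[]//; rewrite -exprS expf_neq0.
Qed.

Lemma is_constME p q : is_const p -> is_const q -> is_const (p * q).
Proof. by move=> /size1_polyC-> /size1_polyC->; rewrite -polyCM /is_const size_polyC; case: eqP. Qed.

Lemma is_constXE p n : is_const p -> is_const (p ^+ n).
Proof. by move=> /size1_polyC->; rewrite -polyC_exp /is_const size_polyC; case: eqP. Qed.

Lemma coefM_top p q m n : (size p <= m.+1)%N -> (size q <= n.+1)%N ->
  (p * q)`_(m + n) = p`_m * q`_n.
Proof.
move=> sp sq; rewrite coefM.
have lt : (m < (m + n).+1)%N by lia.
rewrite (bigD1 (Ordinal lt)) //= addKn big1 ?addr0 // => i ne.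
have ne' : i != m :> nat by [].
case: (ltngtP i m) ne' => // h _.
  by rewrite [q`__]nth_default ?mulr0 // (leq_trans sq) //; lia.
by rewrite [p`__]nth_default ?mul0r // (leq_trans sp).
Qed.

Lemma size_exp_top p m n : (size p <= m.+1)%N -> (size (p ^+ n) <= (m * n).+1)%N.
Proof. by move=> sp; rewrite (leq_trans (size_poly_exp_leq _ _)) // ltnS leq_mul2r -ltnS; lia. Qed.

Lemma coefX_top p m n : (size p <= m.+1)%N -> (p ^+ n)`_(m * n) = p`_m ^+ n.
Proof.
move=> sp; elim: n => [|n IH]; first by rewrite muln0 !expr0 coef1.
by rewrite mulnS !exprS coefM_top ?IH // size_exp_top.
Qed.

End PolynomialCurves.

Section BinaryForms.
Variables (k L : fieldType) (j : {rmorphism k -> L}).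
Implicit Types (al be : {poly L}) (c : {poly k}).
Local Notation "f %:F" := (@FracField.tofrac _ f).

(* The form of degree m whose dehomogenization is c, at (al : be). *)
Definition homogenize c m al be : {poly L} :=
  \sum_(i < m.+1) (j c`_i)%:P * al ^+ (m - i) * be ^+ i.

Let cancel_aux (K : fieldType) (a b c d : K) :
  d != 0 -> a * b * c = b * d * (a * (c / d)).
Proof. by move=> d0; field. Qed.

Let exprBD (R : pzSemiRingType) (x : R) i m : (i <= m)%N ->
  x ^+ m = x ^+ (m - i) * x ^+ i.
Proof. by move=> h; rewrite -exprD subnK. Qed.

Lemma homogenizeE c m al be : al != 0 -> (size c <= m.+1)%N ->
  (homogenize c m al be)%:F = al%:F ^+ m *
    (map_poly (@FracField.tofrac _ \o polyC \o j) c).[be%:F / al%:F]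
   :> {fraction {poly L}}.
Proof.
move=> al0 sc; have al0F : al%:F != 0 by rewrite tofrac_eq0.
rewrite (horner_coef_wide (n := m.+1)); last first.
  by rewrite (leq_trans (size_poly _ _)).
rewrite /homogenize rmorph_sum mulr_sumr; apply: eq_bigr => i _.
have le_i : (i <= m)%N by rewrite -ltnS.
rewrite coef_map /= !tofracM !tofracXn expr_div_n.
rewrite (exprBD _ le_i).
exact: cancel_aux (expf_neq0 _ al0F).
Qed.


Lemma homogenizeM c1 c2 m1 m2 al be : al != 0 ->
  (size c1 <= m1.+1)%N -> (size c2 <= m2.+1)%N ->
  homogenize (c1 * c2) (m1 + m2) al be =
  homogenize c1 m1 al be * homogenize c2 m2 al be.
Proof.
move=> al0 s1 s2; apply/eqP; rewrite -(tofrac_eq) tofracM !homogenizeE //.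
  by rewrite rmorphM hornerM exprD mulrACA.
by rewrite (leq_trans (size_polyMleq _ _)) //; lia.
Qed.

Lemma homogenize_XsubC r m al be : al != 0 ->
  homogenize (('X - r%:P) ^+ m) m al be = (be - (j r) *: al) ^+ m.
Proof.
move=> al0; apply/eqP; rewrite -(tofrac_eq) !homogenizeE //.
  rewrite rmorphXn /= horner_exp rmorphB /= map_polyX map_polyC /=.
  rewrite hornerXsubC -exprMn mulrBr mulrCA mulfV ?tofrac_eq0 // mulr1.
  by rewrite tofracXn tofracB -mul_polyC tofracM [al%:F * _]mulrC.
by rewrite size_exp_XsubC.
Qed.

Lemma coef_homogenize c m al be N :
  (size al <= N.+1)%N -> (size be <= N.+1)%N ->
  (homogenize c m al be)`_(N * m) =
  \sum_(i < m.+1) j c`_i * al`_N ^+ (m - i) * be`_N ^+ i.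
Proof.
move=> sa sb; rewrite /homogenize coef_sum; apply: eq_bigr => i _.
have le_i : (i <= m)%N by rewrite -ltnS.
have -> : (N * m = N * (m - i) + N * i)%N by rewrite -mulnDr subnK.
rewrite -mulrA coefCM coefM_top ?size_exp_top //.
by rewrite !coefX_top // mulrA.
Qed.

Lemma horner_homogenize c m (a b : L) : a != 0 -> (size c <= m.+1)%N ->
  \sum_(i < m.+1) j c`_i * a ^+ (m - i) * b ^+ i = a ^+ m * (map_poly j c).[b / a].
Proof.
move=> a0 sc; rewrite (horner_coef_wide (n := m.+1)); last first.
  by rewrite (leq_trans (size_poly _ _)).
rewrite mulr_sumr; apply: eq_bigr => i _; rewrite coef_map.
have le_i : (i <= m)%N by rewrite -ltnS.
rewrite expr_div_n (exprBD _ le_i).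
exact: cancel_aux (expf_neq0 _ a0).
Qed.

Hypothesis algebraic_const : forall (x : L) (p : {poly k}),
  p != 0 -> (map_poly j p).[x] = 0 -> exists a, x = j a.

(* At a pole of (al, be) the form vanishes at the ratio of the leading
   coefficients; that ratio is algebraic over k, and it is the same for all
   the factors of the form. *)
Lemma constant_form c m al be : (0 < m)%N -> (size c <= m.+1)%N -> al != 0 ->
  ~~ (is_const al && is_const be) ->
  homogenize c m al be != 0 -> is_const (homogenize c m al be) ->
  (exists c0 : k, c = c0%:P) \/ (exists r c0 : k, c = c0 *: ('X - r%:P) ^+ m).
Proof.
move=> m0 sc al0 nc H0 Hc.
have c0 : c != 0.
  apply: contraNneq H0 => ->; rewrite /homogenize big1 // => i _.
  by rewrite coef0 rmorph0 !mul0r.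
have coefHc d : (0 < d)%N -> (homogenize c m al be)`_d = 0.
  by move=> d0; rewrite nth_default // (leq_trans Hc).
(* When be has the larger degree, T = infinity goes to (0 : 1), and the leading coefficient of c
   alone contributes in the highest degree; it cannot cancel, so c has to be constant. *)
have [lt|le] := ltnP (size al) (size be).
  left; have [c1|c1] := leqP (size c) 1; first by exists c`_0; exact: size1_polyC.
  set M := (size al).-1; set N := (size be).-1; set i0 := (size c).-1.
  have sa : size al = M.+1 by rewrite prednK // size_poly_gt0.
  have sb : size be = N.+1 by rewrite prednK // (leq_ltn_trans _ lt).
  have sci : size c = i0.+1 by rewrite prednK // ltnW.
  have MN : (M < N)%N by move: lt; rewrite sa sb.
  have i00 : (0 < i0)%N by move: c1; rewrite sci.
  have i0m : (i0 <= m)%N by move: sc; rewrite sci.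
  have N0 : (0 < N)%N by rewrite (leq_ltn_trans _ MN).
  have idx0 : (0 < M * (m - i0) + N * i0)%N by rewrite addn_gt0 !muln_gt0 N0 i00 orbT.
  have /eqP := coefHc _ idx0; rewrite /homogenize coef_sum.
  have lt0 : (i0 < m.+1)%N by [].
  rewrite (bigD1 (Ordinal lt0)) //= big1 ?addr0 => [|i ne]; last first.
    have ne' : i != i0 :> nat by [].
    have im : (i <= m)%N by rewrite -ltnS.
    case: (ltngtP i i0) ne' => // h _; last first.
      by rewrite [c`_i]nth_default ?sci // rmorph0 !mul0r coef0.
    rewrite -mulrA coefCM [(al ^+ _ * _)`__]nth_default ?mulr0 //.
    rewrite (leq_trans (size_polyMleq _ _)) //.
    have := @size_exp_top _ al M (m - i); rewrite sa => /(_ (leqnn _)).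
    have := @size_exp_top _ be N i; rewrite sb => /(_ (leqnn _)).
    move: (size (al ^+ _)) (size (be ^+ _)) => x y hx hy.
    have : (M * (m - i) + N * i < M * (m - i0) + N * i0)%N.
      have -> : (m - i = (m - i0) + (i0 - i))%N by lia.
      rewrite mulnDr -addnA ltn_add2l -{2}(subnK (ltnW h)) mulnDr ltn_add2r.
      by rewrite ltn_mul2r MN andbT subn_gt0.
    by lia.
  rewrite -mulrA coefCM coefM_top ?size_exp_top ?sa ?sb //.
  rewrite !coefX_top ?sa ?sb // !mulf_eq0 fmorph_eq0 !expf_eq0.
  rewrite -[c`_i0]/(lead_coef c) lead_coef_eq0 (negPf c0) /=.
  rewrite -[al`_M]/(lead_coef al) -[be`_N]/(lead_coef be) !lead_coef_eq0.
  by rewrite (negPf al0) -size_poly_eq0 sb !andbF.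
right; set N := (size al).-1.
have sa : size al = N.+1 by rewrite prednK // size_poly_gt0.
have sb : (size be <= N.+1)%N by rewrite -sa.
have N0 : (0 < N)%N.
  move: nc; rewrite /is_const; apply: contraNltn; rewrite leqn0 => /eqP N0.
  by rewrite sa N0 /= (leq_trans sb) // N0.
have a0 : al`_N != 0 by rewrite -[al`_N]/(lead_coef al) lead_coef_eq0.
(* In the other case al has degree N and be at most N, so the coefficient of T^(N m) is al_N^m
   c(be_N / al_N), where be_N may be 0. This ratio is therefore a root of c. *)
have := coefHc (N * m)%N; rewrite muln_gt0 N0 m0 => /(_ isT)/eqP.
rewrite coef_homogenize ?sa // horner_homogenize // mulf_eq0 expf_eq0.
rewrite (negPf a0) andbF /= => /eqP rt.
have [r er] := algebraic_const c0 rt.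
(* The root r is removed with its full multiplicity. The cofactor q is again constant on the curve,
   so if its degree m - l as a form were positive it would vanish at the same ratio r. *)
have [l [q nq ec]] := multiplicity_XsubC c r.
rewrite c0 /= in nq.
have q0 : q != 0 by apply: contraNneq c0 => z; rewrite ec z mul0r.
have scE : size c = (size q + l)%N.
  rewrite ec size_mul ?expf_neq0 ?polyXsubC_eq0 // size_exp_XsubC.
  by rewrite addnS.
have lm : (l <= m)%N by move: sc; rewrite scE -size_poly_gt0 in q0 *; lia.
have sq : (size q <= (m - l).+1)%N by move: sc; rewrite scE; lia.
have HE : homogenize c m al be =
    homogenize q (m - l) al be * (be - (j r) *: al) ^+ l.
  rewrite -(homogenize_XsubC _ _ _ al0) -homogenizeM ?size_exp_XsubC //.
  by rewrite -ec subnK.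
rewrite HE in H0 Hc; have [qc _] := is_constM H0 Hc.
case: (posnP (m - l)) => [ml|ml].
  have el : l = m by lia.
  exists r, q`_0; rewrite ec -mul_polyC el; congr (_ * _).
  by apply: size1_polyC; rewrite ml in sq.
have : (homogenize q (m - l) al be)`_(N * (m - l)) = 0.
  by rewrite nth_default // (leq_trans qc) // muln_gt0 N0.
move=> /eqP; rewrite coef_homogenize ?sa // horner_homogenize //.
rewrite er horner_map mulf_eq0 expf_eq0 (negPf a0) andbF /= fmorph_eq0 => h.
by rewrite /root h in nq.
Qed.

End BinaryForms.

Section QuasiForms.
Variables (k L : fieldType) (j : {rmorphism k -> L}).
Implicit Types (al be G : {poly L}) (c : {poly k}).

Hypothesis algebraic_const : forall (x : L) (p : {poly k}),
  p != 0 -> (map_poly j p).[x] = 0 -> exists a, x = j a.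

(** S is the sum of the c_t u^(n - b t) Y^(a t) at u = G al^4, Y = be / al. Up to a common monomial
    in G and al it is a binary form in G^b al^(a + 4 b) and be^a with dehomogenization c, so
    [constant_form] makes c a constant times a power of 'X - r. *)
Lemma constant_quasi_form a b n c G al be :
  (0 < a)%N -> (0 < b)%N -> (1 < size c)%N -> c`_0 != 0 ->
  (b * (size c).-1 <= n)%N -> (a * (size c).-1 <= 4 * (n - b * (size c).-1))%N ->
  al != 0 -> ~~ [&& is_const G, is_const al & is_const be] ->
  let S := \sum_(t < size c) (j c`_t)%:P * G ^+ (n - b * t)
     * al ^+ (4 * (n - b * t) - a * t) * be ^+ (a * t) in
  S != 0 -> is_const S ->
  exists r, let h := be ^+ a - j r *: (G ^+ b * al ^+ (a + 4 * b)) in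
    [/\ r != 0, root c r, is_const G, ~~ is_const al && ~~ is_const be
      & h != 0 /\ is_const h].
Proof.
move=> a0 b0 sc c00; set l := (size c).-1 => bl al4 al0 nc S S0 Sc.
have scE : size c = l.+1 by rewrite prednK // ltnW.
have l0 : (0 < l)%N by move: sc; rewrite scE.
(* Because 0 < a l <= 4 (n - b l). A positive power of G thus divides S, and G is constant. *)
have nl0 : (0 < n - b * l)%N.
  by move: al4; have := muln_gt0 a l; rewrite a0 l0 /=; lia.
set al1 := G ^+ b * al ^+ (a + 4 * b); set be1 := be ^+ a.
have SE : S = G ^+ (n - b * l) * (al ^+ (4 * (n - b * l) - a * l)
     * homogenize j c l al1 be1).
  rewrite /S scE /homogenize !mulr_sumr; apply: eq_bigr => t _.
  have tl : (t <= l)%N by rewrite -ltnS.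
  have -> : (n - b * t = (n - b * l) + b * (l - t))%N.
    by have := leq_mul (leqnn b) tl; rewrite mulnBr; lia.
  have -> : (4 * (n - b * l + b * (l - t)) - a * t =
     (4 * (n - b * l) - a * l) + (a + 4 * b) * (l - t))%N.
    have := leq_mul (leqnn a) tl; rewrite mulnDl -mulnA.
    have := mulnBr a l t; move: (b * (l - t))%N (a * (l - t))%N (b * l)%N al4.
    by move: (a * l)%N (a * t)%N; lia.
  rewrite /al1 /be1 exprMn -!exprM !exprD.
  move: (j c`_t)%:P (G ^+ _) (G ^+ _) (al ^+ (4 * _ - _)) (al ^+ (_ * _)).
  by move=> ? ? ? ? ?; ring.
rewrite SE in S0 Sc; have [Gc1 Tc] := is_constM S0 Sc.
have T0 : al ^+ (4 * (n - b * l) - a * l) * homogenize j c l al1 be1 != 0.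
  by apply: contraNneq S0 => ->; rewrite mulr0.
have [_ Hc] := is_constM T0 Tc.
have H0 : homogenize j c l al1 be1 != 0.
  by apply: contraNneq T0 => ->; rewrite mulr0.
have Gc := is_constX nl0 Gc1.
have G0 : G != 0.
  by apply: contraNneq S0 => ->; rewrite expr0n eqn0Ngt nl0 mul0r.
have al10 : al1 != 0 by rewrite mulf_neq0 // expf_neq0.
have m0 : (0 < a + 4 * b)%N by rewrite addn_gt0 a0.
have nc1 : ~~ (is_const al1 && is_const be1).
  apply: contra nc => /andP[c1 c2]; rewrite Gc (is_constX a0 c2) andbT /=.
  by have [_ /(is_constX m0)] := is_constM al10 c1.
have sc1 : (size c <= l.+1)%N by rewrite scE.
have [[d dE]|[r [d dE]]] := constant_form algebraic_const l0 sc1 al10 nc1 H0 Hc.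
  by move: sc; rewrite dE ltnNge size_polyC leq_b1.
have d0 : d != 0 by apply: contraNneq c00 => z; rewrite dE z scale0r coef0.
exists r => h.
have HE : homogenize j c l al1 be1 = (j d)%:P * h ^+ l.
  rewrite dE -mul_polyC -[l in LHS]add0n homogenizeM ?size_polyC ?leq_b1 //.
    rewrite homogenize_XsubC //; congr (_ * _).
    by rewrite /homogenize big_ord_recl big_ord0 addr0 coefC eqxx !expr0 !mulr1.
  by rewrite size_exp_XsubC.
rewrite HE in H0 Hc; have [_ /(is_constX l0) hc] := is_constM H0 Hc.
have h0 : h != 0.
  by move: H0; rewrite mulf_eq0 negb_or expf_eq0 l0 => /andP[].
have jr0 : r != 0.
  apply: contraNneq c00 => z; rewrite dE z polyC0 subr0 coefZ coefXn.
  by rewrite (ltn_eqF l0) mulr0.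
have Gbc : is_const (G ^+ b) by exact: is_constXE.
have cst p q : is_const p -> is_const q -> is_const (p + q).
  by move=> p1 q1; rewrite /is_const (leq_trans (size_polyD _ _)) // geq_max; apply/andP.
have cZ e p : is_const p -> is_const (e *: p).
  by move=> p1; rewrite /is_const (leq_trans (size_scale_leq _ _)).
have beE : be ^+ a = h + j r *: al1 by rewrite /h addrNK.
have alE : j r *: al1 = be ^+ a - h by rewrite /h opprB addrC addrNK.
split=> //; first by rewrite /root dE hornerZ horner_exp hornerXsubC subrr
  expr0n eqn0Ngt l0 mulr0.
(* In be^a = h + r G^b al^(a + 4 b) both G and h are constant and r is nonzero, so al is constant
   exactly when be is; by assumption one of them is not. *)
have al_be : is_const al -> is_const be.
  move=> ac; apply: (@is_constX _ _ a) => //; rewrite beE; apply: cst => //.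
  by apply/cZ/is_constME => //; exact: is_constXE.
have be_al : is_const be -> is_const al.
  move=> bc; apply: (@is_constX _ _ (a + 4 * b)) => //.
  have : is_const (j r *: al1).
    by rewrite alE; apply: cst; [exact: is_constXE|rewrite /is_const size_polyN].
  rewrite /is_const size_scale ?fmorph_eq0 // => a1c.
  by have [] := is_constM al10 a1c.
move: nc; rewrite Gc /= negb_and; case/orP => [na|nb].
  by rewrite na; apply: contra na => /be_al.
by rewrite nb andbT; apply: contra nb => /al_be.
Qed.

End QuasiForms.

(** * Derivations and the exclusion of cuspidal curves *)

Section Derivation.
Variables (R : comNzRingType) (D : R -> R).
Hypotheses (derD : {morph D : x y / x + y})
           (derM : forall x y, D (x * y) = D x * y + x * D y).

Lemma der0 : D 0 = 0.
Proof. by apply: (addIr (D 0)); rewrite -derD addr0 add0r. Qed.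

Lemma der1 : D 1 = 0.
Proof. by apply: (addIr (D 1)); rewrite add0r -{3}[1]mulr1 derM mulr1 mul1r. Qed.

Lemma derN x : D (- x) = - D x.
Proof. by apply: (addrI (D x)); rewrite -derD !subrr der0. Qed.

Lemma derX x n : D (x ^+ n) = n%:R * x ^+ n.-1 * D x.
Proof.
case: n => [|n]; first by rewrite expr0 der1 !mul0r.
elim: n => [|n IH]; first by rewrite expr1 expr0 !mul1r.
rewrite exprS derM IH /= -(natr1 n.+1) exprS.
by move: (x ^+ n) (n.+1%:R) => y z; ring.
Qed.

Definition poly_der (p : {poly R}) : {poly R} := map_poly D p.

Lemma coef_poly_der p i : (poly_der p)`_i = D p`_i.
Proof. by rewrite coef_map_id0 // der0. Qed.

Lemma poly_derD : {morph poly_der : p q / p + q}.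
Proof. by move=> p q; apply/polyP => i; rewrite !(coef_poly_der, coefD) derD. Qed.

Lemma poly_derM p q : poly_der (p * q) = poly_der p * q + p * poly_der q.
Proof.
apply/polyP => i; rewrite coefD coef_poly_der !coefM (big_morph D derD der0).
by rewrite -big_split; apply: eq_bigr => l _; rewrite derM !coef_poly_der.
Qed.

Lemma poly_derC c : poly_der c%:P = (D c)%:P.
Proof.
apply/polyP => i; rewrite coef_poly_der !coefC; case: eqP => // _.
exact: der0.
Qed.

End Derivation.

Section NoCurve.
Variable L : fieldType.
Implicit Types (al be p q : {poly L}).

Lemma nonconst_mul_const p q c n : ~~ is_const p -> (0 < n)%N ->
  p ^+ n * q = c%:P -> c = 0.
Proof.
move=> np n0 e; apply/eqP; apply: contraNT np => c0.
have cP0 : c%:P != 0 by rewrite polyC_eq0.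
have cc : is_const (p ^+ n * q) by rewrite e /is_const size_polyC c0.
rewrite -e in cP0; have [pc _] := is_constM cP0 cc.
exact: is_constX n0 pc.
Qed.

Lemma deriv0_comp p : p^`() = 0 -> ~~ is_const p ->
  exists n, (1 < n)%N && (n%:R == 0 :> L).
Proof.
rewrite /is_const -ltnNge => d p1.
have scE : size p = (size p).-2.+2 by lia.
have lp : p`_(size p).-1 != 0.
  by rewrite -[p`__]/(lead_coef p) lead_coef_eq0 -size_poly_gt0 ltnW.
exists (size p).-1; apply/andP; split.
  rewrite ltn_neqAle; apply/andP; split; last by lia.
  apply/eqP => e; have := congr1 (fun q : {poly L} => q`_0) d.
  by rewrite coef_deriv coef0 mulr1n; apply/eqP; rewrite -e in lp.
have := congr1 (fun q : {poly L} => q`_(size p).-2) d.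
rewrite coef_deriv coef0 => /eqP; rewrite -[_ *+ _]mulr_natr mulf_eq0.
have -> : (size p).-2.+1 = (size p).-1 by lia.
by rewrite (negPf lp).
Qed.

(** As L may be imperfect, a zero derivative only makes p a polynomial in X^r and not an r-th power;
    this suffices for a descent on the degree. *)
Lemma deriv0_compXn p r : prime r -> (r%:R == 0 :> L) -> p^`() = 0 ->
  p = (\poly_(i < size p) p`_(r * i)) \Po 'X^r.
Proof.
move=> pr r0 d; have rgt0 := prime_gt0 pr.
have chr : r \in [pchar L] by rewrite inE pr.
apply/polyP => i; rewrite coef_comp_poly_Xn //.
case: ifP => [/dvdnP[l ->]|/negP ri].
  rewrite mulnK // coef_poly; case: ltnP => [|le]; first by rewrite mulnC.
  by rewrite nth_default // (leq_trans le) // leq_pmulr.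
case: i ri => [|i] ri; first by case: ri; rewrite dvdn0.
have := congr1 (fun q : {poly L} => q`_i) d.
rewrite coef_deriv coef0 -[_ *+ _]mulr_natr => /eqP; rewrite mulf_eq0 => /orP[/eqP //|].
by rewrite -(dvdn_pcharf chr) => h.
Qed.

Variables (D : L -> L).
Hypotheses (derD : {morph D : x y / x + y})
           (derM : forall x y, D (x * y) = D x * y + x * D y).
Local Notation PD := (poly_der D).

(* In the tame case this is the theorem of Mason for be^a = c al^m + h; in the
   wild case one differentiates the coefficients along u instead of the
   variable. *)
Lemma no_cuspidal_curve a b al be (g x u Y h : L) :
  coprime a b -> (1 < a)%N -> (0 < b)%N -> ~~ is_const al -> ~~ is_const be ->
  g != 0 -> x != 0 -> u != 0 -> Y != 0 -> h != 0 ->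
  D x = 0 -> D u = 1 -> D Y = 0 -> u = g * al`_0 ^+ 4 -> be`_0 = Y * al`_0 ->
  be ^+ a - (x * g ^+ b) *: al ^+ (a + 4 * b) = h%:P -> False.
Proof.
move=> co a1 b0 nal nbe g0 x0 u0 Y0 h0 Dx Du DY uE beE e.
set m := (a + 4 * b)%N in e; have [c cE] : exists c, c = x * g ^+ b by eexists.
rewrite -cE in e.
set a0 := al`_0 in uE beE.
have a00 : a0 != 0.
  by apply: contraNneq u0 => z; rewrite uE z expr0n mulr0.
have c0 : c != 0 by rewrite cE mulf_neq0 ?expf_neq0.
have D0 := der0 derD.
have DXE := derX derM.
have ab0 : ~ (a%:R = 0 :> L /\ b%:R = 0 :> L).
  case=> az bz; have [p q pq _] := egcdnP b (ltnW a1).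
  move/eqP: co pq => -> /(congr1 (fun n => n%:R : L)).
  rewrite natrD !natrM az bz !mulr0 add0r => /esym/eqP.
  by rewrite oner_eq0.
have hE : h = be`_0 ^+ a - c * a0 ^+ m.
  have := congr1 (fun q : {poly L} => q.[0]) e.
  by rewrite hornerC hornerD hornerN hornerZ !horner_exp !horner_coef0.
have PDe : PD (be ^+ a) = (D c) *: al ^+ m + c *: PD (al ^+ m) + (D h)%:P.
  have -> : be ^+ a = c%:P * al ^+ m + h%:P by rewrite -e mul_polyC; ring.
  by rewrite (poly_derD derD) (poly_derM derD derM) !(poly_derC derD) !mul_polyC.
have PX := derX (poly_derM derD derM).
have m1 : (1 < m)%N by rewrite (leq_trans a1) // leq_addr.
have a0' : a.-1.+1 = a by rewrite prednK // ltnW.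
have m0' : m.-1.+1 = m by rewrite prednK // ltnW.
have a1' : (0 < a.-1)%N by rewrite -subn1 subn_gt0.
have m1' : (0 < m.-1)%N by rewrite -subn1 subn_gt0.
(* First wild case, m = 0 in L. Applying D to the coefficients kills al^m, so the power be^(a - 1)
   of a nonconstant polynomial divides the constant c D h - D c h, which is thus 0. With the
   relations at T = 0, differentiating W u^b x = Y^a a0^m c then forces b = 0 in L. *)
have [mz|mnz] := eqVneq (m%:R : L) 0.
  have bnz : b%:R != 0 :> L.
    apply/eqP => bz; apply: ab0; split=> //.
    by move: mz; rewrite /m natrD natrM bz mulr0 addr0.
  have eP : be ^+ a.-1 * (c%:P * (a%:R * PD be) - (D c)%:P * be)
      = (c * D h - D c * h)%:P.
    rewrite !polyCB !polyCM.
    have -> : be ^+ a.-1 * (c%:P * (a%:R * PD be) - (D c)%:P * be) =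
        c%:P * PD (be ^+ a) - (D c)%:P * be ^+ a.
      have beS : be ^+ a = be * be ^+ a.-1 by rewrite -exprS a0'.
      by rewrite PX beS; move: (be ^+ a.-1) (PD be) => ? ?; ring.
    rewrite PDe PX -polyC_natr mz polyC0 !mul0r scaler0 addr0.
    have -> : be ^+ a = c%:P * al ^+ m + h%:P by rewrite -e mul_polyC; ring.
    by rewrite -mul_polyC; ring.
  have Z : c * D h - D c * h = 0.
    exact: (nonconst_mul_const nbe a1' eP).
  have Dam : D (a0 ^+ m) = 0 by rewrite DXE mz !mul0r.
  have Dh : D h = D (be`_0 ^+ a) - D c * a0 ^+ m.
    by rewrite hE derD (derN derD) derM Dam mulr0 addr0.
  move: hE Dh; move EW: (be`_0 ^+ a) => W hE Dh.
  have W0 : W != 0 by rewrite -EW beE expf_neq0 // mulf_neq0.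
  have Z2 : c * D W = D c * W by apply/subr0_eq; rewrite -[RHS]Z Dh hE; ring.
  have WE : W * u ^+ b * x = Y ^+ a * a0 ^+ m * c.
    rewrite -EW beE uE cE /m (exprMn a) (exprMn b) exprD exprM.
    by move: (Y ^+ a) (a0 ^+ a) (a0 ^+ 4 ^+ b) (g ^+ b) => ? ? ? ?; ring.
  have := congr1 D WE; rewrite !derM Dam !DXE Dx DY Du => DWE.
  have : c * W * x * u ^+ b.-1 * b%:R = 0.
    have -> : c * W * x * u ^+ b.-1 * b%:R =
        c * ((D W * u ^+ b + W * (b%:R * u ^+ b.-1 * 1)) * x + W * u ^+ b * 0)
        - (c * D W) * u ^+ b * x.
      by move: (u ^+ b) (u ^+ b.-1) (D W) => ? ? ?; ring.
    rewrite DWE Z2.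
    have -> : D c * W * u ^+ b * x = D c * (W * u ^+ b * x).
      by move: (u ^+ b) => ?; ring.
    by rewrite WE; move: (Y ^+ a) (a0 ^+ m) (Y ^+ a.-1) => ? ? ?; ring.
  by apply/eqP; rewrite !mulf_neq0 ?expf_neq0.
(* Second wild case, a = 0 in L. Now al^(m - 1) divides the constant D h, so D h = 0, and D applied
   to c a0^m = x u^b a0^a again gives b = 0 in L. *)
have [az|anz] := eqVneq (a%:R : L) 0.
  have bnz : b%:R != 0 :> L by apply/eqP => bz; apply: ab0; split.
  have eP : al ^+ m.-1 * (- (D c)%:P * al - c%:P * (m%:R * PD al)) = (D h)%:P.
    have alS : al ^+ m = al * al ^+ m.-1 by rewrite -exprS m0'.
    have := PDe; rewrite !PX -!polyC_natr az polyC0 !mul0r alS => PDe'.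
    rewrite -[RHS]subr0 PDe' -!mul_polyC -?polyC_natr.
    by move: (al ^+ m.-1) (PD al) => ? ?; ring.
  have Dh : D h = 0.
    exact: (nonconst_mul_const nal m1' eP).
  have Z : D (c * a0 ^+ m) = 0.
    have : D (be`_0 ^+ a) = D (c * a0 ^+ m) + D h.
      by rewrite -derD hE addrC subrK.
    by rewrite DXE az !mul0r Dh addr0 => <-.
  have WE : c * a0 ^+ m = x * u ^+ b * a0 ^+ a.
    rewrite uE cE /m (exprMn b) exprD exprM.
    by move: (a0 ^+ a) (a0 ^+ 4 ^+ b) (g ^+ b) => ? ? ?; ring.
  have : D (a0 ^+ a) = 0 by rewrite DXE az !mul0r.
  move: Z; rewrite WE !derM Dx mul0r add0r => Z Z'.
  have : x * (b%:R * u ^+ b.-1) * a0 ^+ a = 0.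
    by move: Z; rewrite Z' mulr0 addr0 DXE Du mulr1.
  by apply/eqP; rewrite !mulf_neq0 ?expf_neq0.
(* Tame case: the equation is differentiated in T. If the derivatives of al and be vanish, both are
   polynomials in T^r and the induction on the size replaces T^r by T; the conditions at T = 0 are
   unchanged. *)
have [N sN] : exists N, (size al <= N)%N by exists (size al).
rewrite {}/a0 {PDe} in a00 beE hE uE *.
elim: N al be sN e nal nbe a00 beE hE uE => [|N IH] al be sN e nal nbe a00 beE hE uE.
  by case/negP: nal; rewrite /is_const (leq_trans sN).
have al0 : al != 0 by apply: contraNneq a00 => ->; rewrite coef0.
have be0 : be != 0.
  by apply: contraNneq nbe => ->; rewrite /is_const size_poly0.
have de : be ^+ a.-1 * (a%:R *: be^`()) = al ^+ m.-1 * ((c * m%:R) *: al^`()).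
  have := congr1 (@deriv _) e.
  rewrite derivC derivB derivZ !deriv_exp => /subr0_eq de.
  move: de; rewrite -[_ *+ a]mulr_natr -[_ *+ m]mulr_natr -!mul_polyC.
  rewrite polyCM !polyC_natr.
  move: (be ^+ a.-1) (al ^+ m.-1) (be^`()) (al^`()) (a%:R) (m%:R).
  move=> x1 x2 x3 x4 x5 x6 E.
  have -> : x1 * (x5 * x3) = x3 * x1 * x5 by ring.
  by rewrite E; ring.
have [db|db] := eqVneq be^`() 0.
  have da : al^`() = 0.
    apply/eqP; move/eqP: de; rewrite db scaler0 mulr0 eq_sym mulf_eq0.
    rewrite expf_eq0 (negPf al0) andbF /= scaler_eq0 mulf_eq0.
    by rewrite (negPf c0) (negPf mnz).
  have [n /andP[n1 /eqP nz]] := deriv0_comp da nal.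
  have [|r /andP[pr rz]] := @natf0_pchar L n (ltnW n1); first exact/eqP.
  have alE := deriv0_compXn pr rz da; have beE' := deriv0_compXn pr rz db.
  move: alE beE'; set al1 := \poly_(_ < _) _; set be1 := \poly_(_ < _) _.
  move=> alE beE'.
  have sX : (1 < size ('X^r : {poly L}))%N by rewrite size_polyXn ltnS prime_gt0.
  have comp0 (p : {poly L}) : (p \Po 'X^r)`_0 = p`_0.
    by rewrite coef_comp_poly_Xn ?prime_gt0 // dvdn0 div0n.
  have comp_c (p : {poly L}) : ~~ is_const (p \Po 'X^r) -> ~~ is_const p.
    by apply: contra => /size1_polyC ->; rewrite comp_polyC /is_const size_polyC leq_b1.
  have sal : size al = ((size al1).-1 * r).+1.
    have := size_comp_poly al1 'X^r; rewrite -alE size_polyXn /= => <-.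
    by rewrite prednK // size_poly_gt0.
  have nal1 : ~~ is_const al1 by apply: comp_c; rewrite -alE.
  apply: (IH al1 be1) => //.
  - have r1 := prime_gt1 pr; move: nal1 sN; rewrite sal /is_const -ltnNge.
    case: (size al1) => [|[|s]] //= _; rewrite ltnS => /(leq_trans _); apply.
    by rewrite (@leq_trans (s.+1 * 2)) ?leq_mul2l // muln2 -addnn addSn ltnS leq_addl.
  - have : (be1 ^+ a - c *: al1 ^+ m - h%:P) \Po 'X^r == 0.
      rewrite !(comp_polyB, comp_polyZ, rmorphXn) /= !comp_polyC.
      by rewrite -alE -beE' e subrr.
    by rewrite comp_poly_eq0 // subr_eq0 => /eqP.
  - by apply: comp_c; rewrite -beE'.
  - by rewrite -comp0 -alE.
  - by rewrite -(comp0 al1) -(comp0 be1) -alE -beE'.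
  - by rewrite hE -(comp0 al1) -(comp0 be1) -alE -beE'.
  - by rewrite -(comp0 al1) -alE.
have da : al^`() != 0.
  apply: contraNneq db => da; apply/eqP; move/eqP: de.
  rewrite da scaler0 mulr0 mulf_eq0 expf_eq0 (negPf be0) andbF /= scaler_eq0.
  by rewrite (negPf anz) => /eqP.
(* A common factor would divide the nonzero constant h. Coprimality turns the differentiated
   equation into be^(a-1) | al' and al^(m-1) | be', whence deg be <= deg al' < deg al <= deg be' <
   deg be. *)
have cop : coprimep al be.
  have h1 : 1 %= h%:P by rewrite eqp_sym polyC_eqp1.
  rewrite /coprimep -dvdp1 (eqp_dvdr _ h1) -e; apply: dvdp_sub.
    by rewrite -a0' exprS dvdp_mulr // dvdp_gcdr.
  rewrite -mul_polyC dvdp_mull // -m0' exprS dvdp_mulr //.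
  exact: dvdp_gcdl.
have cm : c * m%:R != 0 by rewrite mulf_neq0.
have d1 : be ^+ a.-1 %| al^`().
  have : be ^+ a.-1 %| al ^+ m.-1 * ((c * m%:R) *: al^`()).
    by rewrite -de dvdp_mulr.
  rewrite Gauss_dvdpr ?dvdpZr //.
  by rewrite coprimep_expl // coprimep_expr // coprimep_sym.
have d2 : al ^+ m.-1 %| be^`().
  have : al ^+ m.-1 %| be ^+ a.-1 * (a%:R *: be^`()).
    by rewrite de dvdp_mulr.
  rewrite Gauss_dvdpr ?dvdpZr //.
  by rewrite coprimep_expl // coprimep_expr.
have bexp : be %| be ^+ a.-1 by rewrite -{1}[be]expr1 dvdp_exp2l.
have aexp : al %| al ^+ m.-1 by rewrite -{1}[al]expr1 dvdp_exp2l.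
have l1 := dvdp_leq da (dvdp_trans bexp d1).
have l2 := dvdp_leq db (dvdp_trans aexp d2).
have l3 := lt_size_deriv al0; have l4 := lt_size_deriv be0.
by have := ltn_trans (leq_ltn_trans l1 l3) (leq_ltn_trans l2 l4); rewrite ltnn.
Qed.

End NoCurve.

(** * Leading terms *)

Section Leading.
Variable L : fieldType.
Local Notation "f %:F" := (@FracField.tofrac _ f).
Local Notation L_w := {fraction {poly L}}.
Implicit Types (f g : L_w) (m e : int) (c d : L).

Let w : L_w := 'X%:F.

Let w0 : w != 0. Proof. by rewrite tofrac_eq0 polyX_eq0. Qed.

(* [f = c w^-m + (terms of order > -m in w)]: with the degree in 1/w as
   degree function, f has degree at most m, and c is its coefficient there. *)
Definition frac_lead f m c := exists n d : {poly L},
  [/\ d.[0] != 0, f * w ^ m = n%:F / d%:F & c = n.[0] / d.[0]].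

Let d_neq0 (d : {poly L}) : d.[0] != 0 -> d != 0.
Proof. by apply: contraNneq => ->; rewrite horner0. Qed.

Lemma frac_lead_uniq f m c c' : frac_lead f m c -> frac_lead f m c' -> c = c'.
Proof.
move=> [n [d [d0 e ->]]] [n' [d' [d0' e' ->]]].
have /eqP : n%:F / d%:F = n'%:F / d'%:F by rewrite -e -e'.
rewrite eq_fraction ?d_neq0 // => /eqP/(congr1 (fun q => q.[0])).
by rewrite !hornerM => h; apply/eqP; rewrite eqr_div // h.
Qed.

Lemma frac_lead0 m : frac_lead 0 m 0.
Proof.
exists 0, 1; split; rewrite ?hornerC ?oner_eq0 ?mul0r ?tofrac0 ?mul0r //.
Qed.

Lemma frac_leadD f g m c c' : frac_lead f m c -> frac_lead g m c' -> frac_lead (f + g) m (c + c').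
Proof.
move=> [n [d [d0 e ->]]] [n' [d' [d0' e' ->]]].
exists (n * d' + n' * d), (d * d'); split; first by rewrite hornerM mulf_neq0.
  rewrite mulrDl e e' addf_div ?tofrac_eq0 ?d_neq0 //.
  by rewrite tofracD !tofracM.
by rewrite addf_div // hornerD !hornerM.
Qed.

Lemma frac_leadM f g m m' c c' :
  frac_lead f m c -> frac_lead g m' c' -> frac_lead (f * g) (m + m') (c * c').
Proof.
move=> [n [d [d0 e ->]]] [n' [d' [d0' e' ->]]].
exists (n * n'), (d * d'); split; first by rewrite hornerM mulf_neq0.
  by rewrite expfzDr // mulrACA e e' mulf_div !tofracM.
by rewrite mulf_div !hornerM.
Qed.

Lemma frac_lead_pow e c : frac_lead (const_frac c * w ^ (- e)) e c.
Proof.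
exists c%:P, 1; rewrite !hornerC oner_eq0; split=> //; last by rewrite divr1.
by rewrite tofrac1 divr1 -mulrA -expfzDr // addNr expr0z mulr1.
Qed.

Lemma frac_lead_const c : frac_lead (const_frac c) 0 c.
Proof. by have := frac_lead_pow 0 c; rewrite oppr0 expr0z mulr1. Qed.

Lemma frac_lead_low f m m' c : frac_lead f m c -> m < m' -> frac_lead f m' 0.
Proof.
move=> [n [d [d0 e _]]] lt; have [p ep] : exists p : nat, m' = m + p.+1.
  exists `|m' - m|.-1%N; lia.
exists (n * 'X^(p.+1)), d; split=> //.
  rewrite ep expfzDr // mulrA e tofracM tofracXn -exprnP /=.
  by rewrite mulrAC.
by rewrite hornerM hornerXn expr0n mulr0 mul0r.
Qed.

Lemma frac_leadV f m c : frac_lead f m c -> c != 0 -> frac_lead f^-1 (- m) c^-1.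
Proof.
move=> [n [d [d0 e ->]]]; rewrite mulf_eq0 negb_or => /andP[n0 _].
exists d, n; split=> //; last by rewrite invf_div.
by rewrite -invf_div -e invfM invr_expz.
Qed.

Let cancel_aux (K : fieldType) (a b c d : K) :
  b != 0 -> c != 0 -> d != 0 -> a * b / (c * d) * (d / b) = a / c.
Proof. by move=> b0 c0 d0; field; do !(apply/andP; split). Qed.

Lemma frac_lead_exists f : f != 0 -> exists m c, c != 0 /\ frac_lead f m c.
Proof.
have split_X (p : {poly L}) : p != 0 ->
    exists i q, q.[0] != 0 /\ p = q * 'X^i :> {poly L}.
  move=> p0; have [i [q nq ->]] := multiplicity_XsubC p 0.
  by exists i, q; rewrite polyC0 subr0; split=> //; rewrite p0 /= in nq.
elim/fraction_ind: f => n d d0; rewrite mulf_eq0 negb_or tofrac_eq0 => /andP[n0 _].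
have [p [n1 [n10 ->]]] := split_X n n0; have [q [d1 [d10 ->]]] := split_X d d0.
exists (q%:Z - p%:Z), (n1.[0] / d1.[0]); split; first by rewrite mulf_neq0 ?invr_eq0.
exists n1, d1; split=> //.
rewrite !tofracM !tofracXn -/w expfzDr // -invr_expz -!exprnP.
by apply: cancel_aux; rewrite ?(expf_neq0 _ w0) ?tofrac_eq0 ?(d_neq0 d10).
Qed.

End Leading.

(* Fields with a degree function with values in the integers and leading
   coefficients in L: [dlead f m c] says that f has degree at most m and that
   c is its coefficient in degree m. *)
Record degreeField (L : fieldType) := DegreeField {
  dfield :> fieldType;
  dlead : dfield -> int -> L -> Prop;
  dconst : {rmorphism L -> dfield};
  dlead_uniq : forall f m c c', dlead f m c -> dlead f m c' -> c = c';
  dlead0 : forall m, dlead 0 m 0;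
  dleadD : forall f g m c c',
    dlead f m c -> dlead g m c' -> dlead (f + g) m (c + c');
  dleadM : forall f g m m' c c',
    dlead f m c -> dlead g m' c' -> dlead (f * g) (m + m') (c * c');
  dlead_const : forall c, dlead (dconst c) 0 c;
  dlead_low : forall f m m' c, dlead f m c -> (m < m')%R -> dlead f m' 0;
  dleadV : forall f m c, dlead f m c -> c != 0 -> dlead f^-1 (- m) c^-1;
  dlead_exists : forall f, f != 0 -> exists m c, c != 0 /\ dlead f m c;
  dlead_onto : forall m c, exists f, dlead f m c }.

Lemma degreeField_exists (L : fieldType) : inhabited (degreeField L).
Proof.
split; refine (@DegreeField L {fraction {poly L}} (@frac_lead L)
  (@const_frac L) _ _ _ _ _ _ _ _ _).
- exact: frac_lead_uniq.
- exact: frac_lead0.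
- exact: frac_leadD.
- exact: frac_leadM.
- exact: frac_lead_const.
- exact: frac_lead_low.
- exact: frac_leadV.
- exact: frac_lead_exists.
- by move=> m c; eexists; exact: frac_lead_pow.
Qed.

Section DegreeFieldTheory.
Variables (L : fieldType) (N : degreeField L).
Local Notation lead := (@dlead L N).
Implicit Types (f g : N) (m : int) (c : L).

Lemma lead1 : lead 1 0 1.
Proof. by rewrite -(rmorph1 (dconst N)); exact: dlead_const. Qed.

Lemma lead_le f m m' c : lead f m c -> m <= m' ->
  lead f m' (if m' == m then c else 0).
Proof.
move=> h le; case: eqP => [->//|ne]; apply: dlead_low h _.
by rewrite lt_neqAle le andbT; apply/eqP => e; apply: ne.
Qed.

Lemma leadN f m c : lead f m c -> lead (- f) m (- c).
Proof.
move=> h; have := dleadM (dlead_const N (- 1)) h.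
by rewrite add0r rmorphN rmorph1 !mulN1r.
Qed.

Lemma leadX f m c p : lead f m c -> lead (f ^+ p) (m *+ p) (c ^+ p).
Proof.
move=> h; elim: p => [|p IH]; first by rewrite !expr0 mulr0n; exact: lead1.
by rewrite !exprS mulrS; exact: dleadM.
Qed.

End DegreeFieldTheory.

Section WeightedLeading.
Variables (L : fieldType) (N : degreeField L).
Local Notation lead := (@dlead L N).
Variables (M : nat) (kappa : int).
Hypothesis M_gt0 : (0 < M)%N.
Implicit Types (f g : N) (x y : int) (c d : L).

(* [lead] with respect to the fractional degree x / M. *)
Definition leadq f x c := exists2 c', lead f (x %/ M%:Z)%Z c' &
  c = if (M%:Z %| x)%Z then c' else 0.

Lemma leadq_uniq f x c c' : leadq f x c -> leadq f x c' -> c = c'.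
Proof. by move=> [d h ->] [d' h' ->]; rewrite (dlead_uniq h h'). Qed.

Lemma leadq0 x : leadq 0 x 0.
Proof. by exists 0; [exact: dlead0|case: ifP]. Qed.

Lemma leadqD f g x c c' : leadq f x c -> leadq g x c' -> leadq (f + g) x (c + c').
Proof.
move=> [d h ->] [d' h' ->]; exists (d + d'); first exact: dleadD.
by case: ifP; rewrite ?addr0.
Qed.

Lemma leadq_le f m x c : lead f m c -> M%:Z * m <= x ->
  leadq f x (if x == M%:Z * m then c else 0).
Proof.
move=> h le; have M0 : M%:Z != 0 by lia.
have le' : m <= (x %/ M%:Z)%Z by rewrite lez_divRL; lia.
eexists; first exact: lead_le h le'.
have [dv|ndv] := boolP (M%:Z %| x)%Z; last first.
  by case: eqP => // e; move: ndv; rewrite e dvdz_mulr.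
have -> // : (x == M%:Z * m) = ((x %/ M%:Z)%Z == m).
apply/eqP/eqP => [->|<-]; first by rewrite mulKz.
by rewrite mulrC divzK.
Qed.

Let dvdzD (d x y : int) : (d %| x)%Z -> (d %| x + y)%Z = (d %| y)%Z.
Proof.
by case/dvdzP => q ->; apply/dvdz_mod0P/dvdz_mod0P; rewrite modzMDl.
Qed.

(** The integer parts of x / M and y / M add up to at most that of (x + y) / M. When M divides x +
    y, equality holds only if M divides both, which is when the product of the coefficients
    survives. *)
Lemma leadqM f g x y c c' :
  leadq f x c -> leadq g y c' -> leadq (f * g) (x + y) (c * c').
Proof.
move=> [d h ->] [d' h' ->]; have M0 : M%:Z != 0 by lia.
have Mp : 0 < M%:Z by lia.
have hh := dleadM h h'.
have ex := divz_eq x M%:Z; have ey := divz_eq y M%:Z.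
have exy := divz_eq (x + y) M%:Z.
have rx0 := modz_ge0 x M0; have ry0 := modz_ge0 y M0.
have rxy0 := modz_ge0 (x + y) M0; have rxy1 := ltz_pmod (x + y) Mp.
set X := (x %/ M%:Z)%Z in h hh ex *; set Y := (y %/ M%:Z)%Z in h' hh ey *.
set Z := ((x + y) %/ M%:Z)%Z in exy *.
have le : X + Y <= Z.
  rewrite leNgt; apply/negP => lt.
  have : Z * M%:Z + M%:Z <= (X + Y) * M%:Z.
    by rewrite -{2}[M%:Z]mul1r -mulrDl ler_pM2r //; lia.
  by move: (Z * M%:Z) exy => zz exy; rewrite mulrDl; lia.
have hZ := lead_le hh le.
eexists; first exact: hZ.
case: (boolP (M%:Z %| x)%Z) => [dx|ndx]; last first.
  rewrite mul0r; case: ifP => // dxy; case: eqP => // e.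
  move/dvdz_mod0P: dxy => dxy; case/negP: ndx; apply/dvdz_mod0P.
  by move: exy; rewrite dxy e mulrDl; lia.
case: (boolP (M%:Z %| y)%Z) => [dy|ndy]; last first.
  by rewrite mulr0 dvdzD // (negPf ndy).
rewrite dvdzD // dy.
move/dvdz_mod0P: dx => dx; move/dvdz_mod0P: dy => dy.
have dxy : ((x + y) %% M%:Z)%Z = 0.
  by apply/dvdz_mod0P; rewrite dvdzD; apply/dvdz_mod0P.
have -> : Z = X + Y; last by rewrite eqxx.
apply: (mulIf M0); rewrite mulrDl.
by move: exy ex ey; rewrite dxy dx dy !addr0 => <- <- <-.
Qed.

(** The variable T of the polynomial ring has degree - kappa / M, so in total degree x / M the
    coefficient of T^i may have degree (x + kappa i) / M. This slope is only rational, which is the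
    reason for [leadq]. *)
Definition leadp (f : {poly N}) x (P : {poly L}) :=
  forall i : nat, leadq f`_i (x + kappa *+ i) P`_i.

Implicit Types (F G : {poly N}) (P Q : {poly L}).

Lemma leadp_uniq F x P Q : leadp F x P -> leadp F x Q -> P = Q.
Proof. by move=> h h'; apply/polyP => i; exact: leadq_uniq (h i) (h' i). Qed.

Lemma leadpD F G x P Q : leadp F x P -> leadp G x Q -> leadp (F + G) x (P + Q).
Proof. by move=> h h' i; rewrite !coefD; exact: leadqD. Qed.

Lemma leadp0 x : leadp 0 x 0.
Proof. by move=> i; rewrite !coef0; exact: leadq0. Qed.

Lemma leadpC f x c : leadq f x c -> leadp f%:P x c%:P.
Proof.
move=> h i; rewrite !coefC; case: eqP => [->|_]; last exact: leadq0.
by rewrite mulr0n addr0.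
Qed.

Lemma leadpM F G x y P Q :
  leadp F x P -> leadp G y Q -> leadp (F * G) (x + y) (P * Q).
Proof.
move=> h h' i; rewrite !coefM.
elim/big_ind2: _ => [|f1 c1 f2 c2|l _]; [exact: leadq0|exact: leadqD|].
have -> : x + y + kappa *+ i = (x + kappa *+ l) + (y + kappa *+ (i - l)).
  have le : (l <= i)%N by rewrite -ltnS.
  by rewrite -{1}(subnKC le) mulrnDr; ring.
exact: leadqM.
Qed.

Lemma leadp1 : leadp 1 0 1.
Proof.
apply: leadpC; have := @leadq_le 1 0 0 1 (lead1 N); rewrite mulr0 eqxx; exact.
Qed.

Lemma leadp_const c : leadp (dconst N c)%:P 0 c%:P.
Proof.
apply: leadpC; have := @leadq_le _ 0 0 c (dlead_const N c); rewrite mulr0 eqxx.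
exact.
Qed.

Lemma leadq_low f x y c : leadq f x c -> x < y -> leadq f y 0.
Proof.
move=> [d h _] lt; have M0 : M%:Z != 0 by lia.
have le : M%:Z * (x %/ M%:Z)%Z < y.
  by rewrite mulrC; apply: le_lt_trans lt; rewrite -lez_divRL; lia.
have := leadq_le h (ltW le); case: eqP => // e; first by rewrite e ltxx in le.
Qed.

Lemma leadp_low F x y P : leadp F x P -> x < y -> leadp F y 0.
Proof.
by move=> h lt i; rewrite coef0; apply: leadq_low (h i) _; rewrite ltrD2r.
Qed.

End WeightedLeading.

(** * Generators of O(S_0) *)

Section Coordinates.
Variable k : fieldType.
Local Notation "f %:F" := (@FracField.tofrac _ f).
Local Notation P := {mpoly k[3]}.
Local Notation K := {fraction {mpoly k[3]}}.
Local Notation A := (OS0 k).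
Local Notation q0 := (q0 k).

Definition gen_num (l : nat) : P :=
  nth 0 [:: px k ^+ 2; px k * py k; py k ^+ 2; - (py k * pz k); pz k ^+ 2] l.

Lemma gen_num_homog l : gen_num l \is 2.-homog.
Proof.
have h1 i : ('X_i : P) \is 1.-homog := X_homog k i.
case: l => [|[|[|[|[|l]]]]]; rewrite /gen_num /=.
- exact: dhomogMn 2 (h1 _).
- exact: dhomogM (h1 _) (h1 _).
- exact: dhomogMn 2 (h1 _).
- by rewrite rpredN; exact: dhomogM (h1 _) (h1 _).
- exact: dhomogMn 2 (h1 _).
- by rewrite nth_nil; exact: dhomog0.
Qed.

Lemma OS0_valD (f g : A) : OS0_val (f + g) = OS0_val f + OS0_val g.
Proof. by []. Qed.
Lemma OS0_valM (f g : A) : OS0_val (f * g) = OS0_val f * OS0_val g.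
Proof. by []. Qed.
Lemma OS0_val1 : OS0_val (1 : A) = 1. Proof. by []. Qed.
Lemma OS0_val0 : OS0_val (0 : A) = 0. Proof. by []. Qed.
Lemma OS0_valN (f : A) : OS0_val (- f) = - OS0_val f. Proof. by []. Qed.
Lemma OS0_valZ c (f : A) : OS0_val (c *: f) = constK c * OS0_val f.
Proof. by []. Qed.
Lemma OS0_valX (f : A) n : OS0_val (f ^+ n) = OS0_val f ^+ n.
Proof. by elim: n => // n IH; rewrite !exprS OS0_valM IH. Qed.
Lemma OS0_eqP (f g : A) : OS0_val f = OS0_val g -> f = g.
Proof. exact: val_inj. Qed.
Definition OS0_valE := (OS0_valD, OS0_valM, OS0_valN, OS0_valZ, OS0_val1,
  OS0_val0, OS0_valX).

Fact gen_subproof l : (gen_num l)%:F / q0%:F \in @OS0_pred k.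
Proof. by apply/asboolP; exists 1%N, (gen_num l); rewrite expr1 gen_num_homog. Qed.

(* x^2, xy, y^2, -yz, z^2 over q0: in the coordinates u = x^2/q0 and Y = y/x,
   [gen l] is u Y^l up to terms of lower degree in u. *)
Definition gen l : A := MkOS0 (gen_subproof l).

Lemma gen0E : gen 0 = x2q0 k.
Proof. by apply: val_inj; rewrite /= /gen_num /= tofracXn. Qed.

Lemma gen_val l : OS0_val (gen l) = (gen_num l)%:F / q0%:F. Proof. by []. Qed.

(** For each value of l + j one product containing [gen 0] or [gen 4] is taken as standard ([top]).
    What the relation xz + y^2 = q0 leaves over is [low], of degree at most 1 in u where the product
    has degree 2. *)
Definition low l j : A := match l, j with
  | 1%N, 2%N | 2%N, 1%N => gen 1
  | 2%N, 2%N => 2 * gen 2 - 1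
  | 1%N, 3%N | 3%N, 1%N => gen 2 - 1
  | 2%N, 3%N | 3%N, 2%N => gen 3
  | _, _ => 0 end.

Definition top l j : A :=
  if (l + j <= 4)%N then gen 0 * gen (l + j) else gen 4 * gen (l + j - 4).

Let q0F : q0%:F = (px k)%:F * (pz k)%:F + (py k)%:F ^+ 2.
Proof. by rewrite /q0 tofracD tofracM tofracXn. Qed.

Let rel12 (F : fieldType) (x y z q : F) : q != 0 -> q = x * z + y ^+ 2 ->
  (x * y / q) * (y ^+ 2 / q) = (x ^+ 2 / q) * (- (y * z) / q) + x * y / q.
Proof. by move=> q1 e; move: q1; rewrite e => q1; field. Qed.
Let rel22 (F : fieldType) (x y z q : F) : q != 0 -> q = x * z + y ^+ 2 ->
  (y ^+ 2 / q) * (y ^+ 2 / q) =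
  (x ^+ 2 / q) * (z ^+ 2 / q) + (2 * (y ^+ 2 / q) - 1).
Proof. by move=> q1 e; move: q1; rewrite e => q1; field. Qed.
Let rel13 (F : fieldType) (x y z q : F) : q != 0 -> q = x * z + y ^+ 2 ->
  (x * y / q) * (- (y * z) / q) =
  (x ^+ 2 / q) * (z ^+ 2 / q) + ((y ^+ 2 / q) - 1).
Proof. by move=> q1 e; move: q1; rewrite e => q1; field. Qed.
Let rel23 (F : fieldType) (x y z q : F) : q != 0 -> q = x * z + y ^+ 2 ->
  (y ^+ 2 / q) * (- (y * z) / q) =
  (z ^+ 2 / q) * (x * y / q) + (- (y * z) / q).
Proof. by move=> q1 e; move: q1; rewrite e => q1; field. Qed.
Let rel11 (F : fieldType) (x y q : F) : q != 0 ->
  (x * y / q) * (x * y / q) = (x ^+ 2 / q) * (y ^+ 2 / q).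
Proof. by move=> q1; field. Qed.
Let rel33 (F : fieldType) (y z q : F) : q != 0 ->
  (- (y * z) / q) * (- (y * z) / q) = (z ^+ 2 / q) * (y ^+ 2 / q).
Proof. by move=> q1; field. Qed.

Lemma gen_mul l j : (l <= 4)%N -> (j <= 4)%N ->
  gen l * gen j = top l j + low l j.
Proof.
have q1 := q0F_neq0 k; have e := q0F.
have symm l1 j1 : gen l1 * gen j1 = top l1 j1 + low l1 j1 ->
    gen j1 * gen l1 = top j1 l1 + low j1 l1.
  rewrite mulrC => ->; congr (_ + _); first by rewrite /top addnC.
  by case: l1 j1 => [|[|[|[|l1]]]] [|[|[|[|j1]]]].
have r11 : gen 1 * gen 1 = top 1 1 + low 1 1.
  rewrite addr0; apply: OS0_eqP; rewrite /top /low !OS0_valE !gen_val /gen_num /= !tofracXn tofracM.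
  exact: rel11.
have r33 : gen 3 * gen 3 = top 3 3 + low 3 3.
  rewrite addr0; apply: OS0_eqP; rewrite /top /low !OS0_valE !gen_val /gen_num /= !tofracXn tofracN !tofracM.
  exact: rel33.
have r12 : gen 1 * gen 2 = top 1 2 + low 1 2.
  by apply: OS0_eqP; rewrite /top /low !OS0_valE !gen_val /gen_num /= !tofracXn tofracN !tofracM; exact: rel12.
have r22 : gen 2 * gen 2 = top 2 2 + low 2 2.
  have -> : low 2 2 = gen 2 + gen 2 - 1 by rewrite /low mulr_natl mulr2n.
  apply: OS0_eqP; rewrite /top /low !OS0_valE !gen_val /gen_num /= !tofracXn (rel22 q1 e) mulr_natl mulr2n.
  by [].
have r13 : gen 1 * gen 3 = top 1 3 + low 1 3.
  by apply: OS0_eqP; rewrite /top /low !OS0_valE !gen_val /gen_num /= !tofracXn tofracN !tofracM; exact: rel13.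
have r23 : gen 2 * gen 3 = top 2 3 + low 2 3.
  by apply: OS0_eqP; rewrite /top /low !OS0_valE !gen_val /gen_num /= !tofracXn tofracN !tofracM; exact: rel23.
have r0 i : (i <= 4)%N -> gen 0 * gen i = top 0 i + low 0 i.
  by move=> i4; rewrite addr0 /top add0n i4.
have r4 i : (i <= 4)%N -> gen 4 * gen i = top 4 i + low 4 i.
  move=> i4; have [->|i0] := posnP i.
    by rewrite /top addn0 /= addr0 mulrC.
  have -> : top 4 i = gen 4 * gen i 
    by rewrite /top addKn; case: ifP => //; lia.
  by rewrite addr0.
case: l j => [|[|[|[|[|//]]]]] [|[|[|[|[|//]]]]] _ _;
  first [exact: r0|exact: r4|exact/symm/r0|exact/symm/r4|exact/symm|by []].
Qed.

(** The standard monomial with leading form u^i Y^j, for j <= 4 i: [gen 4] is split off as long as j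
    exceeds 4, so at most one generator besides [gen 0] and [gen 4] occurs. *)
Fixpoint mon i j : A := if i is i'.+1 then
  (if (j <= 4)%N then gen j * gen 0 ^+ i' else gen 4 * mon i' (j - 4)%N) else 1.

Lemma mon0 i : mon i 0 = gen 0 ^+ i.
Proof. by case: i => //= i; rewrite exprS. Qed.

(** The span of the standard monomials of degree at most N in u. *)
Inductive filt (N : nat) : A -> Prop :=
| filt0 : filt N 0
| filtS c i j f : (i <= N)%N -> (j <= 4 * i)%N -> filt N f ->
    filt N (c *: mon i j + f).

Lemma filt_mon N c i j : (i <= N)%N -> (j <= 4 * i)%N -> filt N (c *: mon i j).
Proof. by move=> iN j4; rewrite -[_ *: _]addr0; apply: filtS => //; exact: filt0. Qed.

Lemma filtD N f g : filt N f -> filt N g -> filt N (f + g).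
Proof.
move=> hf hg; elim: hf => [|c i j f' iN j4 _ IH]; first by rewrite add0r.
by rewrite -addrA; exact: filtS.
Qed.

Lemma filtZ N c f : filt N f -> filt N (c *: f).
Proof.
elim=> [|d i j f' iN j4 _ IH]; first by rewrite scaler0; exact: filt0.
by rewrite scalerDr scalerA; exact: filtS.
Qed.

Lemma filtN N f : filt N f -> filt N (- f).
Proof. by rewrite -scaleN1r; exact: filtZ. Qed.

Lemma filt_le N M f : (N <= M)%N -> filt N f -> filt M f.
Proof.
move=> NM; elim=> [|d i j f' iN j4 _ IH]; first exact: filt0.
by apply: filtS => //; exact: leq_trans NM.
Qed.

Lemma filt_low i l j : filt i.+1 (low l j * gen 0 ^+ i).
Proof.
have z : filt i.+1 (0 * gen 0 ^+ i) by rewrite mul0r; exact: filt0.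
have g s : (s <= 4)%N -> filt i.+1 (gen s * gen 0 ^+ i).
  move=> s4; have -> : gen s * gen 0 ^+ i = 1 *: mon i.+1 s by rewrite /= s4 scale1r.
  by apply: filt_mon; lia.
have o : filt i.+1 (gen 0 ^+ i).
  by rewrite -mon0 -[mon _ _]scale1r; apply: filt_mon.
case: l j => [|[|[|[|l]]]] [|[|[|[|j]]]] //=; try exact: g.
- by rewrite mulrBl mul1r; apply: filtD; [exact: g|exact: filtN].
- rewrite mulrBl mul1r -mulrA mulr_natl -scaler_nat; apply: filtD; last exact: filtN.
  by apply: filtZ; exact: g.
- by rewrite mulrBl mul1r; apply: filtD; [exact: g|exact: filtN].
Qed.

(** Straightening. The bound N makes the induction strong: the error term is again a sum of standard
    monomials of any smaller degree, and it has to be multiplied by [gen 4] in turn. *)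
Lemma gen_mon N : forall i j l, (i <= N)%N -> (j <= 4 * i)%N -> (l <= 4)%N ->
  exists2 r, filt i r & gen l * mon i j = mon i.+1 (j + l) + r.
Proof.
elim: N => [|N IH] i j l.
  rewrite leqn0 => /eqP-> j0 l4; have -> : j = 0%N by lia.
  by exists 0; [exact: filt0|rewrite /= add0n l4 addr0 expr0].
rewrite leq_eqVlt => /predU1P[->|]; last by exact: IH.
move=> j4 l4; rewrite [mon N.+1 j]/=; case: leqP => [jl|lj].
  exists (low l j * gen 0 ^+ N); first exact: filt_low.
  rewrite mulrA gen_mul // mulrDl; congr (_ + _); rewrite /top addnC.
  rewrite [mon _ _]/=; case: (leqP (j + l) 4) => h.
    by rewrite mulrAC -exprS mulrC.
  have -> : (j + l - 4 <= 4)%N by lia.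
  by rewrite mulrA.
have j4' : (j - 4 <= 4 * N)%N by lia.
have [r fr er] := IH _ _ l (leqnn N) j4' l4.
exists (gen 4 * r); last first.
  rewrite mulrCA er mulrDr; congr (_ + _).
  have -> : mon N.+2 (j + l) = gen 4 * mon N.+1 (j + l - 4).
    by rewrite [LHS]/=; case: leqP => //; lia.
  by congr (_ * mon _ _); lia.
elim: fr => [|c a b f aN b4 _ IHf]; first by rewrite mulr0; exact: filt0.
rewrite mulrDr -scalerAr; apply: filtD => //; apply: filtZ.
have [s fs ->] := IH _ _ 4 aN b4 (leqnn _).
apply: filtD; last by apply: filt_le fs; rewrite leqW.
by rewrite -[mon _ _]scale1r; apply: filt_mon; lia.
Qed.

Lemma filt_gen N l f : (l <= 4)%N -> filt N f -> filt N.+1 (gen l * f).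
Proof.
move=> l4; elim=> [|c i j f' iN j4 _ IH]; first by rewrite mulr0; exact: filt0.
rewrite mulrDr -scalerAr; apply: filtD => //; apply: filtZ.
have [s fs ->] := gen_mon (leqnn i) j4 l4.
apply: filtD; last by apply: filt_le fs; rewrite leqW.
by rewrite -[mon _ _]scale1r; apply: filt_mon; lia.
Qed.

End Coordinates.

Section Spanning.
Variable k : fieldType.
Local Notation "f %:F" := (@FracField.tofrac _ f).
Local Notation P := {mpoly k[3]}.
Local Notation K := {fraction {mpoly k[3]}}.
Local Notation A := (OS0 k).
Local Notation q0 := (q0 k).
Local Notation gen := (gen k).
Local Notation mon := (mon k).

Lemma filt_const N c : filt N (c%:A : A).
Proof. by apply: (@filt_mon _ N c 0 0). Qed.

Fact homog_subproof n (p : P) (hp : p \is (2 * n).-homog) :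
  p%:F / q0%:F ^+ n \in @OS0_pred k.
Proof. by apply/asboolP; exists n, p. Qed.
Definition homog_frac n p hp : A := MkOS0 (@homog_subproof n p hp).

Lemma OS0_frac (f : A) :
  exists n (p : P), p \is (2 * n).-homog /\ OS0_val f = p%:F / q0%:F ^+ n.
Proof. by case: f => f /= /asboolP. Qed.

Lemma XX_homog (i j : 'I_3) : ('X_i * 'X_j : P) \is (2 * 1).-homog.
Proof. by apply: (dhomogM (X_homog k i) (X_homog k j)). Qed.
Definition pair i j : A := homog_frac (XX_homog i j).

Lemma ord3P (Q : 'I_3 -> Prop) :
  Q (@Ordinal 3 0 isT) -> Q (@Ordinal 3 1 isT) -> Q (@Ordinal 3 2 isT) ->
  forall i, Q i.
Proof.
move=> h0 h1 h2 [[|[|[|//]]] lt].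
- by have -> : Ordinal lt = @Ordinal 3 0 isT by exact: val_inj.
- by have -> : Ordinal lt = @Ordinal 3 1 isT by exact: val_inj.
- by have -> : Ordinal lt = @Ordinal 3 2 isT by exact: val_inj.
Qed.

Lemma pairC i j : pair i j = pair j i.
Proof. by apply: OS0_eqP; rewrite /= ['X_i * _]mulrC. Qed.

(** Of the products of two coordinates only xz is not a generator up to sign, and xz = q0 - y^2. *)
Lemma pair_gen i j :
  pair i j = 1 - gen 2 \/ exists2 l, (l <= 4)%N &
    pair i j = gen l \/ pair i j = - gen l.
Proof.
have q1 := q0F_neq0 k.
move: i j; pose o0 := @Ordinal 3 0 isT; pose o1 := @Ordinal 3 1 isT.
pose o2 := @Ordinal 3 2 isT.
have p01 : pair o0 o1 = gen 1 by apply: OS0_eqP; rewrite /= expr1.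
have p12 : pair o1 o2 = - gen 3.
  apply: OS0_eqP; rewrite OS0_valN gen_val /= expr1 /gen_num /= tofracN.
  by rewrite mulNr opprK.
have p02 : pair o0 o2 = 1 - gen 2.
  apply: OS0_eqP; rewrite OS0_valD OS0_valN OS0_val1 gen_val /= expr1.
  apply: (mulIf q1); rewrite mulrBl !divfK // mul1r -tofracB /gen_num /=.
  by congr (_%:F); rewrite /q0 addrK.
have p00 : pair o0 o0 = gen 0 by apply: OS0_eqP; rewrite /= expr1.
have p11 : pair o1 o1 = gen 2 by apply: OS0_eqP; rewrite /= expr1.
have p22 : pair o2 o2 = gen 4 by apply: OS0_eqP; rewrite /= expr1.
apply: ord3P; apply: ord3P.
- by right; exists 0%N; rewrite // -p00; left.
- by right; exists 1%N; rewrite // -p01; left.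
- by left.
- by right; exists 1%N; rewrite // -p01 pairC; left.
- by right; exists 2%N; rewrite // -p11; left.
- by right; exists 3%N; rewrite // -p12; right.
- by left; rewrite -p02 pairC.
- by right; exists 3%N; rewrite // -p12 pairC; right.
- by right; exists 4%N; rewrite // -p22; left.
Qed.

Lemma filt_pair N i j f : filt N f -> filt N.+1 (pair i j * f).
Proof.
move=> h; have [->|[l l4 [->|->]]] := pair_gen i j.
- rewrite mulrBl mul1r; apply: filtD; first by apply: filt_le h; rewrite leqW.
  exact/filtN/filt_gen.
- exact: filt_gen.
- by rewrite mulNr; exact/filtN/filt_gen.
Qed.

Lemma mdeg_split (m : 'X_{1..3}) n : mdeg m = n.+1 ->
  exists i m', m = (U_(i) + m')%MM /\ mdeg m' = n.
Proof.
move=> dm; have [i mi] : exists i, (0 < m i)%N.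
  apply: contrapT => h; move: dm; rewrite mdegE big1 // => i _.
  by apply/eqP; rewrite -leqn0 leqNgt; apply/negP => mi; apply: h; exists i.
have le : (U_(i) <= m)%MM.
  apply/mnm_lepP => j; rewrite mnm1E; case: eqP => // <-; exact: mi.
have em : m = (U_(i) + (m - U_(i)))%MM.
  by apply/mnmP => j; rewrite mnmDE mnmBE subnKC //; move/mnm_lepP: le; apply.
by exists i, (m - U_(i))%MM; split=> //; move: dm; rewrite {1}em mdegD mdeg1 => -[].
Qed.

(** A monomial of degree 2 n is a product of n pairs of coordinates, and each pair raises the
    filtration by one. *)
Lemma filt_mnm n (m : 'X_{1..3}) (hm : mdeg m = (2 * n)%N) (f : A) :
  OS0_val f = ('X_[m])%:F / q0%:F ^+ n -> filt n f.
Proof.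
elim: n m hm f => [|n IH] m hm f vf.
  have m0 : m = 0%MM by apply/eqP; rewrite -mdeg_eq0 hm.
  have -> : f = 1%:A; last exact: filt_const.
  apply: OS0_eqP; rewrite scale1r OS0_val1 vf m0 mpolyX0 expr0 divr1.
  exact: tofrac1.
have hm1 : mdeg m = (2 * n).+2 by rewrite hm mulnS.
have [i [m1 [em hm2]]] := mdeg_split hm1.
have [j [m2 [em1 hm3]]] := mdeg_split hm2.
have hp : ('X_[m2] : P) \is (2 * n).-homog by rewrite dhomogX /= hm3.
have -> : f = pair i j * homog_frac hp.
  apply: OS0_eqP; rewrite OS0_valM vf em em1 /= expr1 !mpolyXD !tofracM.
  by rewrite mulf_div -exprS mulrA.
exact/filt_pair/(IH m2).
Qed.

Lemma filt_homog n (p : P) (hp : p \is (2 * n).-homog) (f : A) :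
  OS0_val f = p%:F / q0%:F ^+ n -> filt n f.
Proof.
have hm m : m \in msupp p -> mdeg m = (2 * n)%N by move=> h; exact: (dhomog_mf hp h).
have sub (s : seq 'X_{1..3}) : (forall m, m \in s -> m \in msupp p) ->
    exists2 g : A, filt n g &
      OS0_val g = (\sum_(m <- s) p@_m *: 'X_[m])%:F / q0%:F ^+ n.
  elim: s => [|m s IH] ss.
    exists 0; [exact: filt0|by rewrite big_nil tofrac0 mul0r].
  have [|g fg vg] := IH; first by move=> l ls; apply: ss; rewrite in_cons ls orbT.
  have hmm : mdeg m = (2 * n)%N by apply/hm/ss; rewrite mem_head.
  have hp1 : ('X_[m] : P) \is (2 * n).-homog by rewrite dhomogX /= hmm.
  exists (p@_m *: homog_frac hp1 + g).
    by apply: filtD => //; apply/filtZ/(filt_mnm hmm).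
  rewrite OS0_valD OS0_valZ vg big_cons (tofracD (p@_m *: 'X_[m])) mulrDl /=; congr (_ + _).
  by rewrite -mul_mpolyC tofracM mulrA.
have [//|g fg] := sub (msupp p); rewrite -mpolyE => vg vf.
by rewrite (_ : f = g) //; apply: OS0_eqP; rewrite vf vg.
Qed.

Lemma filt_all (f : A) : exists N, filt N f.
Proof. by have [n [p [hp vf]]] := OS0_frac f; exists n; exact: filt_homog vf. Qed.

(** The coefficients are grouped by the degree in u, so that c i plays the part of the polynomial in
    Y that multiplies u^i in the leading form. *)
Definition comb N (c : nat -> {poly k}) : A :=
  \sum_(i < N.+1) \sum_(j < (4 * i).+1) (c i)`_j *: mon i j.

Lemma filt_comb N f : filt N f -> exists2 c : nat -> {poly k},
  forall i, (size (c i) <= (4 * i).+1)%N & f = comb N c.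
Proof.
elim=> [|a i0 j0 f' i0N j04 _ [c sc ->]].
  exists (fun _ => 0) => [i|]; first by rewrite size_poly0.
  by rewrite /comb big1 // => i _; rewrite big1 // => j _; rewrite coef0 scale0r.
exists (fun i => c i + (if i == i0 then a *: 'X^j0 else 0)) => [i|].
  rewrite (leq_trans (size_polyD _ _)) // geq_max sc /=.
  case: eqP => [->|_]; last by rewrite size_poly0.
  by rewrite (leq_trans (size_scale_leq _ _)) // size_polyXn.
rewrite /comb; transitivity (\sum_(i < N.+1) (\sum_(j < (4 * i).+1) (c i)`_j *: mon i j
   + if i == i0 :> nat then a *: mon i0 j0 else 0)).
  rewrite big_split /= addrC; congr (_ + _).
  have lt : (i0 < N.+1)%N by [].
  rewrite (bigD1 (Ordinal lt)) //= eqxx big1 ?addr0 // => i ne.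
  by rewrite ifN //; exact: ne.
apply: eq_bigr => i _; case: eqP => [ei|_]; last first.
  by rewrite addr0; apply: eq_bigr => j _; rewrite addr0.
rewrite -ei; have lt : (j0 < (4 * i).+1)%N by rewrite ei.
transitivity (\sum_(j < (4 * i).+1) ((c i)`_j *: mon i j +
   if j == j0 :> nat then a *: mon i j0 else 0)).
  rewrite big_split /=; congr (_ + _).
  rewrite (bigD1 (Ordinal lt)) //= eqxx big1 ?addr0 // => j ne.
  by rewrite ifN //; exact: ne.
apply: eq_bigr => j _; rewrite coefD coefZ coefXn scalerDl; congr (_ + _).
by case: eqP => [->|_]; rewrite ?mulr1 // mulr0 scale0r.
Qed.

Section Homomorphisms.
Variables (R : idomainType) (h h' : {rmorphism A -> R}).
Hypotheses (eq_const : forall c : k, h c%:A = h' c%:A)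
  (eq0 : h (gen 0) = h' (gen 0)) (eq1 : h (gen 1) = h' (gen 1))
  (gen0_neq0 : h (gen 0) != 0).

(** The product of [gen 0] with each of [gen 2], [gen 3], [gen 4] is a polynomial in the earlier
    generators, and the image of [gen 0] can be cancelled in a domain. *)
Lemma eq_rmorphism_OS0 : h =1 h'.
Proof.
have hh l : (l <= 4)%N -> h (gen l) = h' (gen l).
  have e2 : h (gen 2) = h' (gen 2).
    have /(congr1 h) := @gen_mul k 1 1 isT isT.
    have /(congr1 h') := @gen_mul k 1 1 isT isT.
    rewrite /top /low /= !addr0 !rmorphM /= -eq0 -eq1 => -> /(mulfI gen0_neq0).
    by move=> ->.
  have e3 : h (gen 3) = h' (gen 3).
    have /(congr1 h) := @gen_mul k 1 2 isT isT.
    have /(congr1 h') := @gen_mul k 1 2 isT isT.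
    rewrite /top /low /= !rmorphD !rmorphM /= -eq0 -eq1 -e2 => -> /addIr.
    by move=> /(mulfI gen0_neq0) ->.
  have e4 : h (gen 4) = h' (gen 4).
    have /(congr1 h) := @gen_mul k 2 2 isT isT.
    have /(congr1 h') := @gen_mul k 2 2 isT isT.
    rewrite /top /low /= !rmorphD !rmorphM !rmorphN !rmorph_nat !rmorph1 /= -eq0 -e2.
    by move=> -> /addIr /(mulfI gen0_neq0) ->.
  by case: l => [|[|[|[|[|//]]]]].
have hm i j : (j <= 4 * i)%N -> h (mon i j) = h' (mon i j).
  elim: i j => [|i IH] j j4; first by rewrite /= !rmorph1.
  rewrite /=; case: leqP => jl; rewrite !rmorphM ?rmorphXn /= ?eq0 ?hh //.
  by rewrite IH //; lia.
move=> f; have [N] := filt_all f.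
elim=> [|c i j f' _ j4 _ IH]; first by rewrite !rmorph0.
by rewrite !rmorphD /= IH -!(mulr_algl c (mon i j)) (rmorphM h c%:A) (rmorphM h' c%:A) eq_const hm.
Qed.

End Homomorphisms.

Section Evaluation.
Variables (R : comUnitRingType) (eta : {rmorphism k -> R}) (X : 'I_3 -> R).
Hypothesis q0_unit : mmap eta X q0 \is a GRing.unit.

(** The value is read off a chosen fraction p / q0^n. Equality of two fractions is an identity
    between polynomials, so the choice does not matter, and the formula holds for inhomogeneous
    numerators too. *)
Lemma evaluation_exists : exists h : {rmorphism A -> R},
  (forall c : k, h c%:A = eta c) /\
  forall n (p : P) (f : A), OS0_val f = p%:F / q0%:F ^+ n ->
    h f = mmap eta X p / mmap eta X q0 ^+ n.
Proof.
have /choice[rep repP] : forall f : A, exists r : nat * P,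
    OS0_val f = r.2%:F / q0%:F ^+ r.1.
  by move=> f; have [n [p [_ e]]] := OS0_frac f; exists (n, p).
pose h (f : A) := mmap eta X (rep f).2 / mmap eta X q0 ^+ (rep f).1.
have hE n (p : P) (f : A) : OS0_val f = p%:F / q0%:F ^+ n ->
    h f = mmap eta X p / mmap eta X q0 ^+ n.
  move=> vf; rewrite /h; move: (etrans (esym vf) (repP f)).
  case: (rep f) => n1 p1 /= /eqP.
  rewrite -!tofracXn eq_fraction ?expf_neq0 ?q0_neq0 // => /eqP.
  move=> /(congr1 (mmap eta X)); rewrite !rmorphM !rmorphXn /= => e.
  have u1 := unitrX n1 q0_unit; have u := unitrX n q0_unit.
  apply: (mulIr u1); apply: (mulIr u); rewrite divrK // [RHS]mulrAC divrK //.
have hz : zmod_morphism h.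
  move=> f g; have [n [p [hp ef]]] := OS0_frac f.
  have [m [r [hr eg]]] := OS0_frac g; rewrite (hE _ _ _ ef) (hE _ _ _ eg).
  rewrite (hE (n + m)%N (p * q0 ^+ m - r * q0 ^+ n)).
    rewrite rmorphB !rmorphM !rmorphXn exprD /=.
    have u1 := unitrX m q0_unit; have u := unitrX n q0_unit.
    rewrite invrM // mulrBl !mulrA; congr (_ - _); last first.
      by rewrite mulrAC mulrK // 
         -mulrA [_^-1 * _]mulrC mulrA.
    by rewrite mulrK.
  rewrite OS0_valD OS0_valN ef eg tofracB !tofracM !tofracXn exprD.
  have qn := expf_neq0 n (q0F_neq0 k); have qm := expf_neq0 m (q0F_neq0 k).
  rewrite invfM mulrBl; congr (_ - _); first by rewrite mulrACA (divff qm) mulr1.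
  by rewrite [X in _ = _ * X]mulrC mulrACA (divff qn) mulr1.
have hm : monoid_morphism h.
  split=> [|f g].
    rewrite (hE 0%N 1); first by rewrite rmorph1 expr0 divr1.
    by rewrite tofrac1 expr0 divr1.
  have [n [p [hp ef]]] := OS0_frac f.
  have [m [r [hr eg]]] := OS0_frac g; rewrite (hE _ _ _ ef) (hE _ _ _ eg).
  rewrite (hE (n + m)%N (p * r)).
    rewrite rmorphM exprD /= invrM ?unitrX //.
    by rewrite [RHS]mulrACA [X in _ = _ * X]mulrC.
  by rewrite OS0_valM ef eg tofracM exprD mulf_div.
pose h' : {rmorphism A -> R} := HB.pack h
  (GRing.isZmodMorphism.Build _ _ h hz) (GRing.isMonoidMorphism.Build _ _ h hm).
exists h'; split=> [c|]; last exact: hE.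
rewrite [h' _](hE 0%N (c%:MP)); first by rewrite mmapC expr0 divr1.
by rewrite OS0_valZ OS0_val1 mulr1 expr0 divr1.
Qed.

End Evaluation.

End Spanning.

(** * Leading terms of combinations of standard monomials *)

Section LeadingOfCombinations.
Variable k : fieldType.
Local Notation A := (OS0 k).
Variables (R S : comNzRingType) (Ld : R -> int -> S -> Prop).
Variables (eta : {rmorphism k -> S}) (h : {rmorphism A -> R}).
Hypotheses (Ld0 : forall x, Ld 0 x 0)
  (LdD : forall f g x c d, Ld f x c -> Ld g x d -> Ld (f + g) x (c + d))
  (LdM : forall f g x y c d, Ld f x c -> Ld g y d -> Ld (f * g) (x + y) (c * d))
  (Ld1 : Ld 1 0 1)
  (Ld_low : forall f x y c, Ld f x c -> x < y -> Ld f y 0)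
  (Ld_const : forall c, Ld (h c%:A) 0 (eta c)).
Variables (a b : nat) (Q : nat -> S).
Hypothesis Ld_gen : forall l, (l <= 4)%N -> Ld (h (gen k l)) (a + b * l)%N (Q l).

(** Follows the recursion of [mon], with Q l as leading coefficient of [gen l]. The relation [Ld] is
    left abstract since it serves for degree fields, for polynomials in T over them, and for
    polynomials in Y. *)
Fixpoint mon_top i j : S := if i is i'.+1 then
  (if (j <= 4)%N then Q j * Q 0%N ^+ i' else Q 4 * mon_top i' (j - 4)%N) else 1.

Lemma Ld_exp f x c n : Ld f x c -> Ld (f ^+ n) (x *+ n) (c ^+ n).
Proof.
move=> hf; elim: n => [|n IH]; first by rewrite !expr0 mulr0n; exact: Ld1.
by rewrite !exprS mulrS; exact: LdM.
Qed.

Lemma Ld_mon i j : (j <= 4 * i)%N -> Ld (h (mon k i j)) (a * i + b * j)%N (mon_top i j).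
Proof.
elim: i j => [|i IH] j j4.
  by have -> : j = 0%N by [lia]; rewrite !muln0 /= rmorph1; exact: Ld1.
rewrite /=; case: leqP => jl; rewrite rmorphM ?rmorphXn.
  have := LdM (Ld_gen jl) (Ld_exp i (Ld_gen (leq0n 4))).
  have -> : (a + b * j)%N%:Z + (a + b * 0)%N%:Z *+ i = (a * i.+1 + b * j)%N%:Z.
    by rewrite muln0 addn0 -mulr_natr natz -PoszM -PoszD mulnS; congr Posz; lia.
  exact.
have := LdM (Ld_gen (leqnn 4)) (IH (j - 4)%N _).
have -> : (a + b * 4)%N%:Z + (a * i + b * (j - 4))%N%:Z = (a * i.+1 + b * j)%N%:Z.
  have := mulnBr b j 4; have := leq_mul (leqnn b) (ltnW jl).
  by rewrite -PoszD mulnS => ? ?; congr Posz; lia.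
by apply; lia.
Qed.

Definition comb_top N (c : nat -> {poly k}) W : S :=
  \sum_(i < N.+1) \sum_(j < (4 * i).+1)
    eta (if (a * i + b * j == W)%N then (c i)`_j else 0) * mon_top i j.

Lemma Ld_comb N (c : nat -> {poly k}) (W : nat) :
  (forall i j, (i <= N)%N -> (j <= 4 * i)%N -> (c i)`_j != 0 ->
     (a * i + b * j <= W)%N) ->
  Ld (h (comb N c)) W (comb_top N c W).
Proof.
move=> hW; rewrite /comb /comb_top rmorph_sum.
apply: (big_ind2 (fun f g => Ld f W g)) => [//|????|i _]; first exact: LdD.
rewrite rmorph_sum.
apply: (big_ind2 (fun f g => Ld f W g)) => [//|????|j _]; first exact: LdD.
have iN : (i <= N)%N by rewrite -ltnS.
have j4 : (j <= 4 * i)%N by rewrite -ltnS.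
rewrite -mulr_algl rmorphM /=.
have hm := LdM (Ld_const (c i)`_j) (Ld_mon j4); rewrite add0r in hm.
have [cz|cnz] := eqVneq (c i)`_j 0.
  rewrite cz in hm *; rewrite if_same rmorph0 !mul0r.
  rewrite (_ : (0%:A : A) = 0) ?scale0r // rmorph0 mul0r; exact: Ld0.
have le := hW i j iN j4 cnz; case: eqP => [<-//|ne].
rewrite rmorph0 mul0r; apply: Ld_low hm _; lia.
Qed.

End LeadingOfCombinations.

Lemma mon_top_monomial (S : comNzRingType) (Q : nat -> S) (U V : S) :
  (forall l, (l <= 4)%N -> Q l = U * V ^+ l) ->
  forall i j, (j <= 4 * i)%N -> mon_top Q i j = U ^+ i * V ^+ j.
Proof.
move=> hQ; elim=> [|i IH] j j4 /=.
  by have -> : j = 0%N by [lia]; rewrite !expr0 mulr1.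
case: leqP => jl; first by rewrite !hQ // expr0 mulr1 exprS mulrAC.
rewrite hQ // IH; last by lia.
by rewrite mulrACA -exprS -exprD addnC subnK // ltnW.
Qed.

Lemma mon_top_veronese (S : comNzRingType) (Q : nat -> S) (G al be : S) :
  (forall l, (l <= 4)%N -> Q l = G * al ^+ (4 - l) * be ^+ l) ->
  forall i j, (j <= 4 * i)%N ->
    mon_top Q i j = G ^+ i * al ^+ (4 * i - j) * be ^+ j.
Proof.
move=> hQ; elim=> [|i IH] j j4 /=.
  by have -> : j = 0%N by [lia]; rewrite !expr0 !mulr1.
case: leqP => jl.
  rewrite !hQ // subn0 expr0 mulr1.
  have -> : (4 * i.+1 - j = (4 - j) + 4 * i)%N by lia.
  rewrite exprMn -exprM exprD (exprS G).
  by move: (G ^+ i) (al ^+ _) (al ^+ _) (be ^+ j) => ? ? ? ?; ring.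
rewrite hQ // subnn expr0 mulr1 IH; last by lia.
have -> : (4 * i - (j - 4) = 4 * i.+1 - j)%N by lia.
have -> : be ^+ j = be ^+ 4 * be ^+ (j - 4) by rewrite -exprD subnKC // ltnW.
rewrite (exprS G).
by move: (G ^+ i) (al ^+ _) (be ^+ 4) (be ^+ (j - 4)) => ? ? ? ?; ring.
Qed.

Section Points.
Variable k : fieldType.
Local Notation "f %:F" := (@FracField.tofrac _ f).
Local Notation A := (OS0 k).

(** The point with u = U and Y = V. The coordinates [U : U V : 1 - U V^2] are scaled so that q0 = U,
    which is also the value of x. *)
Lemma point_exists (R : comUnitRingType) (eta : {rmorphism k -> R}) (U V : R) :
  U \is a GRing.unit -> exists h : {rmorphism A -> R},
    [/\ forall c : k, h c%:A = eta c, h (gen k 0) = U & h (gen k 1) = U * V].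
Proof.
move=> Uu; pose X (i : 'I_3) := nth 0 [:: U; U * V; 1 - U * V ^+ 2] i.
have mX (i : 'I_3) : mmap eta X 'X_i = X i by rewrite mmapX mmap1U.
have qE : mmap eta X (q0 k) = U.
  rewrite /q0 rmorphD rmorphM rmorphXn /= !mX /X /=; ring.
have qu : mmap eta X (q0 k) \is a GRing.unit by rewrite qE.
have [h [hc hE]] := evaluation_exists qu; exists h; split=> //.
  rewrite (hE 1%N (gen_num k 0) (gen k 0)) ?expr1 // qE.
  by rewrite /gen_num /= rmorphXn /= mX /X /= expr2 mulrK.
rewrite (hE 1%N (gen_num k 1) (gen k 1)) ?expr1 // qE.
by rewrite /gen_num /= rmorphM /= !mX /X /= mulrAC divrr // mul1r.
Qed.

Lemma rmorph_gen (R : comUnitRingType) (h : {rmorphism A -> R}) (U V : R) :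
  U \is a GRing.unit -> h (gen k 0) = U -> h (gen k 1) = U * V ->
  [/\ h (gen k 2) = U * V ^+ 2, h (gen k 3) = U * V ^+ 3 - V
    & h (gen k 4) = U * V ^+ 4 - 2 * V ^+ 2 + U^-1].
Proof.
move=> Uu e0 e1.
have e2 : h (gen k 2) = U * V ^+ 2.
  have /(congr1 h) := @gen_mul k 1 1 isT isT.
  rewrite /top /low /= addr0 !rmorphM /= e0 e1 => e; apply: (mulrI Uu).
  by rewrite -e; ring.
have e3 : h (gen k 3) = U * V ^+ 3 - V.
  have /(congr1 h) := @gen_mul k 1 2 isT isT.
  rewrite /top /low /= !rmorphD !rmorphM /= e0 e1 e2 => e; apply: (mulrI Uu).
  by rewrite mulrBr; apply: (addIr (U * V)); rewrite -e; ring.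
have e4 : h (gen k 4) = U * V ^+ 4 - 2 * V ^+ 2 + U^-1.
  have /(congr1 h) := @gen_mul k 2 2 isT isT.
  rewrite /top /low /= !rmorphD !rmorphM !rmorphN !rmorph_nat !rmorph1 /= e0 e2.
  move=> e; apply: (mulrI Uu); rewrite mulrDr mulrV //.
  by apply: (addIr (2 * (U * V ^+ 2) - 1)); rewrite -e; ring.
by [].
Qed.

End Points.

Section Tops.
Local Notation "f %:F" := (@FracField.tofrac _ f).
Variables (k L : fieldType) (E : degreeField L) (j : {rmorphism k -> L}).
Variables (u Y : L).
Hypothesis independent : forall N (c : nat -> {poly k}),
  \sum_(i < N) u ^+ i * (map_poly j (c i)).[Y] = 0 ->
  forall i, (i < N)%N -> c i = 0.

Local Notation A := (OS0 k).
Local Notation lead := (@dlead L E).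

Definition scal : k -> E := dconst E \o j.
HB.instance Definition _ := GRing.RMorphism.on scal.

Lemma u_neq0 : u != 0.
Proof.
apply/eqP => u0; have := @independent 2 (fun i => (i == 1)%:R).
rewrite !big_ord_recl big_ord0 /= u0 rmorph0 horner0 rmorph1.
rewrite !mulr0 expr1 mul0r !addr0 => /(_ erefl 1%N isT)/eqP.
by rewrite oner_eq0.
Qed.

Lemma Y_neq0 : Y != 0.
Proof.
apply/eqP => Y0; have := @independent 1 (fun i => 'X).
rewrite big_ord_recl big_ord0 /= map_polyX hornerX Y0 mulr0 addr0.
by move=> /(_ erefl 0%N isT)/eqP; rewrite polyX_eq0.
Qed.

Section LeadPoint.
Variables (h : {rmorphism A -> E}) (a b : nat) (U V : E) (U1 V1 : L).
Hypotheses (h_const : forall c : k, h c%:A = scal c)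
  (h0 : h (gen k 0) = U) (h1 : h (gen k 1) = U * V)
  (a_gt0 : (0 < a)%N) (U_lead : lead U a U1) (V_lead : lead V b V1)
  (U1_neq0 : U1 != 0).

Lemma lead_gen l : (l <= 4)%N -> lead (h (gen k l)) (a + b * l)%N (U1 * V1 ^+ l).
Proof.
have U0 : U \is a GRing.unit.
  rewrite unitfE; apply: contraNneq U1_neq0 => z; have := U_lead; rewrite z => lz.
  by rewrite (dlead_uniq lz (dlead0 _ _)).
have [h2 h3 h4] := rmorph_gen U0 h0 h1.
have UV n : lead (U * V ^+ n) (a + b * n)%N (U1 * V1 ^+ n).
  have := dleadM U_lead (leadX n V_lead).
  by rewrite -mulr_natr natz -PoszM -PoszD.
case: l => [|[|[|[|[|//]]]]] _.
- by rewrite h0 -[U]mulr1 -[1](expr0 V); exact: UV.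
- by rewrite h1 -{1}[V]expr1; exact: UV.
- by rewrite h2; exact: UV.
- rewrite h3 -[U1 * _]subr0; apply: dleadD; first exact: UV.
  by apply/leadN/(dlead_low V_lead); lia.
- rewrite h4 -[U1 * _]addr0 -{1}[U1 * _]subr0.
  apply: dleadD; last by apply: (dlead_low (dleadV U_lead U1_neq0)); lia.
  apply: dleadD; first exact: UV.
  apply: leadN.
  have := dleadM (dleadD (lead1 E) (lead1 E)) (leadX 2 V_lead).
  by move/dlead_low; apply; lia.
Qed.

(** The part of weight W of [comb n c], each [mon i l] being replaced by its leading form; it may be
    0 at special U, V, but by [topsum_neq0] not at u, Y. *)
Definition topsum n (c : nat -> {poly k}) W (U V : L) : L :=
  \sum_(i < n.+1) \sum_(l < (4 * i).+1)
    j (if (a * i + b * l == W)%N then (c i)`_l else 0) * (U ^+ i * V ^+ l).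

Lemma lead_comb N (c : nat -> {poly k}) (W : nat) :
  (forall i l, (i <= N)%N -> (l <= 4 * i)%N -> (c i)`_l != 0 ->
     (a * i + b * l <= W)%N) ->
  lead (h (comb N c)) W (topsum N c W U1 V1).
Proof.
move=> hW.
have hc c0 : lead (h c0%:A) 0 (j c0) by rewrite h_const; exact: dlead_const.
have := Ld_comb (@dlead0 L E) (@dleadD L E) (@dleadM L E) (lead1 E) (@dlead_low L E) hc
  lead_gen hW.
rewrite /comb_top /topsum (eq_bigr (fun i : 'I_N.+1 => \sum_(l < (4 * i).+1)
    j (if (a * i + b * l == W)%N then (c i)`_l else 0) * (U1 ^+ i * V1 ^+ l))) //.
move=> i _; apply: eq_bigr => l _; rewrite (@mon_top_monomial _ _ U1 V1) //.
by rewrite -ltnS.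
Qed.

End LeadPoint.

Lemma topsum_neq0 a b N (c : nat -> {poly k}) W i l :
  (i <= N)%N -> (l <= 4 * i)%N -> (c i)`_l != 0 -> (a * i + b * l = W)%N ->
  topsum a b N c W u Y != 0.
Proof.
move=> iN l4 cil eW; apply/eqP => T0.
pose d i' := \poly_(l' < (4 * i').+1)
  (if (a * i' + b * l' == W)%N then (c i')`_l' else 0).
have := @independent N.+1 d _ i iN.
suff TE : \sum_(i < N.+1) u ^+ i * (map_poly j (d i)).[Y] = topsum a b N c W u Y.
  rewrite TE => /(_ T0)/(congr1 (fun p : {poly k} => p`_l)).
  by rewrite coef_poly ltnS l4 eW eqxx coef0; apply/eqP.
apply: eq_bigr => i' _; rewrite (@horner_coef_wide _ (4 * i').+1); last first.
  by rewrite (leq_trans (size_poly _ _)) // size_poly.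
rewrite mulr_sumr; apply: eq_bigr => l' _.
by rewrite coef_map coef_poly ltn_ord mulrCA.
Qed.

(** A generic point whose coordinates have degrees a and b with leading coefficients u and Y. The
    leading coefficient of a function at this point is its leading form for the weights a, b, seen
    as an element of L. *)
Lemma wpt_exists (a b : nat) : exists h : {rmorphism A -> E},
  exists U V, [/\ forall c : k, h c%:A = scal c, h (gen k 0) = U,
     h (gen k 1) = U * V, lead U a u & lead V b Y].
Proof.
have [U lU] := dlead_onto E a u; have [V lV] := dlead_onto E b Y.
have U0 : U \is a GRing.unit.
  rewrite unitfE; apply: contraNneq u_neq0 => z; rewrite z in lU.
  by rewrite (dlead_uniq lU (dlead0 _ _)).
have [h [hc h0 h1]] := point_exists scal V U0.
by exists h, U, V.
Qed.

Definition wpt a b : {rmorphism A -> E} := projT1 (cid (wpt_exists a b)).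

Lemma wptP a b : exists U V, [/\ forall c : k, wpt a b c%:A = scal c,
  wpt a b (gen k 0) = U, wpt a b (gen k 1) = U * V, lead U a u & lead V b Y].
Proof. exact: projT2 (cid (wpt_exists a b)). Qed.

Lemma lead_wpt a b N (c : nat -> {poly k}) (W : nat) : (0 < a)%N ->
  (forall i l, (i <= N)%N -> (l <= 4 * i)%N -> (c i)`_l != 0 ->
     (a * i + b * l <= W)%N) ->
  lead (wpt a b (comb N c)) W (topsum a b N c W u Y).
Proof.
have [U [V [hc h0 h1 lU lV]]] := wptP a b => a0.
exact: (lead_comb hc h0 h1 a0 lU lV u_neq0).
Qed.

Definition trimmed n (c : nat -> {poly k}) : Prop :=
  (forall i, (size (c i) <= (4 * i).+1)%N) /\ c n != 0.

Lemma comb_exists (f : A) : f != 0 -> exists n c, trimmed n c /\ f = comb n c.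
Proof.
have [N /filt_comb[c sc ->]] := filt_all f; elim: N => [|N IH] f0.
  exists 0%N, c; split=> //; split=> //; apply: contraNneq f0 => c0.
  by rewrite /comb big_ord1 big1 // => i _; rewrite c0 coef0 scale0r.
have [cz|cnz] := eqVneq (c N.+1) 0; last by exists N.+1, c.
have e : comb N.+1 c = comb N c.
  rewrite /comb big_ord_recr /= [X in _ + X]big1 ?addr0 // => i _.
  by rewrite cz coef0 scale0r.
by rewrite e in f0 *; exact: IH.
Qed.

Lemma comb_max a b n c : trimmed n c -> exists2 W : nat,
  forall i l, (i <= n)%N -> (l <= 4 * i)%N -> (c i)`_l != 0 ->
     (a * i + b * l <= W)%N &
  exists i l, [/\ (i <= n)%N, (l <= 4 * i)%N, (c i)`_l != 0 &
     (a * i + b * l)%N = W].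
Proof.
move=> [sc cn].
pose Q (W : nat) := [exists i : 'I_n.+1, [exists l : 'I_(4 * i).+1,
   ((c i)`_l != 0) && (a * i + b * l == W)%N]].
have QP W : reflect (exists i l, [/\ (i <= n)%N, (l <= 4 * i)%N, (c i)`_l != 0 &
     (a * i + b * l)%N = W]) (Q W).
  apply: (iffP existsP) => [[i /existsP[l /andP[h /eqP e]]]|[i [l [h1 h2 h3 h4]]]].
    by exists i, l; rewrite -ltnS ltn_ord -(ltnS l) ltn_ord.
  exists (Ordinal (h1 : i < n.+1)%N); apply/existsP.
  by exists (Ordinal (h2 : l < (4 * i).+1)%N); rewrite h3 h4 eqxx.
have exQ : exists W, Q W.
  exists (a * n + b * (size (c n)).-1)%N; apply/QP.
  exists n, (size (c n)).-1; split=> //.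
    by rewrite -ltnS (leq_trans _ (sc n)) // prednK // size_poly_gt0.
  by rewrite -[_`__]/(lead_coef _) lead_coef_eq0.
have bound W : Q W -> (W <= a * n + b * (4 * n))%N.
  move=> /QP[i [l [h1 h2 _ <-]]]; apply: leq_add; rewrite leq_mul2l ?h1 ?orbT //.
  by rewrite (leq_trans h2) ?orbT // leq_mul2l h1 orbT.
case: (ex_maxnP exQ bound) => W /QP hW maxW; exists W => // i l h1 h2 h3.
by apply: maxW; apply/QP; exists i, l.
Qed.

End Tops.

Section Comorphisms.
Variables (k : fieldType) (A : comAlgType k) (Phi : autSpec A).

Fact comorph_zmod_morphism : zmod_morphism (comorph Phi).
Proof.
move=> x y; have -> : x - y = -1 *: y + x by rewrite scaleN1r addrC.
by rewrite comorph_linear scaleN1r addrC.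
Qed.
HB.instance Definition _ :=
  GRing.isZmodMorphism.Build A A (comorph Phi) comorph_zmod_morphism.
HB.instance Definition _ :=
  GRing.isMonoidMorphism.Build A A (comorph Phi) (comorph_monoid Phi).

Lemma comorph_const c : comorph Phi c%:A = c%:A.
Proof. by rewrite -{1}[c%:A]addr0 comorph_linear rmorph0 addr0 rmorph1. Qed.

Lemma comorphV_const c : comorphV Phi c%:A = c%:A.
Proof. by rewrite -{1}(comorph_const c) comorphK. Qed.

Lemma comorphZ c f : comorph Phi (c *: f) = c *: comorph Phi f.
Proof. by rewrite -{1}[c *: f]addr0 comorph_linear rmorph0 addr0. Qed.

Lemma comorphM (Psi : autSpec A) f :
  comorph (Phi * Psi)%g f = comorph Psi (comorph Phi f).
Proof. by []. Qed.

Lemma comorphVE f : comorph Phi^-1%g f = comorphV Phi f.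
Proof. by []. Qed.

End Comorphisms.

(** * Degeneration of the conjugated translations *)

Lemma max_slope (T : finType) (Q : pred T) (num : T -> int) (den : T -> nat) x0 :
  Q x0 -> (forall x, Q x -> (0 < den x)%N) ->
  exists2 x, Q x & forall y, Q y -> num y * (den x)%:Z <= num x * (den y)%:Z.
Proof.
move=> Q0 dpos; pose F x : rat := (num x)%:Q / (den x)%:R.
case: (Order.TotalTheory.arg_maxP F Q0) => x Qx xmax; exists x => // y Qy.
have := xmax y Qy; rewrite /F => le.
have dx : 0 < (den x)%:R :> rat by rewrite ltr0n dpos.
have dy : 0 < (den y)%:R :> rat by rewrite ltr0n dpos.
by rewrite -(ler_int rat) !intrM; move: le; rewrite /Order.ge /= ler_pdivlMr // mulrAC ler_pdivrMr.
Qed.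

Section Degeneration.
Variables (k L : fieldType) (E : degreeField L) (j : {rmorphism k -> L}).
Variables (u Y : L).
Hypothesis independent : forall N (c : nat -> {poly k}),
  \sum_(i < N) u ^+ i * (map_poly j (c i)).[Y] = 0 ->
  forall i, (i < N)%N -> c i = 0.
Local Notation A := (OS0 k).
Local Notation lead := (@dlead L E).
Local Notation gen := (gen k).
Local Notation u_neq0 := (u_neq0 independent).
Local Notation topsum_neq0 := (topsum_neq0 independent).

(* The conjugate by phi of the action Y |-> Y + T fixes F = phi^*(u).  Its
   leading part for the weights a, b of u, Y is a polynomial curve
   (al : be) with scaling factor G, on which the leading part of F is constant. *)
Lemma degeneration (phi : autSpec A) (F : A) (a b n W : nat) (c : nat -> {poly k}) :
  F = comorph phi (gen 0) -> (0 < a)%N -> trimmed n c -> F = comb n c ->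
  (forall i l, (i <= n)%N -> (l <= 4 * i)%N -> (c i)`_l != 0 ->
     (a * i + b * l <= W)%N) ->
  (exists i l, [/\ (i <= n)%N, (l <= 4 * i)%N, (c i)`_l != 0 &
     (a * i + b * l)%N = W]) ->
  exists G al be : {poly L}, [/\ al != 0,
    ~~ [&& is_const G, is_const al & is_const be],
    u = G`_0 * al`_0 ^+ 4, be`_0 = Y * al`_0 &
    \sum_(i < n.+1) \sum_(l < (4 * i).+1)
      (j (if (a * i + b * l == W)%N then (c i)`_l else 0))%:P *
        (G ^+ i * al ^+ (4 * i - l) * be ^+ l)
    = (topsum j a b n c W u Y)%:P /\ topsum j a b n c W u Y != 0].
Proof.
move=> FE a0 [sc cn] Fc leW [iM [lM [hi0 hl0 hc0 hW0]]].
have T0 := topsum_neq0 hi0 hl0 hc0 hW0.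
have := wptP E independent a b; set io := wpt E _ a b => -[U0 [V0 [ioc io0 io1 lU lV]]].
have lF : lead (io F) W (topsum j a b n c W u Y).
  by rewrite Fc; exact: lead_wpt.
have ioF0 : io F != 0.
  by apply: contraNneq T0 => z; rewrite z in lF; rewrite (dlead_uniq lF (dlead0 _ _)).
(* The image under phi of the generic point has u = [io F] and Y = [V1]. In [Xi1] its second
   coordinate is translated by T = ['X], and [Xi] returns through the inverse of phi. *)
pose V1 := io (comorph phi (gen 1)) / io F.
have unitF : (io F)%:P \is a GRing.unit by rewrite poly_unitE size_polyC ioF0 coefC /= unitfE.
pose scalP : {rmorphism k -> {poly E}} := polyC \o scal E j.
have [Xi1 [Xi1c Xi10 Xi11]] := point_exists scalP (V1%:P + 'X) unitF.
have scalPE c0 : scalP c0 = (scal E j c0)%:P by [].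
have {}Xi1c c0 : Xi1 c0%:A = (scal E j c0)%:P by rewrite -scalPE; exact: Xi1c.
have [Xi XiE] : exists Xi : {rmorphism A -> {poly E}},
    forall f, Xi f = Xi1 (comorphV phi f).
  by exists (Xi1 \o comorph phi^-1%g).
have Xic c0 : Xi c0%:A = (scal E j c0)%:P.
  by rewrite XiE comorphV_const Xi1c.
have XiF : Xi F = (io F)%:P by rewrite XiE {1}FE comorphK Xi10.
have Xi_phi f : Xi (comorph phi f) = Xi1 f by rewrite XiE comorphK.
(* At T = 0 nothing is translated; by [eq_rmorphism_OS0] the comparison is needed on constants,
   [gen 0] and [gen 1] only. *)
have Xi_0 f : (Xi f)`_0 = io f.
  rewrite -(comorphVK phi f) Xi_phi -horner_coef0.
  move: (comorphV phi f) => g.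
  pose h1 : {rmorphism A -> E} := horner_eval 0 \o Xi1.
  pose h2 : {rmorphism A -> E} := io \o comorph phi.
  apply: (@eq_rmorphism_OS0 _ _ h1 h2) => [c0|||].
  - by rewrite /h1 /h2 /= comorph_const Xi1c ioc /horner_eval hornerC.
  - by rewrite /h1 /h2 /= Xi10 /horner_eval hornerC FE.
  - rewrite /h1 /h2 /= Xi11 /horner_eval hornerM hornerD hornerX !hornerC addr0.
    by rewrite mulrC divfK.
  - by rewrite /h1 /= Xi10 /horner_eval hornerC.
(* If the five generators had images free of T, so would every function, but the image of
   [comorph phi (gen 1)] is [io F] times [V1 + T]. *)
have nonconst : exists l i, [/\ (l <= 4)%N, (0 < i)%N & (Xi (gen l))`_i != 0].
  apply: contrapT => none.
  have gc l : (l <= 4)%N -> exists x, Xi (gen l) = x%:P.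
    move=> l4; exists (Xi (gen l))`_0; apply: size1_polyC; apply/leq_sizeP => i i1.
    by apply/eqP; apply: contrapT => /negP z; apply: none; exists l, i.
  have mc i l : (l <= 4 * i)%N -> exists x, Xi (mon k i l) = x%:P.
    elim: i l => [|i IH] l l4; first by exists 1; rewrite rmorph1.
    rewrite /=; case: leqP => l4'; rewrite rmorphM ?rmorphXn /=.
      have [x ->] := gc _ l4'; have [y ->] := gc 0%N isT.
      by exists (x * y ^+ i); rewrite polyCM polyC_exp.
    have [x ->] := gc _ (leqnn 4); have [|y ->] := IH (l - 4)%N; first lia.
    by exists (x * y); rewrite polyCM.
  have allc f : exists x, Xi f = x%:P.
    have [N] := filt_all f; elim=> [|d i l g _ l4 _ [y ey]].
      by exists 0; rewrite rmorph0.
    have [x ex] := mc i l l4; exists (scal E j d * x + y).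
    by rewrite rmorphD /= ey -mulr_algl rmorphM /= Xic ex polyCD polyCM.
  have [x] := allc (comorph phi (gen 1)); rewrite Xi_phi Xi11.
  move=> /(congr1 (fun p : {poly E} => p`_1)); rewrite coefCM coefD coefX !coefC /= add0r mulr1.
  exact/eqP.
have [deg degP] : exists deg : nat * nat -> int, forall x,
    (Xi (gen x.1))`_x.2 != 0 ->
    exists c0, c0 != 0 /\ lead (Xi (gen x.1))`_x.2 (deg x) c0.
  have /choice[deg hdeg] : forall x : nat * nat, exists m : int,
      (Xi (gen x.1))`_x.2 != 0 ->
      exists c0, c0 != 0 /\ lead (Xi (gen x.1))`_x.2 m c0.
    move=> x; have [z|nz] := eqVneq (Xi (gen x.1))`_x.2 0; first by exists 0.
    by have [m [c0 hc]] := dlead_exists nz; exists m => _; exists c0.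
  by exists deg.
pose B := (\max_(l < 5) size (Xi (gen l))).+1.
have sB (l : 'I_5) : (size (Xi (gen l)) <= B)%N.
  by apply: leqW; exact: (leq_bigmax (F := fun l : 'I_5 => size (Xi (gen l)))).
pose Q (x : 'I_5 * 'I_B) := (0 < x.2)%N && ((Xi (gen x.1))`_x.2 != 0).
have [x0 Qx0] : exists x, Q x.
  have [l [i [l4 i1 nz]]] := nonconst.
  have iB : (i < B)%N.
    apply: contraNT nz; rewrite -leqNgt => Bi; rewrite nth_default //.
    by rewrite (leq_trans (sB (Ordinal (l4 : l < 5)%N))).
  by exists (Ordinal (l4 : l < 5)%N, Ordinal iB); rewrite /Q /= i1.
(* The excess of the degree of the coefficient of T^i in [Xi (gen l)] over the weight a + b l.
   Divided by i, its maximum kappa / M fixes the degree of T: every [Xi (gen l)] then stays within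
   its weight, and at the maximizing pair T survives in the leading part. *)
pose num (x : 'I_5 * 'I_B) := deg (x.1 : nat, x.2 : nat) - (a + b * x.1)%N%:Z.
have [|x Qx xmax] := @max_slope _ Q num (fun x => x.2) x0 Qx0.
  by move=> x /andP[].
pose M : nat := x.2; pose kappa := num x.
have M0 : (0 < M)%N by case/andP: Qx.
have x2nz : (Xi (gen x.1))`_x.2 != 0 by case/andP: Qx.
pose lev l : nat := (M * (a + b * l))%N.
have coefP l i : (l <= 4)%N -> exists c0 : L,
    [/\ leadq M ((Xi (gen l))`_i) ((lev l)%:Z + kappa *+ i) c0,
        (size (Xi (gen l)) <= i)%N -> c0 = 0, i = 0%N -> c0 = u * Y ^+ l &
        (l = x.1 :> nat) -> (i = x.2 :> nat) -> c0 != 0].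
  move=> l4; have [z|nz] := eqVneq (Xi (gen l))`_i 0.
    exists 0; split=> //; first by rewrite z; exact: leadq0.
      move=> i0; move: z; rewrite i0 Xi_0 => z.
      have := lead_gen io0 io1 a0 lU lV u_neq0 l4.
      by rewrite z => /(dlead_uniq (dlead0 E _)).
    by move=> el ei; move: x2nz; rewrite -el -ei z eqxx.
  have li : (i < size (Xi (gen l)))%N.
    by rewrite ltnNge; apply: contraNN nz => le; rewrite nth_default.
  have [i0|i1] := posnP i.
    exists (u * Y ^+ l); split=> //.
    - rewrite i0 mulr0n addr0 Xi_0.
      have := lead_gen io0 io1 a0 lU lV u_neq0 l4.
      move=> /(leadq_le (M := M) M0 (x := (lev l)%:Z)).
      by rewrite /lev -PoszM lexx eqxx => /(_ isT).
    - by rewrite leqNgt li.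
    - by move=> _ ei; move: M0; rewrite /M -ei i0.
  have iB : (i < B)%N by rewrite (leq_trans li) // (sB (Ordinal (l4 : l < 5)%N)).
  have [c0 [c00 lc0]] := degP (l, i) nz.
  have Qli : Q (Ordinal (l4 : l < 5)%N, Ordinal iB) by rewrite /Q /= i1 nz.
  have le : M%:Z * deg (l, i) <= (lev l)%:Z + kappa *+ i.
    have := xmax _ Qli; rewrite -/kappa -/M /num /= /lev PoszM.
    rewrite -[kappa *+ i]mulr_natr natz mulrBl [M%:Z * deg _]mulrC.
    by rewrite lerBlDl [M%:Z * (a + _)%N%:Z]mulrC.
  exists (if (lev l)%:Z + kappa *+ i == M%:Z * deg (l, i) then c0 else 0).
  split; first exact: leadq_le.
  - by rewrite leqNgt li.
  - by move=> i0; rewrite i0 in i1.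
  move=> el ei; rewrite ifT //; apply/eqP.
  rewrite -[kappa *+ i]mulr_natr natz /lev PoszM /kappa /num -el -ei /M -ei.
  by rewrite mulrBl -[deg _ * _]mulrC [(a + b * l)%N%:Z * _]mulrC addrCA subrr addr0.
have leP l : (l <= 4)%N -> exists P : {poly L},
    [/\ leadp M kappa (Xi (gen l)) (lev l) P, P`_0 = u * Y ^+ l &
        (l = x.1 :> nat) -> ~~ is_const P].
  move=> l4; have /choice[d hd] := fun i => coefP l i l4.
  have dE i : (\poly_(i < size (Xi (gen l))) d i)`_i = d i.
    by rewrite coef_poly; case: ltnP => // h; have [_ -> //] := hd i.
  exists (\poly_(i < size (Xi (gen l))) d i); split.
  - by move=> i; rewrite dE; have [] := hd i.
  - by rewrite dE; have [_ _ ->] := hd 0%N.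
  move=> el; apply/negP; rewrite /is_const => sz.
  have [_ _ _ /(_ el erefl)] := hd x.2.
  by rewrite -dE nth_default ?eqxx // (leq_trans sz).
have [P hP] : exists P : nat -> {poly L}, forall l, (l <= 4)%N ->
    [/\ leadp M kappa (Xi (gen l)) (lev l) (P l), (P l)`_0 = u * Y ^+ l &
        (l = x.1 :> nat) -> ~~ is_const (P l)].
  have /choice[P hP] : forall l, exists P : {poly L}, (l <= 4)%N ->
      [/\ leadp M kappa (Xi (gen l)) (lev l) P, P`_0 = u * Y ^+ l &
        (l = x.1 :> nat) -> ~~ is_const P].
    move=> l; case: (leqP l 4) => [/leP[P hP]|]; first by exists P.
    by exists 0.
  by exists P.
have lP l (l4 : (l <= 4)%N) : leadp M kappa (Xi (gen l)) (lev l) (P l).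
  by have [] := hP l l4.
have P00 : P 0%N != 0.
  apply: contraNneq u_neq0 => z; have [_ + _] := hP 0%N isT.
  by rewrite z coef0 expr0 mulr1 => <-.
have lev2 m1 m2 : (a + b * m1 + (a + b * m2) = a + a + b * (m1 + m2))%N.
  by rewrite mulnDr addnACA.
have levD l1 l2 l3 l4 : (l1 + l2 = l3 + l4)%N ->
    (lev l1)%:Z + (lev l2)%:Z = (lev l3)%:Z + (lev l4)%:Z.
  by move=> e; rewrite -!PoszD /lev -!mulnDr !lev2 e.
(* Since 0 < a, the [low] terms of a product of two generators lie strictly below its level and
   disappear. The leading parts P_l thus satisfy the homogeneous equations of the quartic cone. *)
have low_lt l l1 l2 : (l <= l1 + l2)%N -> (lev l)%:Z < (lev l1)%:Z + (lev l2)%:Z.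
  move=> le; rewrite -PoszD /lev -mulnDr ltz_nat ltn_pmul2l // lev2.
  by rewrite -addnA -[X in (X < _)%N]add0n -addSn leq_add // leq_add2l leq_mul2l le orbT.
have e2 : P 0%N * P 2%N = P 1%N ^+ 2.
  have h1 := leadpM M0 (lP 0%N isT) (lP 2%N isT).
  have h2 := leadpM M0 (lP 1%N isT) (lP 1%N isT).
  have /(congr1 Xi) := @gen_mul k 1 1 isT isT.
  rewrite /top /low /= addr0 !rmorphM /= => ee.
  rewrite -ee (levD 0%N 2%N 1%N 1%N) // in h1.
  by rewrite expr2; exact: leadp_uniq h1 h2.
have e3 : P 0%N * P 3%N = P 1%N * P 2%N.
  have h1 := leadpM M0 (lP 0%N isT) (lP 3%N isT).
  have h2 := leadpM M0 (lP 1%N isT) (lP 2%N isT).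
  have h3 := leadp_low M0 (lP 1%N isT) (low_lt 1%N 1%N 2%N isT).
  have /(congr1 Xi) := @gen_mul k 1 2 isT isT.
  rewrite /top /low /= !rmorphD !rmorphM /= => ee.
  rewrite (levD 0%N 3%N 1%N 2%N) // in h1.
  have := leadpD h1 h3; rewrite -ee addr0 => h4.
  exact: leadp_uniq h4 h2.
have e4 : P 0%N * P 4%N = P 2%N ^+ 2.
  have h1 := leadpM M0 (lP 0%N isT) (lP 4%N isT).
  have h2 := leadpM M0 (lP 2%N isT) (lP 2%N isT).
  have h3 := leadp_low M0 (lP 2%N isT) (low_lt 2%N 2%N 2%N isT).
  have lt0 : 0 < (lev 2)%:Z + (lev 2)%:Z.
    by apply: le_lt_trans (low_lt 2%N 2%N 2%N isT); lia.
  have h5 := leadp_low M0 (leadp1 E kappa M0) lt0.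
  have /(congr1 Xi) := @gen_mul k 2 2 isT isT.
  rewrite /top /low /= mulr_natl mulr2n !rmorphD !rmorphM !rmorphN !rmorph1 /= => ee.
  rewrite (levD 0%N 4%N 2%N 2%N) // in h1.
  have := leadpD h2 h5; rewrite ee -addrA subrK addr0 => h4.
  have := leadpD h1 (leadpD h3 h3); rewrite !addr0 => h6.
  by rewrite expr2; exact: leadp_uniq h6 h4.
have [G [al [be [co al0 PE]]]] := veronese_parametrization P00 e2 e3 e4.
exists G, al, be; split=> //.
- apply/negP => /and3P[Gc alc bec].
  have l4 : (x.1 <= 4)%N by rewrite -ltnS.
  have [_ _ /(_ erefl)] := hP x.1 l4; apply/negP; rewrite negbK PE //.
  by apply: is_constME; [apply: is_constME|]; rewrite ?is_constXE.
- have [_ + _] := hP 0%N isT; rewrite PE // !expr0 !mulr1 subn0 => <-.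
  by rewrite -!horner_coef0 hornerM horner_exp.
- have [_ + _] := hP 1%N isT; have [_ + _] := hP 0%N isT.
  rewrite !PE // !expr0 !expr1 !mulr1 -!horner_coef0 !(horner_exp, hornerM).
  move=> <- e; have nz : G.[0] * al.[0] ^+ 3 != 0.
    apply: contraNneq u_neq0 => z; have [_ + _] := hP 0%N isT.
    rewrite PE // !expr0 !mulr1 -horner_coef0 hornerM horner_exp => <-.
    by rewrite exprSr mulrA z mul0r.
  by apply: (mulfI nz); rewrite e exprSr; ring.
split=> //.
(* The leading part of [Xi F] is computed twice: from the expansion of F and the P_l, and from
   [Xi F = (io F)%:P], which is free of T. *)
pose etaP : {rmorphism k -> {poly L}} := polyC \o j.
have Ld_c c0 : leadp M kappa (Xi c0%:A) 0 (etaP c0).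
  by rewrite Xic; exact: leadp_const.
have Ld_g l : (l <= 4)%N ->
    leadp M kappa (Xi (gen l)) (M * a + M * b * l)%N (P l).
  by move=> /lP; rewrite /lev mulnDr mulnA.
have leW' i l : (i <= n)%N -> (l <= 4 * i)%N -> (c i)`_l != 0 ->
    (M * a * i + M * b * l <= M * W)%N.
  by move=> h1 h2 h3; rewrite -!mulnA -mulnDr leq_mul2l leW ?orbT.
have h1 := Ld_comb (@leadp0 _ E M kappa) (leadpD (kappa := kappa)) (leadpM M0)
  (leadp1 E kappa M0) (leadp_low M0) Ld_c Ld_g leW'.
have h2 : leadp M kappa (io F)%:P (M * W)%N (topsum j a b n c W u Y)%:P.
  apply: leadpC; have := leadq_le M0 lF (lexx (M%:Z * W%:Z)).
  by rewrite -PoszM eqxx.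
rewrite -Fc XiF in h1; rewrite -(leadp_uniq h1 h2) /comb_top.
apply: eq_bigr => i _; apply: eq_bigr => l _.
rewrite (mon_top_veronese PE); last by rewrite -ltnS.
by rewrite -!mulnA -mulnDr eqn_pmul2l.
Qed.

End Degeneration.

(** * Leading forms of the image of u *)

(** As a and b are coprime, the lattice points with a i + b l = a n and i <= n are the (n - b t, a
    t). *)
Lemma line_sum (V : zmodType) (f : nat -> nat -> V) a b n :
  (0 < a)%N -> (0 < b)%N -> coprime a b ->
  \sum_(i < n.+1) \sum_(l < (4 * i).+1)
    (if (a * i + b * l == a * n)%N then f i l else 0) =
  \sum_(t < n.+1)
    (if (b * t <= n)%N && (a * t <= 4 * (n - b * t))%N
     then f (n - b * t)%N (a * t)%N else 0).
Proof.
move=> a0 b0 co.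
transitivity (\sum_(i < n.+1) \sum_(l < (4 * i).+1) \sum_(t < n.+1)
   (if (i + b * t == n)%N && (nat_of_ord l == (a * t)%N) then f i l else 0)).
  apply: eq_bigr => i _; apply: eq_bigr => l _; case: eqP => [e|ne]; last first.
    rewrite big1 // => t _; case: ifP => // /andP[/eqP e1 /eqP e2].
    have e3 : (a * n = a * (i + b * t))%N by rewrite e1.
    by case: ne; rewrite e2 e3 mulnDr mulnCA.
  have in_ : (i <= n)%N by rewrite -ltnS.
  have e' : (b * l = a * (n - i))%N by rewrite mulnBr; lia.
  have /dvdnP[t et] : (a %| l)%N.
    by rewrite -(Gauss_dvdr _ co) e' dvdn_mulr.
  have e'' : (b * t = n - i)%N.
    by apply/eqP; rewrite -(eqn_pmul2l a0) -e' et mulnCA [(a * t)%N]mulnC.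
  have tn : (t < n.+1)%N.
    by rewrite ltnS (leq_trans _ (leq_subr i n)) // -e'' leq_pmull.
  rewrite (bigD1 (Ordinal tn)) //= big1 ?addr0 => [|t' ne].
    by rewrite e'' subnKC // eqxx et mulnC eqxx.
  case: ifP => // /andP[_ /eqP e2]; case/eqP: ne; apply: val_inj => /=.
  by apply/eqP; rewrite -(eqn_pmul2l a0) -e2 et mulnC.
rewrite (eq_bigr (fun i : 'I_n.+1 => \sum_(t < n.+1) \sum_(l < (4 * i).+1)
   (if (i + b * t == n)%N && (nat_of_ord l == (a * t)%N) then f i l else 0))); last first.
  by move=> i _; rewrite exchange_big.
rewrite exchange_big; apply: eq_bigr => t _ /=.
have [btn|nbt] := leqP (b * t) n; last first.
  rewrite big1 // => i _; rewrite big1 // => l _.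
  by rewrite gtn_eqF // (leq_trans nbt) // leq_addl.
have it : (n - b * t < n.+1)%N by rewrite ltnS leq_subr.
rewrite (bigD1 (Ordinal it)) //= [X in _ + X]big1 ?addr0 => [|i ne]; last first.
  rewrite big1 // => l _; case: ifP => // /andP[/eqP e _].
  case/eqP: ne; apply: val_inj => /=; have -> : (n - b * t = i + b * t - b * t)%N by rewrite e.
  by rewrite addnK.
rewrite subnK // eqxx /=; have [lt|nlt] := leqP (a * t) (4 * (n - b * t)).
  rewrite (bigD1 (Ordinal (lt : a * t < (4 * (n - b * t)).+1)%N)) //= eqxx.
  rewrite big1 ?addr0 // => l ne; case: eqP => // e.
  by case/eqP: ne; apply: val_inj.
rewrite big1 // => l _; case: eqP => // e; move: nlt; rewrite -e.
by have := ltn_ord l; rewrite ltnS => le /(leq_ltn_trans le); rewrite ltnn.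
Qed.

Section TopForms.
Variables (k L : fieldType) (E : degreeField L) (j : {rmorphism k -> L}).
Variables (u Y : L).
Hypothesis independent : forall N (c : nat -> {poly k}),
  \sum_(i < N) u ^+ i * (map_poly j (c i)).[Y] = 0 ->
  forall i, (i < N)%N -> c i = 0.
Hypothesis algebraic_const : forall (x : L) (p : {poly k}),
  p != 0 -> (map_poly j p).[x] = 0 -> exists a, x = j a.
Local Notation A := (OS0 k).
Local Notation lead := (@dlead L E).
Local Notation gen := (gen k).
Local Notation u_neq0 := (u_neq0 independent).
Local Notation Y_neq0 := (Y_neq0 independent).
Local Notation topsum_neq0 := (topsum_neq0 independent).
Local Notation wpt := (wpt E independent).

Lemma transcendental_Y (p : {poly k}) : (map_poly j p).[Y] = 0 -> p = 0.
Proof.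
move=> p0; apply: (@independent 1 (fun=> p) _ 0%N) => //.
by rewrite big_ord1 p0 mulr0.
Qed.

(** A ratio algebraic over k would lie in k, so Y would be a constant times u^b, against
    independence; the polynomials d i express this relation. *)
Lemma transcendental_ratio (b : nat) (p : {poly k}) : (0 < b)%N ->
  (map_poly j p).[Y / u ^+ b] = 0 -> p = 0.
Proof.
move=> b0 p0; apply: contrapT => /eqP pn0.
have [x ex] := algebraic_const pn0 p0.
have ub0 : u ^+ b != 0 by rewrite expf_neq0 // u_neq0.
have YE : Y = j x * u ^+ b by rewrite -ex divfK.
pose d (i : nat) : {poly k} := 'X *+ (i == 0%N) - x%:P *+ (i == b).
have dE i : (map_poly j (d i)).[Y] = Y *+ (i == 0%N) - j x *+ (i == b).
  by rewrite rmorphB !rmorphMn /= map_polyX map_polyC hornerD hornerN !hornerMn hornerX hornerC.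
have := @independent b.+1 d _ 0%N isT.
rewrite /d eqxx [_ == b]eq_sym eqn0Ngt b0 mulr0n subr0 mulr1n => z.
suff /z/eqP : \sum_(i < b.+1) u ^+ i * (map_poly j (d i)).[Y] = 0.
  by rewrite polyX_eq0.
under eq_bigr => i _ do rewrite dE mulrBr.
rewrite big_split /= sumrN big_ord_recl big1 => [|i _]; last by rewrite mulr0.
rewrite [X in _ - X]big_ord_recr /= big1 => [|i _]; last first.
  by rewrite ltn_eqF // mulr0.
by rewrite !eqxx expr0 mul1r addr0 add0r !mulr1n mulrC -YE subrr.
Qed.

(** The leading form of f for the weights (1, 0) is u^n p(Y). *)
Definition topform (f : A) n p : Prop :=
  exists c, [/\ trimmed n c, f = comb n c & c n = p].

Lemma topform_exists f : f != 0 -> exists n p, topform f n p.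
Proof.
by move=> /comb_exists[n [c [tc e]]]; exists n, (c n), c.
Qed.

Lemma topform_neq0 f n p : topform f n p -> p != 0.
Proof. by case=> c [[_ c0] _ <-]. Qed.

Lemma topform_size f n p : topform f n p -> (size p <= (4 * n).+1)%N.
Proof. by case=> c [[sc _] _ <-]. Qed.

Lemma topsum10 n (c : nat -> {poly k}) U V : (size (c n) <= (4 * n).+1)%N ->
  topsum j 1 0 n c n U V = U ^+ n * (map_poly j (c n)).[V].
Proof.
move=> sc; rewrite /topsum big_ord_recr /= big1 ?add0r => [|i _]; last first.
  rewrite big1 // => l _; rewrite mul1n addn0 ifF ?rmorph0 ?mul0r //.
  by rewrite ltn_eqF.
rewrite (@horner_coef_wide _ (4 * n).+1); last by rewrite (leq_trans (size_poly _ _)).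
rewrite mulr_sumr; apply: eq_bigr => l _.
by rewrite mul1n addn0 eqxx coef_map mulrCA.
Qed.

Lemma lead_topform (h : {rmorphism A -> E}) U V U1 V1 f n p :
  (forall c : k, h c%:A = scal E j c) -> h (gen 0) = U -> h (gen 1) = U * V ->
  lead U 1 U1 -> lead V 0 V1 -> U1 != 0 -> topform f n p ->
  lead (h f) n (U1 ^+ n * (map_poly j p).[V1]).
Proof.
move=> hc h0 h1 lU lV U10 [c [[sc _] -> <-]].
rewrite -topsum10 //; apply: (lead_comb hc h0 h1 _ lU lV U10) => //.
by move=> i l le _ _; rewrite mul1n addn0.
Qed.

Lemma topform_lead f n p : topform f n p ->
  lead (wpt 1 0 f) n (u ^+ n * (map_poly j p).[Y]).
Proof.
have [U [V [hc h0 h1 lU lV]]] := wptP E independent 1 0.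
exact: lead_topform hc h0 h1 lU lV u_neq0.
Qed.

Lemma topform_of_lead f (n : nat) p : p != 0 ->
  lead (wpt 1 0 f) n (u ^+ n * (map_poly j p).[Y]) -> topform f n p.
Proof.
move=> p0 lf.
have nz m (q : {poly k}) : q != 0 -> u ^+ m * (map_poly j q).[Y] != 0.
  move=> q0; rewrite mulf_neq0 ?expf_neq0 ?u_neq0 //.
  by apply: contraNneq q0 => /transcendental_Y ->.
have f0 : f != 0.
  apply: contraNneq (nz n p p0) => z; rewrite z rmorph0 in lf.
  by rewrite (dlead_uniq lf (dlead0 _ _)).
have [m [q tf]] := topform_exists f0; have lf' := topform_lead tf.
have q0 := topform_neq0 tf.
have e : m = n.
  have [lt|lt|//] := ltngtP m n.
    have /eqP := dlead_uniq (dlead_low lf' (lt : m%:Z < n%:Z)) lf.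
    by rewrite eq_sym (negPf (nz n p p0)).
  have /eqP := dlead_uniq (dlead_low lf (lt : n%:Z < m%:Z)) lf'.
  by rewrite eq_sym (negPf (nz m q q0)).
rewrite e in tf lf'; have /mulfI := dlead_uniq lf lf'.
rewrite expf_neq0 ?u_neq0 // => /(_ isT)/eqP; rewrite -subr_eq0.
rewrite -hornerN -hornerD -rmorphB => /eqP/transcendental_Y/eqP.
by rewrite subr_eq0 => /eqP ->.
Qed.

Lemma topform_uniq f n p n' p' : topform f n p -> topform f n' p' -> n = n' /\ p = p'.
Proof.
move=> t1 t2; have l1 := topform_lead t1; have l2 := topform_lead t2.
have nz m (q : {poly k}) : q != 0 -> u ^+ m * (map_poly j q).[Y] != 0.
  move=> q0; rewrite mulf_neq0 ?expf_neq0 ?u_neq0 //.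
  by apply: contraNneq q0 => /transcendental_Y ->.
have [p0 p0'] := (topform_neq0 t1, topform_neq0 t2).
have e : n = n'.
  have [lt|lt|//] := ltngtP n n'.
    have /eqP := dlead_uniq (dlead_low l1 (lt : n%:Z < n'%:Z)) l2.
    by rewrite eq_sym (negPf (nz _ _ p0')).
  have /eqP := dlead_uniq (dlead_low l2 (lt : n'%:Z < n%:Z)) l1.
  by rewrite eq_sym (negPf (nz _ _ p0)).
split=> //; subst n'; have /mulfI := dlead_uniq l1 l2.
rewrite expf_neq0 ?u_neq0 // => /(_ isT)/eqP; rewrite -subr_eq0.
by rewrite -hornerN -hornerD -rmorphB => /eqP/transcendental_Y/eqP; rewrite subr_eq0 => /eqP.
Qed.

Lemma comorph_gen0_neq0 (phi : autSpec A) : comorph phi (gen 0) != 0.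
Proof.
rewrite -(rmorph0 (comorph phi)) (inj_eq (can_inj (@comorphK _ _ phi))).
apply/eqP => z; have [U [V [_ h0 _ lU _]]] := wptP E independent 1 0.
move: lU; rewrite -h0 z rmorph0 => lU; have /eqP := dlead_uniq lU (dlead0 _ _).
by rewrite (negPf u_neq0).
Qed.

(** For the weights (1, 0) the curve of [degeneration] makes G^n times a binary form of degree 4 n
    constant. As n is positive G is constant, so the pair (al, be) is not, and [constant_form]
    applies. *)
Lemma topform_comorph phi n p : (0 < n)%N -> topform (comorph phi (gen 0)) n p ->
  (exists c0 : k, p = c0%:P) \/ (exists r c0 : k, p = c0 *: ('X - r%:P) ^+ (4 * n)).
Proof.
move=> n0 [c [tc Fc <-]]; have [sc cn] := tc.
have := @degeneration k L E j u Y independent phi _ 1 0 n n c erefl isT tc Fc.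
case.
- by move=> i l le _ _; rewrite mul1n addn0.
- exists n, (size (c n)).-1; split=> //; last by rewrite mul1n addn0.
    by rewrite -ltnS (leq_trans _ (sc n)) // prednK // size_poly_gt0.
  by rewrite -[_`__]/(lead_coef _) lead_coef_eq0.
move=> G [al [be [al0 nc uE beE [SE T0]]]].
have {}SE : G ^+ n * homogenize j (c n) (4 * n) al be = (topsum j 1 0 n c n u Y)%:P.
  rewrite -SE big_ord_recr /= big1 ?add0r => [|i _]; last first.
    rewrite big1 // => l _; rewrite mul1n addn0 ifF ?rmorph0 ?mul0r //.
    by rewrite ltn_eqF.
  rewrite /homogenize mulr_sumr; apply: eq_bigr => l _.
  rewrite mul1n addn0 eqxx -!mulrA; move: (al ^+ _) (be ^+ _) (G ^+ n) => x1 x2 x3.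
  by rewrite mulrCA.
have S0 : G ^+ n * homogenize j (c n) (4 * n) al be != 0 by rewrite SE polyC_eq0.
have [Gn Hc] : is_const (G ^+ n) /\ is_const (homogenize j (c n) (4 * n) al be).
  by apply: is_constM => //; rewrite SE /is_const size_polyC T0.
have Gc := is_constX n0 Gn; rewrite Gc /= in nc.
apply: (constant_form algebraic_const _ (sc n) al0 nc _ Hc); first by rewrite muln_gt0.
by apply: contraNneq S0 => ->; rewrite mulr0.
Qed.

(** The edge polynomial: for coprime positive a, b the part of weight a n of [comb n c] is u^n times
    this polynomial at Y^a / u^b. *)
Definition line_poly a b n (c : nat -> {poly k}) : {poly k} :=
  \poly_(t < n.+1) (if (b * t <= n)%N && (a * t <= 4 * (n - b * t))%N
                    then (c (n - b * t)%N)`_(a * t) else 0).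

Lemma coef_line_poly a b n c t : (0 < b)%N -> (line_poly a b n c)`_t =
  if (b * t <= n)%N && (a * t <= 4 * (n - b * t))%N then (c (n - b * t)%N)`_(a * t) else 0.
Proof.
move=> b0; rewrite coef_poly; case: ltnP => // nt; rewrite ifF //.
by rewrite leqNgt (leq_trans nt) // leq_pmull.
Qed.

Lemma line_poly_sum (M : comNzRingType) (eta : {rmorphism k -> M}) (f : nat -> nat -> M)
    a b n (c : nat -> {poly k}) : (0 < a)%N -> (0 < b)%N -> coprime a b ->
  \sum_(i < n.+1) \sum_(l < (4 * i).+1)
    eta (if (a * i + b * l == a * n)%N then (c i)`_l else 0) * f i l =
  \sum_(t < size (line_poly a b n c)) eta (line_poly a b n c)`_t * f (n - b * t)%N (a * t)%N.
Proof.
move=> a0 b0 co.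
rewrite (eq_bigr (fun i : 'I_n.+1 => \sum_(l < (4 * i).+1)
    if (a * i + b * l == a * n)%N then eta (c i)`_l * f i l else 0)); last first.
  by move=> i _; apply: eq_bigr => l _; case: eqP; rewrite ?rmorph0 ?mul0r.
rewrite (line_sum (fun i l => eta (c i)`_l * f i l)) //.
rewrite (big_ord_widen n.+1 (fun t => eta (line_poly a b n c)`_t * f (n - b * t)%N (a * t)%N));
  last exact: size_poly.
rewrite [RHS]big_mkcond; apply: eq_bigr => t _; case: ltnP => [lt|le].
  by rewrite coef_line_poly //; case: ifP; rewrite ?rmorph0 ?mul0r.
move: le => /(nth_default 0); rewrite coef_line_poly //.
by case: ifP => // _ ->; rewrite rmorph0 mul0r.
Qed.

Lemma topsum_line b n (c : nat -> {poly k}) U V : (0 < b)%N -> U != 0 ->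
  topsum j 1 b n c n U V = U ^+ n * (map_poly j (line_poly 1 b n c)).[V / U ^+ b].
Proof.
move=> b0 U0; have := @line_poly_sum L j (fun i l => U ^+ i * V ^+ l) 1 b n c isT b0.
rewrite coprime1n mul1n => /(_ isT); rewrite /topsum => ->.
rewrite (@horner_coef_wide _ (size (line_poly 1 b n c))); last first.
  by rewrite size_poly.
rewrite mulr_sumr; apply: eq_bigr => t _; rewrite coef_map /=.
have [btn|nbt] := leqP (b * t) n; last first.
  by rewrite coef_line_poly // leqNgt nbt rmorph0 !mul0r mulr0.
rewrite [RHS]mulrCA; congr (_ * _); rewrite mul1n expr_div_n -exprM.
have -> : U ^+ n = U ^+ (n - b * t) * U ^+ (b * t) by rewrite -exprD subnK.
by rewrite -mulrA [V ^+ t / _]mulrC mulVKf // expf_neq0.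
Qed.

Variables (D : L -> L).
Hypotheses (derD : {morph D : x y / x + y})
           (derM : forall x y, D (x * y) = D x * y + x * D y)
           (der_j : forall a, D (j a) = 0) (der_u : D u = 1) (der_Y : D Y = 0).

(** As c n is a nonzero constant, (n, 0) is the only support point with i = n, so the ratios l / (n
    - i) with l > 0 make sense. Their maximum, a / b in lowest terms, is the slope of an edge
    through (n, 0) with a second point, so its polynomial is not constant. *)
Lemma line_poly_root (phi : autSpec A) n c p : (0 < n)%N ->
  comorph phi (gen 0) = comb n c -> trimmed n c -> c n = p%:P ->
  (exists i l, [/\ (i <= n)%N, (0 < l)%N & (c i)`_l != 0]) ->
  exists b r, [/\ (0 < b)%N, root (line_poly 1 b n c) r &
    forall i l, (i <= n)%N -> (c i)`_l != 0 -> (i + b * l <= n)%N].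
Proof.
move=> n0 Fc tc cE [i1 [l1 [i1n l10 c10]]]; have [sc cn] := tc.
pose B := (4 * n).+1.
pose Q (x : 'I_n.+1 * 'I_B) := (0 < x.2)%N && ((c x.1)`_x.2 != 0).
have c_lt i l : (c i)`_l != 0 -> (l <= 4 * i)%N.
  by apply: contraNT; rewrite -ltnNge => lt; rewrite nth_default // (leq_trans (sc i)).
have i_lt i l : (i <= n)%N -> (0 < l)%N -> (c i)`_l != 0 -> (i < n)%N.
  rewrite leq_eqVlt => /orP[/eqP ->|//]; rewrite cE coefC.
  by case: l => // l _; rewrite eqxx.
have l_lt i l : (i <= n)%N -> (c i)`_l != 0 -> (l < B)%N.
  by move=> le /c_lt h; rewrite ltnS (leq_trans h) // leq_mul2l le orbT.
pose x1 : 'I_n.+1 * 'I_B := (Ordinal (i1n : i1 < n.+1)%N, Ordinal (l_lt _ _ i1n c10)).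
have Q1 : Q x1 by rewrite /Q /= l10.
have [|[i0 l0] /andP[/= l00 c00] maxP] :=
  @max_slope _ Q (fun x => (x.2 : nat)%:Z) (fun x => n - x.1)%N x1 Q1.
  by move=> x /andP[h1 h2]; rewrite subn_gt0 (i_lt _ _ _ h1 h2) // -ltnS.
have i0n : (i0 <= n)%N by rewrite -ltnS.
have d0 : (0 < n - i0)%N by rewrite subn_gt0 (i_lt _ _ _ l00 c00).
pose g := gcdn l0 (n - i0).
have g0 : (0 < g)%N by rewrite gcdn_gt0 l00.
have [[a aE] [b bE]] : (exists a, l0 = a * g :> nat)%N /\ (exists b, n - i0 = b * g)%N.
  by split; apply/dvdnP; rewrite ?dvdn_gcdl ?dvdn_gcdr.
have a0 : (0 < a)%N by move: l00; rewrite aE muln_gt0 => /andP[].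
have b0 : (0 < b)%N by move: d0; rewrite bE muln_gt0 => /andP[].
have co : coprime a b.
  have : (gcdn l0 (n - i0) = g)%N by [].
  rewrite aE bE -muln_gcdl => e; rewrite /coprime -(eqn_pmul2r g0) mul1n.
  by apply/eqP.
have leW i l : (i <= n)%N -> (c i)`_l != 0 -> (a * i + b * l <= a * n)%N.
  move=> le nz; have [->|lp] := posnP l; first by rewrite muln0 addn0 leq_mul2l le orbT.
  have := maxP (Ordinal (le : i < n.+1)%N, Ordinal (l_lt _ _ le nz)).
  rewrite /Q /= lp nz => /(_ isT); rewrite -!PoszM lez_nat aE bE.
  rewrite mulnA [X in (_ <= X)%N]mulnAC leq_pmul2r // mulnC => h.
  by rewrite -(subnKC le) mulnDr leq_add2l.
pose Gp := line_poly a b n c.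
have Gp0 : Gp`_0 != 0.
  rewrite coef_line_poly // !muln0 !leq0n /= subn0.
  by move: cn; rewrite cE polyC_eq0 coefC.
have Gpg : Gp`_g != 0.
  rewrite coef_line_poly // -aE -bE leq_subr subKn //= c_lt //.
have sG : (1 < size Gp)%N.
  by rewrite (@leq_trans g.+1) // ltnNge; apply: contraNN Gpg => /(nth_default 0) ->.
have lcG : Gp`_(size Gp).-1 != 0.
  by rewrite -[_`__]/(lead_coef _) lead_coef_eq0 -size_poly_gt0 ltnW.
have := lcG; rewrite coef_line_poly //; case: ifP; last by rewrite eqxx.
move=> /andP[bs as4] _.
have := @degeneration k L E j u Y independent phi _ a b n (a * n) c erefl a0 tc Fc.
case.
- by move=> i l le _; exact: leW.
- exists n, 0%N; split=> //; last by rewrite muln0 addn0.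
  by move: cn; rewrite cE polyC_eq0 coefC.
move=> G [al [be [al0 nc uE beE [SE T0]]]].
have SE' := @line_poly_sum _ (polyC \o j) (fun i l => G ^+ i * al ^+ (4 * i - l) * be ^+ l)
  a b n c a0 b0 co.
have {}SE : \sum_(t < size Gp) (j Gp`_t)%:P * G ^+ (n - b * t)
     * al ^+ (4 * (n - b * t) - a * t) * be ^+ (a * t) = (topsum j a b n c (a * n) u Y)%:P.
  rewrite -SE; transitivity (\sum_(t < size Gp) (j Gp`_t)%:P * (G ^+ (n - b * t) *
     al ^+ (4 * (n - b * t) - a * t) * be ^+ (a * t))).
    by apply: eq_bigr => t _; rewrite !mulrA.
  exact: esym SE'.
have [||r [r0 rt Gc /andP[nal nbe] [h0 hc]]] := constant_quasi_form algebraic_const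
  a0 b0 sG Gp0 bs as4 al0 nc.
- by rewrite SE polyC_eq0.
- by rewrite SE /is_const size_polyC T0.
(* For a > 1 the constant polynomial G is replaced by its value, which enters u = G_0 al_0^4, and
   [no_cuspidal_curve] is applied with D = d/du. *)
have a1 : a = 1%N.
  have [lt|lt|//] := ltngtP a 1; first by move: lt; rewrite ltnS leqNgt a0.
  move/size1_polyC: Gc => Gc; move: hc h0 => /size1_polyC hc; rewrite hc polyC_eq0 => h0.
  have g00 : G`_0 != 0.
    by apply: contraNneq u_neq0 => z; rewrite uE z mul0r.
  exfalso; apply: (@no_cuspidal_curve L D derD derM a b al be G`_0 (j r) u Y _ co lt b0
    nal nbe g00 _ u_neq0 Y_neq0 h0 (der_j r) der_u der_Y uE beE).
    by rewrite fmorph_eq0.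
  rewrite -hc {2}Gc -polyC_exp -scalerA; congr (_ - _ *: _).
  by rewrite mul_polyC.
rewrite /Gp a1 in rt.
exists b, r; split=> // i l le nz; have := leW i l le nz.
by rewrite a1 !mul1n.
Qed.

(** In the weights (1, b), Y |-> Y + r u^b changes the edge form u^n g(Y / u^b) into u^n g(Y / u^b +
    r). Were n' at least n, both would equal n and the new top form could only be the constant g(r),
    which is 0. *)
Lemma fibre_lowers (f : A) n c b r (psi : autSpec A) : (0 < b)%N ->
  f = comb n c -> (forall i, (size (c i) <= (4 * i).+1)%N) ->
  root (line_poly 1 b n c) r ->
  (forall i l, (i <= n)%N -> (c i)`_l != 0 -> (i + b * l <= n)%N) ->
  comorph psi (gen 0) = gen 0 ->
  comorph psi (gen 1) = gen 1 + r *: gen 0 ^+ b.+1 ->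
  f != 0 -> forall n' p, topform (comorph psi f) n' p -> (n' < n)%N.
Proof.
move=> b0 fE sc /rootP rt leW p0 p1 f0 n' p [c' [tc' fE' _]].
have [sc' cn'] := tc'; rewrite ltnNge; apply/negP => nn'.
have [U [V [hc h0 h1 lU lV]]] := wptP E independent 1 b.
have U0 : U != 0.
  apply: contraNneq u_neq0 => z; rewrite z in lU.
  by rewrite (dlead_uniq lU (dlead0 _ _)).
pose h : {rmorphism A -> E} := wpt 1 b \o comorph psi.
have hE f' : h f' = wpt 1 b (comorph psi f') by [].
have hc' (c0 : k) : h c0%:A = scal E j c0 by rewrite hE comorph_const hc.
have h0' : h (gen 0) = U by rewrite hE p0.
have h1' : h (gen 1) = U * (V + scal E j r * U ^+ b).
  by rewrite hE p1 rmorphD /= -mulr_algl rmorphM rmorphXn /= hc h0 h1 exprS mulrDr mulrCA.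
have lV' : lead (V + scal E j r * U ^+ b) b (Y + j r * u ^+ b).
  apply: dleadD => //; have := dleadM (dlead_const E (j r)) (leadX b lU).
  by rewrite add0r -[_ *+ b]mulr_natr mul1r natz.
have l1 : lead (h f) n (u ^+ n * (map_poly j (line_poly 1 b n c)).[(Y + j r * u ^+ b) / u ^+ b]).
  rewrite -topsum_line ?u_neq0 // fE.
  apply: (lead_comb hc' h0' h1' _ lU lV' u_neq0) => // i l le _ nz.
  by rewrite mul1n leW.
have [W' maxW [i [l [hi hl hnz eW]]]] := comb_max 1 b tc'.
have l2 : lead (h f) W' (topsum j 1 b n' c' W' u Y).
  by rewrite hE fE'; apply: lead_wpt.
have T0 := topsum_neq0 hi hl hnz eW.
have n'W : (n' <= W')%N.
  have := maxW n' (size (c' n')).-1 (leqnn _).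
  rewrite -[(c' n')`_ _]/(lead_coef _) lead_coef_eq0 cn' mul1n => le.
  rewrite (leq_trans _ (le _ isT)) ?leq_addr //.
  by rewrite -ltnS (leq_trans _ (sc' n')) // prednK // size_poly_gt0.
have W'n : (W' <= n)%N.
  rewrite leqNgt; apply: contraNN T0 => lt; apply/eqP.
  exact: dlead_uniq l2 (dlead_low l1 (lt : n%:Z < W'%:Z)).
have eW' : W' = n by apply/eqP; rewrite eqn_leq W'n (leq_trans nn').
have en' : n' = n by apply/eqP; rewrite eqn_leq nn' -eW' n'W.
rewrite eW' en' in l2 maxW T0 n'W W'n cn'.
have un0 := u_neq0; have ub0 : u ^+ b != 0 by rewrite expf_neq0.
have := dlead_uniq l1 l2; rewrite topsum_line // => /mulfI.
rewrite expf_neq0 // mulrDl mulfK // => /(_ isT) e.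
have /transcendental_ratio eG : (map_poly j (line_poly 1 b n c \Po ('X + r%:P)
   - line_poly 1 b n c')).[Y / u ^+ b] = 0.
  rewrite rmorphB hornerD hornerN /= map_comp_poly horner_comp rmorphD /= map_polyX map_polyC.
  by rewrite hornerD hornerX hornerC e subrr.
have {}eG := eG b0.
have z0 : (c' n)`_0 = 0.
  have := congr1 (fun q : {poly k} => q.[0]) eG.
  rewrite hornerD hornerN horner_comp hornerD hornerX !hornerC add0r rt add0r.
  by rewrite horner_coef0 coef_line_poly // !muln0 !leq0n /= subn0 => /eqP; rewrite oppr_eq0 => /eqP.
case/negP: cn'; apply/eqP/polyP => t; rewrite coef0.
case: t => [|t] //; apply/eqP; apply: contrapT => /negP nz.
have t4 : (t.+1 <= 4 * n)%N.
  by rewrite leqNgt; apply: contraNN nz => lt; rewrite nth_default // (leq_trans (sc' n)).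
have := maxW n t.+1 (leqnn _) t4 nz; rewrite mul1n -[X in (_ <= X)%N]addn0 leq_add2l leqn0 muln_eq0 /=.
by rewrite orbF eqn0Ngt b0.
Qed.

End TopForms.

(* The field k(u, Y) of rational functions on the plane, together with the
   derivation d/du. *)
Record coordinateField (k : fieldType) := CoordinateField {
  cfield :> fieldType;
  cemb : {rmorphism k -> cfield};
  cu : cfield;
  cY : cfield;
  cder : cfield -> cfield;
  cindependent : forall N (c : nat -> {poly k}),
    \sum_(i < N) cu ^+ i * (map_poly cemb (c i)).[cY] = 0 ->
    forall i, (i < N)%N -> c i = 0;
  calgebraic : forall (x : cfield) (p : {poly k}),
    p != 0 -> (map_poly cemb p).[x] = 0 -> exists a, x = cemb a;
  cderD : {morph cder : x y / x + y};
  cderM : forall x y, cder (x * y) = cder x * y + x * cder y;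
  cder_const : forall a, cder (cemb a) = 0;
  cder_u : cder cu = 1;
  cder_Y : cder cY = 0 }.

(** * Construction of the coordinate field *)

Lemma tofrac_monomial (F : fieldType) (a : F) i :
  FracField.tofrac (a *: 'X^i) = const_frac a * FracField.tofrac 'X ^+ i.
Proof. by rewrite -mul_polyC tofracM tofracXn. Qed.

Section Existence.
Variable k : fieldType.
Local Notation "f %:F" := (@FracField.tofrac _ f).
Local Notation M := {fraction {poly k}}.
Local Notation L := {fraction {poly M}}.

(** The field is k(Y)(u) with u as the outer variable, so that [frac_deriv] over M = k(Y) is d/du
    and kills Y. *)
Let emb : {rmorphism k -> L} := @const_frac M \o @const_frac k.
Let Y : L := const_frac ('X%:F : M).

Let horner_Y (p : {poly k}) : (map_poly emb p).[Y] = const_frac (p%:F : M).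
Proof.
have -> : (p%:F : M) = (map_poly (@const_frac k) p).['X%:F].
  rewrite -{1}[p]coefK poly_def (raddf_sum (@FracField.tofrac {poly k})).
  rewrite (@horner_coef_wide _ (size p)) ?size_poly //.
  apply: eq_bigr => i _; rewrite coef_map.
  exact: tofrac_monomial.
have -> : map_poly emb p = map_poly (@const_frac M) (map_poly (@const_frac k) p).
  by rewrite -map_poly_comp.
by rewrite -horner_map.
Qed.

Let independent N (c : nat -> {poly k}) :
  \sum_(i < N) ('X%:F : L) ^+ i * (map_poly emb (c i)).[Y] = 0 ->
  forall i, (i < N)%N -> c i = 0.
Proof.
pose q : {poly M} := \poly_(i < N) (c i)%:F.
have -> : \sum_(i < N) ('X%:F : L) ^+ i * (map_poly emb (c i)).[Y] = q%:F.
  rewrite /q poly_def (raddf_sum (@FracField.tofrac {poly M})); apply: eq_bigr => i _.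
  rewrite horner_Y mulrC; exact: esym (tofrac_monomial _ _).
move/eqP; rewrite tofrac_eq0 => /eqP q0 i iN.
have := congr1 (fun p : {poly M} => p`_i) q0; rewrite coef_poly iN coef0.
by move/eqP; rewrite tofrac_eq0 => /eqP.
Qed.

Let algebraic (x : L) (p : {poly k}) :
  p != 0 -> (map_poly emb p).[x] = 0 -> exists a, x = emb a.
Proof.
move=> p0 px.
have e : map_poly emb p = map_poly (@const_frac M) (map_poly (@const_frac k) p).
  by rewrite -map_poly_comp.
have pM0 : map_poly (@const_frac k) p != 0 by rewrite map_poly_eq0.
rewrite e in px; have [y ey] := algebraic_rational_function pM0 px.
rewrite ey horner_map in px.
have /eqP := px; rewrite fmorph_eq0 => /eqP py.
have [a ea] := algebraic_rational_function p0 py.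
by exists a; refine (etrans ey _); refine (f_equal (@const_frac M) ea).
Qed.

Lemma coordinateField_exists : inhabited (coordinateField k).
Proof.
split; refine (@CoordinateField k L emb 'X%:F Y (@frac_deriv M) independent algebraic
  _ _ _ _ _).
- exact: frac_derivD.
- exact: frac_derivM.
- by move=> a; exact: frac_deriv_const.
- exact: frac_derivX.
- exact: frac_deriv_const.
Qed.

End Existence.

(** * Explicit automorphisms *)

Section Restrictions.
Variable k : fieldType.
Local Notation "f %:F" := (@FracField.tofrac _ f).
Local Notation P := {mpoly k[3]}.
Local Notation K := {fraction {mpoly k[3]}}.
Local Notation A := (OS0 k).
Local Notation gen := (gen k).
Local Notation q0 := (q0 k).
Implicit Types (F : 3.-tuple K) (Phi Psi : AutS0 k).

(* restricts_to without the homogeneity of the numerator, a form that is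
   stable under composition. *)
Definition pulls_back F Psi := forall n (p : P) (f : A),
  OS0_val f = p%:F / q0%:F ^+ n ->
  OS0_val (comorph Psi f) = subst_rat F p / subst_rat F q0 ^+ n.

Lemma pulls_back_restricts F Psi : pulls_back F Psi -> restricts_to F Psi.
Proof. by move=> h n p f _; exact: h. Qed.

(** Regularity of all images follows from that of the five generators, since the standard monomials
    span O(S_0). *)
Lemma lift_to_OS0 (h : {rmorphism A -> K}) :
  (forall c : k, h c%:A = constK c) -> (forall l, (l <= 4)%N -> h (gen l) \in @OS0_pred k) ->
  exists h' : {rmorphism A -> A}, (forall c : k, h' c%:A = c%:A) /\
    forall f, OS0_val (h' f) = h f.
Proof.
move=> hc hg.
have hmon i j : (j <= 4 * i)%N -> h (mon k i j) \in @OS0_pred k.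
  elim: i j => [|i IH] j j4; first by rewrite /= rmorph1 rpred1.
  rewrite /=; case: leqP => jl; rewrite rmorphM ?rmorphXn /= rpredM ?rpredX ?hg //.
  by apply: IH; rewrite leq_subLR -mulnS.
have hA f : h f \in @OS0_pred k.
  have [N] := filt_all f; elim=> [|c i l g _ l4 _ hgp]; first by rewrite rmorph0 rpred0.
  rewrite rmorphD rpredD // -mulr_algl rmorphM rpredM ?hmon //= hc.
  exact: OS0_const_subproof.
pose h1 f : A := MkOS0 (hA f).
have hz : zmod_morphism h1 by move=> f g; apply: OS0_eqP; rewrite /= rmorphB.
have hm : monoid_morphism h1.
  by split=> [|f g]; apply: OS0_eqP; rewrite /= ?rmorph1 ?rmorphM.
pose h' : {rmorphism A -> A} := HB.pack h1
  (GRing.isZmodMorphism.Build _ _ h1 hz) (GRing.isMonoidMorphism.Build _ _ h1 hm).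
exists h'; split=> // c; apply: OS0_eqP; rewrite OS0_valZ OS0_val1 mulr1; exact: hc.
Qed.

Lemma subst_ratE F (X Y Z : K) : (forall i, tnth F i = nth 0 [:: X; Y; Z] i) ->
  subst_rat F q0 = X * Z + Y ^+ 2 /\
  forall l, (l <= 4)%N -> subst_rat F (gen_num k l) =
    nth 0 [:: X ^+ 2; X * Y; Y ^+ 2; - (Y * Z); Z ^+ 2] l.
Proof.
move=> FE; have mX (i : 'I_3) : mmap (@constK k) (tnth F) 'X_i = nth 0 [:: X; Y; Z] i.
  by rewrite mmapX mmap1U FE.
rewrite /subst_rat; split; first by rewrite /q0 rmorphD rmorphM rmorphXn /= !mX.
by case=> [|[|[|[|[|//]]]]] _; rewrite /gen_num /= ?rmorphN ?rmorphXn ?rmorphM /= ?mX.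
Qed.

(** A rational map is evaluated in the function field first. That it is regular on S_0 has to be
    seen on five generators only, and g supplies their images as elements of O(S_0). *)
Lemma restriction_exists F (X Y Z : K) (g : nat -> A) :
  (forall i, tnth F i = nth 0 [:: X; Y; Z] i) ->
  X * Z + Y ^+ 2 != 0 ->
  (forall l, (l <= 4)%N -> OS0_val (g l) * (X * Z + Y ^+ 2) =
     nth 0 [:: X ^+ 2; X * Y; Y ^+ 2; - (Y * Z); Z ^+ 2] l) ->
  exists h : {rmorphism A -> A}, [/\ forall c : k, h c%:A = c%:A,
    forall l, (l <= 4)%N -> h (gen l) = g l &
    forall n (p : P) (f : A), OS0_val f = p%:F / q0%:F ^+ n ->
      OS0_val (h f) = subst_rat F p / subst_rat F q0 ^+ n].
Proof.
move=> FE Q0 gE; have [qE numE] := subst_ratE FE.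
have qu : mmap (@constK k) (tnth F) q0 \is a GRing.unit.
  by rewrite unitfE -[mmap _ _ _]/(subst_rat F q0) qE.
have [h [hc hE]] := evaluation_exists qu.
have hg l : (l <= 4)%N -> h (gen l) = OS0_val (g l).
  move=> l4; rewrite (hE 1%N (gen_num k l)) ?expr1 //.
  rewrite -!/(subst_rat F _) qE numE // -gE //.
  exact: mulfK Q0 _.
have [|h' [h'c h'E]] := lift_to_OS0 hc.
  by move=> l /hg ->; exact: OS0_valP.
exists h'; split=> // [l l4|n p f vf].
  by apply: OS0_eqP; rewrite h'E hg.
by rewrite h'E (hE _ _ _ vf).
Qed.

Lemma gen0_neq0 : gen 0 != 0.
Proof.
apply/eqP => /(congr1 (@OS0_val k)); rewrite gen_val OS0_val0 => /eqP.
rewrite mulf_eq0 invr_eq0 (negPf (q0F_neq0 k)) orbF tofrac_eq0 /gen_num /=.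
rewrite expf_eq0 /= => /eqP/(congr1 (fun p : P => p.@[fun=> 1])).
by rewrite mevalXU meval0 => /eqP; rewrite oner_eq0.
Qed.

Lemma eq_endomorphism (f g : {rmorphism A -> A}) :
  (forall c : k, f c%:A = c%:A) -> (forall c : k, g c%:A = c%:A) ->
  f (gen 0) = g (gen 0) -> f (gen 1) = g (gen 1) -> f (gen 0) != 0 -> f =1 g.
Proof.
move=> fc gc e0 e1 nz.
have vinj : injective (@OS0_val k) by move=> a b; exact: OS0_eqP.
have hz : zmod_morphism (@OS0_val k) by move=> a b; rewrite OS0_valD OS0_valN.
have hm : monoid_morphism (@OS0_val k) by [].
pose v : {rmorphism A -> K} := HB.pack (@OS0_val k)
  (GRing.isZmodMorphism.Build _ _ (@OS0_val k) hz)
  (GRing.isMonoidMorphism.Build _ _ (@OS0_val k) hm).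
move=> a; apply: (@vinj _ _).
apply: (@eq_rmorphism_OS0 k _ (v \o f) (v \o g)) => [c|||] /=.
- by rewrite fc gc.
- by rewrite e0.
- by rewrite e1.
- by apply: contraNneq nz; rewrite -OS0_val0 => /vinj ->.
Qed.

Lemma autS0_exists (h h' : {rmorphism A -> A}) :
  (forall c : k, h c%:A = c%:A) -> (forall c : k, h' c%:A = c%:A) ->
  h (h' (gen 0)) = gen 0 -> h (h' (gen 1)) = gen 1 ->
  h' (h (gen 0)) = gen 0 -> h' (h (gen 1)) = gen 1 ->
  exists Psi : AutS0 k, comorph Psi =1 h.
Proof.
have inv (f g : {rmorphism A -> A}) : (forall c : k, f c%:A = c%:A) ->
    (forall c : k, g c%:A = c%:A) -> f (g (gen 0)) = gen 0 ->
    f (g (gen 1)) = gen 1 -> cancel g f.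
  move=> fc gc e0 e1; pose fg : {rmorphism A -> A} := f \o g.
  apply: (@eq_endomorphism fg idfun) => //=; last by rewrite e0 gen0_neq0.
  by move=> c; rewrite gc fc.
move=> hc h'c e1 e2 e3 e4.
have hl : linear h.
  by move=> c a b; rewrite rmorphD /= -[c *: a]mulr_algl rmorphM /= hc mulr_algl.
have hm : monoid_morphism h by split; [exact: rmorph1|exact: rmorphM].
by exists (MkAutSpec hl hm (inv _ _ h'c hc e3 e4) (inv _ _ hc h'c e1 e2)).
Qed.

Lemma eq_autS0 Phi Psi : comorph Phi (gen 0) = comorph Psi (gen 0) ->
  comorph Phi (gen 1) = comorph Psi (gen 1) -> Phi = Psi.
Proof.
move=> e0 e1; apply: autSpec_eq; apply: eq_endomorphism => //.
- exact: comorph_const.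
- exact: comorph_const.
by rewrite -(rmorph0 (comorph Phi)) (inj_eq (can_inj (@comorphK _ _ Phi))) gen0_neq0.
Qed.

Lemma rho0C c : rho0 c%:P = c%:A :> A.
Proof. by rewrite /rho0 horner_algC. Qed.

Lemma rho0X : rho0 'X = gen 0.
Proof. by rewrite /rho0 horner_algX gen0E. Qed.

Lemma rho0E (p : {poly k}) : rho0 p = \sum_(i < size p) p`_i *: gen 0 ^+ i.
Proof.
rewrite {1}/rho0 -gen0E -[horner_alg _ _]/((map_poly (in_alg A) p).[gen 0]).
rewrite (@horner_coef_wide _ (size p)) ?size_poly //; apply: eq_bigr => i _.
by rewrite coef_map /= mulr_algl.
Qed.

HB.instance Definition _ := GRing.LRMorphism.copy (@rho0 k) (horner_alg (x2q0 k)).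

Lemma rmorph_rho0 (R : comNzRingType) (h : {rmorphism A -> R}) (eta : {rmorphism k -> R}) :
  (forall c : k, h c%:A = eta c) ->
  forall p : {poly k}, h (rho0 p) = (map_poly eta p).[h (gen 0)].
Proof.
move=> hc p; rewrite rho0E rmorph_sum (@horner_coef_wide _ (size p)) ?size_poly //.
apply: eq_bigr => i _; rewrite coef_map -mulr_algl rmorphM rmorphXn /=.
by rewrite hc.
Qed.

Lemma rmorph_rho0_comp (h : {rmorphism A -> A}) r :
  (forall c : k, h c%:A = c%:A) -> h (gen 0) = rho0 r ->
  forall p : {poly k}, h (rho0 p) = rho0 (p \Po r).
Proof.
move=> hc h0 p; rewrite rho0E rmorph_sum comp_polyE rmorph_sum.
apply: eq_bigr => i _; rewrite -mulr_algl rmorphM rmorphXn /= hc h0 mulr_algl.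
rewrite linearZ /= rmorphXn -mulr_algl; exact: erefl.
Qed.

Lemma restricts_uniq F Psi Psi' : restricts_to F Psi -> restricts_to F Psi' -> Psi = Psi'.
Proof.
move=> r1 r2; apply: autSpec_eq => f; have [n [p [hp vf]]] := OS0_frac f.
by apply: OS0_eqP; rewrite (r1 _ _ _ hp vf) (r2 _ _ _ hp vf).
Qed.

(** The images of the five generators under a fibred map, written so as to be visibly regular; 1 -
    g2 stands for xz / q0. *)
Let fibre_alg (R : comNzRingType) (x y z q s g0 g1 g2 g3 g4 : R) :
  x * z + y ^+ 2 = q -> g0 * q = x ^+ 2 -> g1 * q = x * y -> g2 * q = y ^+ 2 ->
  g3 * q = - (y * z) -> g4 * q = z ^+ 2 ->
  let Y := y + s * x in let Z := z - 2 * y * s - x * s ^+ 2 in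
  x * Z + Y ^+ 2 = q /\
  [/\ g0 * q = x ^+ 2, (g1 + s * g0) * q = x * Y,
     (g2 + 2 * s * g1 + s ^+ 2 * g0) * q = Y ^+ 2,
     (g3 + 2 * s * g2 + s ^+ 2 * g1 - s * (1 - g2) + 2 * s ^+ 2 * g1 + s ^+ 3 * g0) * q
       = - (Y * Z) &
     (g4 + 4 * s * g3 + 4 * s ^+ 2 * g2 - 2 * s ^+ 2 * (1 - g2) + 4 * s ^+ 3 * g1
       + s ^+ 4 * g0) * q = Z ^+ 2].
Proof.
move=> qE h0 h1 h2 h3 h4 Y Z.
have h5 : (1 - g2) * q = x * z by rewrite mulrBl h2 -qE; ring.
split; first by rewrite -qE /Y /Z; ring.
split=> //.
- by rewrite mulrDl h1 -mulrA h0 /Y; ring.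
- by rewrite !mulrDl h2 -!mulrA h1 h0 /Y; ring.
- rewrite (_ : _ * q = g3 * q + 2 * s * (g2 * q) + s ^+ 2 * (g1 * q)
    - s * ((1 - g2) * q) + 2 * s ^+ 2 * (g1 * q) + s ^+ 3 * (g0 * q)); last by ring.
  by rewrite h0 h1 h2 h3 h5 /Y /Z; ring.
- rewrite (_ : _ * q = g4 * q + 4 * s * (g3 * q) + 4 * s ^+ 2 * (g2 * q)
    - 2 * s ^+ 2 * ((1 - g2) * q) + 4 * s ^+ 3 * (g1 * q) + s ^+ 4 * (g0 * q)); last by ring.
  by rewrite h0 h1 h2 h3 h4 h5 /Z; ring.
Qed.

Lemma gen_valq : let x := (px k)%:F in let y := (py k)%:F in let z := (pz k)%:F in
  let g l := OS0_val (gen l) in let q := q0%:F in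
  x * z + y ^+ 2 = q /\ [/\ g 0%N * q = x ^+ 2, g 1%N * q = x * y, g 2%N * q = y ^+ 2,
    g 3%N * q = - (y * z) & g 4%N * q = z ^+ 2].
Proof.
move=> x y z g q; split; first by rewrite /q /q0 tofracD tofracM tofracXn.
have gE l : g l * q = (gen_num k l)%:F by rewrite /g gen_val (divfK (q0F_neq0 k)).
by split; rewrite gE /gen_num /= ?tofracN ?tofracXn ?tofracM.
Qed.

(** In the chart, u is fixed and Y becomes Y + s(u); the second equation is this one multiplied by
    u. *)
Definition is_fibre s Psi :=
  comorph Psi (gen 0) = gen 0 /\ comorph Psi (gen 1) = gen 1 + rho0 s * gen 0.

Lemma fibre_exists s : exists Psi, pulls_back (fibre_map s) Psi /\ is_fibre s Psi.
Proof.
have endo r : exists h : {rmorphism A -> A}, [/\ forall c : k, h c%:A = c%:A,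
    h (gen 0) = gen 0, h (gen 1) = gen 1 + rho0 r * gen 0 &
    forall n (p : P) (f : A), OS0_val f = p%:F / q0%:F ^+ n ->
      OS0_val (h f) = subst_rat (fibre_map r) p / subst_rat (fibre_map r) q0 ^+ n].
  pose t : A := rho0 r.
  have tE : (map_poly (@constK k) r).[(px k)%:F ^+ 2 / q0%:F] = OS0_val t.
    rewrite (@horner_coef_wide _ (size r)) ?size_poly // /t rho0E.
    rewrite (big_morph (@OS0_val k) (@OS0_valD k) (OS0_val0 k)); apply: eq_bigr => i _.
    by rewrite coef_map OS0_valZ OS0_valX gen0E.
  have [qE [e0 e1 e2 e3 e4]] := gen_valq.
  have [QE [f0 f1 f2 f3 f4]] := @fibre_alg _ _ _ _ _ (OS0_val t) _ _ _ _ _ qE e0 e1 e2 e3 e4.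
  pose g l : A := nth 0 [:: gen 0; gen 1 + t * gen 0;
    gen 2 + 2 * t * gen 1 + t ^+ 2 * gen 0;
    gen 3 + 2 * t * gen 2 + t ^+ 2 * gen 1 - t * (1 - gen 2) + 2 * t ^+ 2 * gen 1
      + t ^+ 3 * gen 0;
    gen 4 + 4 * t * gen 3 + 4 * t ^+ 2 * gen 2 - 2 * t ^+ 2 * (1 - gen 2)
      + 4 * t ^+ 3 * gen 1 + t ^+ 4 * gen 0] l.
  have [|||h [hc hg hE]] := @restriction_exists (fibre_map r) _ _ _ g (_ : forall i, tnth _ i = nth 0 [:: (px k)%:F;
      (py k)%:F + OS0_val t * (px k)%:F;
      (pz k)%:F - 2 * (py k)%:F * OS0_val t - (px k)%:F * OS0_val t ^+ 2] i).
  - by move=> i; rewrite /fibre_map tE (tnth_nth 0).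
  - by rewrite QE q0F_neq0.
  - by rewrite QE; case=> [|[|[|[|[|//]]]]] _.
  exists h; split=> //.
  - exact: (hg 0%N).
  - exact: (hg 1%N).
have [h [hc h0 h1 hE]] := endo s; have [h' [h'c h'0 h'1 _]] := endo (- s).
have fix_rho (f : {rmorphism A -> A}) : (forall c : k, f c%:A = c%:A) ->
    f (gen 0) = gen 0 -> forall r, f (rho0 r) = rho0 r.
  move=> fc f0 r; rewrite (rmorph_rho0_comp fc (r := 'X)) ?comp_polyXr //.
  by rewrite f0 rho0X.
have [||||Psi PsiE] := autS0_exists hc h'c.
- by rewrite h'0.
- by rewrite h'1 rmorphD rmorphM /= h1 h0 fix_rho // rmorphN mulNr addrK.
- by rewrite h0.
- by rewrite h1 rmorphD rmorphM /= h'1 h'0 fix_rho // rmorphN mulNr subrK.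
exists Psi; split; last by rewrite /is_fibre !PsiE.
by move=> n p f vf; rewrite PsiE (hE _ _ _ vf).
Qed.

Lemma comorph_rho0 Psi (p : {poly k}) :
  comorph Psi (gen 0) = gen 0 -> comorph Psi (rho0 p) = rho0 p.
Proof.
move=> e0; have h : comorph Psi (gen 0) = rho0 'X by rewrite e0 rho0X.
by have := rmorph_rho0_comp (comorph_const Psi) h p; rewrite comp_polyXr.
Qed.

Lemma is_fibreV s Psi : is_fibre s Psi -> is_fibre (- s) Psi^-1%g.
Proof.
move=> [e0 e1]; have v0 : comorph Psi^-1%g (gen 0) = gen 0.
  by apply: (can_inj (@comorphK _ _ Psi)); rewrite comorphVE comorphVK e0.
split=> //; apply: (can_inj (@comorphK _ _ Psi)); rewrite comorphVE comorphVK.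
by rewrite rmorphD rmorphM /= comorph_rho0 // e0 e1 rmorphN mulNr addrK.
Qed.

(** In the chart, u becomes a^2 u and Y becomes a^-1 Y. *)
Definition is_torus (a : k) Psi :=
  comorph Psi (gen 0) = a ^+ 2 *: gen 0 /\ comorph Psi (gen 1) = a *: gen 1.

Let torus_alg (R : comUnitRingType) (x y z q a b g0 g1 g2 g3 g4 : R) : a * b = 1 ->
  x * z + y ^+ 2 = q -> g0 * q = x ^+ 2 -> g1 * q = x * y -> g2 * q = y ^+ 2 ->
  g3 * q = - (y * z) -> g4 * q = z ^+ 2 ->
  (a * x) * (b * z) + y ^+ 2 = q /\
  [/\ (a ^+ 2 * g0) * q = (a * x) ^+ 2, (a * g1) * q = a * x * y, g2 * q = y ^+ 2,
   (b * g3) * q = - (y * (b * z)) & (b ^+ 2 * g4) * q = (b * z) ^+ 2].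
Proof.
move=> ab qE h0 h1 h2 h3 h4; split.
  by rewrite -qE mulrACA ab mul1r.
by split=> //; rewrite -?mulrA ?h0 ?h1 ?h2 ?h3 ?h4; ring.
Qed.

Lemma torus_exists (a : k) : a != 0 -> exists Psi,
  pulls_back [tuple of map (@FracField.tofrac P) (torus_map a)] Psi /\ is_torus a Psi.
Proof.
move=> a0; pose T b := [tuple of map (@FracField.tofrac P) (torus_map b)].
have endo b : b != 0 -> exists h : {rmorphism A -> A}, [/\ forall c : k, h c%:A = c%:A,
    h (gen 0) = b ^+ 2 *: gen 0, h (gen 1) = b *: gen 1 &
    forall n (p : P) (f : A), OS0_val f = p%:F / q0%:F ^+ n ->
      OS0_val (h f) = subst_rat (T b) p / subst_rat (T b) q0 ^+ n].
  move=> b0; have [qE [e0 e1 e2 e3 e4]] := gen_valq.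
  have cX (c : k) n : constK (c ^+ n) = constK c ^+ n by rewrite rmorphXn.
  have bb : constK b * constK b^-1 = 1 by rewrite -rmorphM divff // rmorph1.
  have [QE [f0 f1 f2 f3 f4]] := torus_alg bb qE e0 e1 e2 e3 e4.
  pose g l : A := nth 0 [:: b ^+ 2 *: gen 0; b *: gen 1; gen 2; b^-1 *: gen 3;
    b^-1 ^+ 2 *: gen 4] l.
  have [|||h [hc hg hE]] := @restriction_exists (T b) _ _ _ g (_ : forall i, tnth _ i = nth 0 [:: constK b * (px k)%:F;
      (py k)%:F; constK b^-1 * (pz k)%:F] i).
  - have tE (c : k) (m : P) : (c *: m)%:F = constK c * m%:F by rewrite -mul_mpolyC tofracM.
    by apply: ord3P; rewrite tnth_map (tnth_nth 0) //= tE.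
  - by rewrite QE q0F_neq0.
  - rewrite QE; case=> [|[|[|[|[|//]]]]] _; by rewrite /g /= ?OS0_valZ ?cX.
  exists h; split=> //.
  - exact: (hg 0%N).
  - exact: (hg 1%N).
have [h [hc h0 h1 hE]] := endo a a0; have [|h' [h'c h'0 h'1 _]] := endo a^-1.
  by rewrite invr_eq0.
have hZ (f : {rmorphism A -> A}) : (forall c : k, f c%:A = c%:A) ->
    forall c g, f (c *: g) = c *: f g.
  by move=> fc c g; rewrite -mulr_algl rmorphM /= fc mulr_algl.
have [||||Psi PsiE] := autS0_exists hc h'c.
- by rewrite h'0 hZ // h0 scalerA -exprMn mulVf // expr1n scale1r.
- by rewrite h'1 hZ // h1 scalerA mulVf // scale1r.
- by rewrite h0 hZ // h'0 scalerA -exprMn divff // expr1n scale1r.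
- by rewrite h1 hZ // h'1 scalerA divff // scale1r.
exists Psi; split; last by rewrite /is_torus !PsiE.
by move=> n p f vf; rewrite PsiE (hE _ _ _ vf).
Qed.

(** Up to lower terms u becomes u Y^4 and Y becomes Y^-1. *)
Definition is_swap Psi :=
  comorph Psi (gen 0) = gen 4 /\ comorph Psi (gen 1) = gen 3.

Lemma swap_exists : exists Psi,
  [/\ pulls_back [tuple of map (@FracField.tofrac P) (swap_map k)] Psi,
      is_swap Psi, comorph Psi (gen 3) = gen 1 & comorph Psi (gen 4) = gen 0].
Proof.
have [qE [e0 e1 e2 e3 e4]] := gen_valq.
have QE : (pz k)%:F * (px k)%:F + (- (py k)%:F) ^+ 2 = q0%:F by rewrite -qE sqrrN mulrC.
pose g l : A := nth 0 [:: gen 4; gen 3; gen 2; gen 1; gen 0] l.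
pose T := [tuple of map (@FracField.tofrac P) (swap_map k)].
have [|||h [hc hg hE]] := @restriction_exists T _ _ _ g (_ : forall i, tnth _ i = nth 0
    [:: (pz k)%:F; - (py k)%:F; (px k)%:F] i).
- by apply: ord3P; rewrite tnth_map (tnth_nth 0) //= tofracN.
- by rewrite QE q0F_neq0.
- rewrite QE; case=> [|[|[|[|[|//]]]]] _; rewrite /g /= ?e0 ?e1 ?e2 ?e3 ?e4 //.
  + by rewrite mulrN mulrC.
  + by rewrite sqrrN.
  + by rewrite mulNr opprK mulrC.
have h0 : h (gen 0) = gen 4 := hg 0%N isT; have h1 : h (gen 1) = gen 3 := hg 1%N isT.
have h3 : h (gen 3) = gen 1 := hg 3%N isT; have h4 : h (gen 4) = gen 0 := hg 4%N isT.
have [||||Psi PsiE] := autS0_exists hc hc.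
- by rewrite h0 h4.
- by rewrite h1 h3.
- by rewrite h0 h4.
- by rewrite h1 h3.
exists Psi; split; rewrite /is_swap ?PsiE //.
by move=> n p f vf; rewrite PsiE (hE _ _ _ vf).
Qed.

End Restrictions.

(** * Action on leading forms *)

Section Levels.
Variables (L : fieldType) (E : degreeField L).
Local Notation lead := (@dlead L E).

Lemma lead_level f m m' c c' : lead f m c -> lead f m' c' -> c != 0 -> c' != 0 -> m = m'.
Proof.
move=> l1 l2 c0 c'0; have [lt|lt|//] := ltgtP m m'.
  by move: c'0; rewrite (dlead_uniq l2 (dlead_low l1 lt)) eqxx.
by move: c0; rewrite (dlead_uniq l1 (dlead_low l2 lt)) eqxx.
Qed.

Lemma lead_horner (k : fieldType) (j : {rmorphism k -> L}) (s : {poly k}) f (m b : nat) x :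
  (0 < m)%N -> (size s <= b.+1)%N -> lead f m x ->
  lead (map_poly (scal E j) s).[f] (m * b)%N (j s`_b * x ^+ b).
Proof.
move=> m0 sb lf; rewrite (@horner_coef_wide _ b.+1); last first.
  by rewrite (leq_trans (size_poly _ _)).
rewrite big_ord_recr /= -[j s`_b * _]add0r; apply: dleadD; last first.
  rewrite coef_map /=; have := dleadM (dlead_const E (j s`_b)) (leadX b lf).
  by rewrite add0r -mulr_natr natz -PoszM.
apply: (big_ind (fun y => lead y (m * b)%N 0)); first exact: dlead0.
  by move=> y z ly lz; have := dleadD ly lz; rewrite addr0.
move=> i _; rewrite coef_map /=; have := dleadM (dlead_const E (j s`_i)) (leadX i lf).
move/dlead_low; apply; rewrite add0r -mulr_natr natz -PoszM ltz_nat ltn_pmul2l //.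
Qed.

End Levels.

Section TopStates.
Variables (k : fieldType) (C : coordinateField k) (E : degreeField C).
Local Notation A := (OS0 k).
Local Notation j := (@cemb k C).
Local Notation u := (cu C).
Local Notation Y := (cY C).
Local Notation lead := (@dlead C E).
Local Notation gen := (gen k).
Local Notation indep := (@cindependent k C).
Local Notation u_neq0 := (u_neq0 indep).
Local Notation Y_neq0 := (Y_neq0 indep).
Local Notation wpt := (wpt E indep).
Implicit Types (f : A) (Psi : AutS0 k) (s p : {poly k}).

(** In the chart, u becomes c1 u and Y becomes e Y + s(u); torus and fibred letters are both of this
    form. *)
Definition is_triangular (c1 e : k) s Psi := [/\ c1 != 0, e != 0,
  comorph Psi (gen 0) = c1 *: gen 0 &
  comorph Psi (gen 1) = c1 *: (e *: gen 1 + rho0 s * gen 0)].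

Lemma fibre_triangular s Psi : is_fibre s Psi -> is_triangular 1 1 s Psi.
Proof. by case=> h0 h1; split; rewrite ?oner_neq0 ?scale1r. Qed.

Let wpt_triangular (c1 e : k) s Psi : is_triangular c1 e s Psi ->
  let h : {rmorphism A -> E} := wpt 1 0 \o comorph Psi in
  exists U V, [/\ forall c : k, h c%:A = scal E j c, h (gen 0) = U, h (gen 1) = U * V,
    lead U 1 (j c1 * u) &
    forall b, (size s <= b.+1)%N ->
      lead V b ((j e * Y) *+ (b == 0%N) + j s`_b * u ^+ b)].
Proof.
move=> [c10 e0 p0 p1] h; have [U [V [hc h0 h1 lU lV]]] := wptP E indep 1 0.
have hE f : h f = wpt 1 0 (comorph Psi f) by [].
have hZ c f : wpt 1 0 (c *: f) = scal E j c * wpt 1 0 f.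
  by rewrite -mulr_algl rmorphM /= hc.
have hD f g : wpt 1 0 (f + g) = wpt 1 0 f + wpt 1 0 g by rewrite rmorphD.
have hM f g : wpt 1 0 (f * g) = wpt 1 0 f * wpt 1 0 g by rewrite rmorphM.
exists (scal E j c1 * U), (scal E j e * V + (map_poly (scal E j) s).[U]); split.
- by move=> c; rewrite hE comorph_const hc.
- by rewrite hE p0 hZ h0.
- rewrite hE p1 hZ hD hM hZ h0 h1 (rmorph_rho0 hc) h0 -[RHS]mulrA [X in _ = _ * X]mulrDr.
  by congr (_ * (_ + _)); [rewrite mulrCA|rewrite mulrC].
- by have := dleadM (dlead_const E (j c1)) lU; rewrite add0r.
move=> b sb; apply: dleadD; last first.
  by have := lead_horner j (isT : (0 < 1)%N) sb lU; rewrite mul1n.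
have := dleadM (dlead_const E (j e)) lV; rewrite add0r => /lead_le /(_ (le0z_nat b)).
by case: (b).
Qed.

Lemma topform_borel (c1 e s0 : k) Psi f n p : is_triangular c1 e s0%:P Psi ->
  topform f n p ->
  topform (comorph Psi f) n (c1 ^+ n *: (p \Po (e *: 'X + s0%:P))).
Proof.
move=> tr tf; have [c10 e0 _ _] := tr.
have sE : size (e *: 'X + s0%:P) = 2%N.
  by rewrite size_polyDl size_scale ?size_polyX // ltnS size_polyC leq_b1.
apply: (topform_of_lead (E := E) (independent := indep)).
  rewrite scaler_eq0 negb_or expf_neq0 //= comp_poly_eq0 ?sE //.
  exact: topform_neq0 tf.
have [U [V [hc h0 h1 lU lV]]] := wpt_triangular tr.
have {}lV := lV 0%N; rewrite size_polyC leq_b1 eqxx coefC eqxx expr0 !mulr1 in lV.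
have jcu : j c1 * u != 0 by rewrite mulf_neq0 ?fmorph_eq0 // u_neq0.
have := lead_topform hc h0 h1 lU (lV isT) jcu tf.
congr (lead _ _ _); rewrite map_polyZ hornerZ map_comp_poly horner_comp exprMn rmorphXn.
rewrite [RHS]mulrA [u ^+ n * _]mulrC; congr (_ * _.[_]).
by rewrite rmorphD /= map_polyZ map_polyX map_polyC hornerD hornerZ hornerX hornerC.
Qed.

(** Here s has degree b.+1, so Y acquires this degree in u. The largest degree n + b.+1 (4 n) comes
    from u^n Y^(4 n) alone, whose coefficient is c because the top form is a full power. *)
Lemma topform_fibre (c1 e : k) s b Psi f n c r : is_triangular c1 e s Psi ->
  size s = b.+2 -> c != 0 -> topform f n (c *: ('X - r%:P) ^+ (4 * n)) ->
  exists2 c', c' != 0 & topform (comorph Psi f) (n + b.+1 * (4 * n)) c'%:P.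
Proof.
move=> tr sb c0 [d [[sd _] -> dE]]; have [c10 e0 _ _] := tr.
have dn : (d n)`_(4 * n) = c.
  rewrite dE coefZ; have /monicP := monic_exp (4 * n) (monicXsubC r).
  by rewrite lead_coefE size_exp_XsubC /= => ->; rewrite mulr1.
have sb0 : s`_b.+1 != 0 by rewrite -[b.+1]/(b.+2.-1) -sb -lead_coefE lead_coef_eq0 -size_poly_gt0 sb.
exists (c * c1 ^+ n * (s`_b.+1) ^+ (4 * n)); first by rewrite !mulf_neq0 ?expf_neq0.
apply: (topform_of_lead (E := E) (independent := indep)).
  by rewrite polyC_eq0 !mulf_neq0 ?expf_neq0.
have [U [V [hc h0 h1 lU lV]]] := wpt_triangular tr.
have {}lV := lV b.+1; rewrite sb leqnn mulr0n add0r in lV.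
have jcu : j c1 * u != 0 by rewrite mulf_neq0 ?fmorph_eq0 // u_neq0.
set W := (n + b.+1 * (4 * n))%N.
have leW i l : (i <= n)%N -> (l <= 4 * i)%N -> (1 * i + b.+1 * l <= W)%N.
  move=> h2 h3; rewrite mul1n leq_add // leq_mul2l /= (leq_trans h3) //.
  by rewrite leq_mul2l.
have := lead_comb hc h0 h1 (isT : (0 < 1)%N) lU (lV isT) jcu (fun i l h2 h3 (_ : (d i)`_l != 0) => leW i l h2 h3).
congr (lead _ _ _); rewrite /topsum big_ord_recr /= big1 ?add0r => [|i _]; last first.
  rewrite big1 // => l _; rewrite ltn_eqF ?rmorph0 ?mul0r // mul1n /W -addSn leq_add //.
  rewrite leq_mul2l /=; have := ltn_ord l; rewrite ltnS => /leq_trans; apply.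
  by rewrite leq_mul2l ltnW.
rewrite big_ord_recr /= big1 ?add0r => [|l _]; last first.
  rewrite ltn_eqF ?rmorph0 ?mul0r // mul1n /W ltn_add2l ltn_mul2l /=.
  exact: ltn_ord.
rewrite mul1n eqxx dn map_polyC hornerC /= !exprMn -exprM /W exprD !rmorphM !rmorphXn /=.
move: (u ^+ n) (u ^+ _) (j c1 ^+ n) (_ ^+ (4 * n)) (j c) => ? ? ? ? ?; ring.
Qed.

(** By the effect of the swap on u and Y, the new form q is the reversal of p in degree 4 n; it is
    prescribed through its value in L. *)
Lemma topform_swap Psi f n p q : is_swap Psi -> topform f n p -> q != 0 ->
  Y ^+ (4 * n) * (map_poly j p).[Y^-1] = (map_poly j q).[Y] ->
  topform (comorph Psi f) n q.
Proof.
move=> [p0 p1] tf q0 qE; apply: (topform_of_lead (E := E) (independent := indep)) => //.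
have [U0 [V0 [hc h0 h1 lU lV]]] := wptP E indep 1 0.
pose h : {rmorphism A -> E} := wpt 1 0 \o comorph Psi.
have hE f' : h f' = wpt 1 0 (comorph Psi f') by [].
have l4 := lead_gen h0 h1 (isT : (0 < 1)%N) lU lV u_neq0 (isT : (4 <= 4)%N).
have l3 := lead_gen h0 h1 (isT : (0 < 1)%N) lU lV u_neq0 (isT : (3 <= 4)%N).
have uY4 : u * Y ^+ 4 != 0 by rewrite mulf_neq0 ?expf_neq0 ?u_neq0 ?Y_neq0.
have g40 : wpt 1 0 (gen 4) != 0.
  apply: contraNneq uY4 => z; rewrite z in l4.
  by rewrite (dlead_uniq l4 (dlead0 _ _)).
have hc' (c0 : k) : h c0%:A = scal E j c0 by rewrite hE comorph_const hc.
have h0' : h (gen 0) = wpt 1 0 (gen 4) by rewrite hE p0.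
have h1' : h (gen 1) = wpt 1 0 (gen 4) * (wpt 1 0 (gen 3) / wpt 1 0 (gen 4)).
  by rewrite hE p1 mulrC divfK.
have lV' := dleadM l3 (dleadV l4 uY4).
have -> : u ^+ n * (map_poly j q).[Y] = (u * Y ^+ 4) ^+ n * (map_poly j p).[Y^-1].
  by rewrite -qE mulrA exprMn -exprM.
have YE : u * Y ^+ 3 / (u * Y ^+ 4) = Y^-1.
  by move: u_neq0 Y_neq0 => a0 b0; field; rewrite ?a0 ?b0.
rewrite YE in lV'; exact: lead_topform hc' h0' h1' l4 lV' uY4 tf.
Qed.

Lemma topform_swap_const Psi f n (c : k) : is_swap Psi -> c != 0 -> topform f n c%:P ->
  topform (comorph Psi f) n (c *: 'X^(4 * n)).
Proof.
move=> sw c0 tf; apply: (topform_swap sw tf).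
  by rewrite scaler_eq0 negb_or c0 expf_neq0 ?polyX_eq0.
by rewrite map_polyC hornerC map_polyZ /= map_polyXn hornerZ hornerXn mulrC.
Qed.

Lemma topform_swap_power Psi f n (c r : k) : is_swap Psi -> c != 0 ->
  topform f n (c *: ('X - r%:P) ^+ (4 * n)) ->
  topform (comorph Psi f) n (c *: (1 - r *: 'X) ^+ (4 * n)).
Proof.
move=> sw c0 tf; apply: (topform_swap sw tf).
  rewrite scaler_eq0 negb_or c0 expf_neq0 //.
  apply/eqP => /(congr1 (fun p : {poly k} => p.[0])).
  by rewrite hornerD hornerN hornerZ hornerX !hornerC mulr0 subr0 => /eqP; rewrite oner_eq0.
rewrite !map_polyZ /= !hornerZ mulrCA; congr (_ * _).
rewrite !rmorphXn !horner_exp -exprMn; congr (_ ^+ _).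
rewrite !rmorphB /= map_polyZ /= rmorph1 map_polyX map_polyC !hornerD !hornerN hornerZ !hornerX !hornerC.
by rewrite mulrBr divff ?Y_neq0 // [Y * _]mulrC.
Qed.

(** The inverse of Psi gives u = p(w) for a function w. If w has degree m in u, then m times the
    degree of p is 1; m = 0 would bound the degree of u by 0. *)
Lemma comorph_rho0_linear (Psi : AutS0 k) p :
  comorph Psi (gen 0) = rho0 p -> size p = 2%N.
Proof.
move=> e; have [U0 [V0 [hc h0 h1 lU lV]]] := wptP E indep 1 0.
have := congr1 (comorphV Psi) e; rewrite comorphK.
rewrite -comorphVE (rmorph_rho0 (eta := @GRing.in_alg k A)) => [e1|c]; last first.
  exact: comorph_const.
pose w := comorph Psi^-1%g (gen 0).
have {}e1 : U0 = (map_poly (scal E j) p).[wpt 1 0 w].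
  rewrite -h0 e1 -/w -horner_map /= -map_poly_comp; congr (_.[_]).
  by apply: eq_map_poly => c /=; rewrite hc.
have w0 : w != 0.
  by rewrite -(rmorph0 (comorph Psi^-1%g)) (inj_eq (can_inj (@comorphK _ _ _))) gen0_neq0.
have wp0 : wpt 1 0 w != 0.
  have [m [q tw]] := topform_exists w0; have lw := topform_lead E indep tw.
  apply/eqP => z; rewrite z in lw; have /eqP := dlead_uniq lw (dlead0 _ _).
  rewrite mulf_eq0 expf_eq0 (negPf u_neq0) andbF /= => /eqP/(transcendental_Y indep)/eqP.
  by rewrite (negPf (topform_neq0 tw)).
have [m [q tw]] := topform_exists w0; have lw := topform_lead E indep tw.
have x0 : u ^+ m * (map_poly j q).[Y] != 0.
  rewrite mulf_neq0 ?expf_neq0 ?u_neq0 //; apply: contraNneq (topform_neq0 tw).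
  by move/(transcendental_Y indep) => ->.
have p0 : p != 0.
  apply: contraNneq (gen0_neq0 k) => z; apply/eqP; apply: (can_inj (@comorphK _ _ Psi)).
  by rewrite e z !rmorph0.
have [m0|m0] := posnP m.
  rewrite m0 in lw; have lp : exists x, lead U0 0 x.
    rewrite e1 (@horner_coef_wide _ (size p)) ?size_poly //.
    apply: (big_ind (fun y => exists x, lead y 0 x)); first by exists 0; exact: dlead0.
      by move=> y z [y1 ly] [z1 lz]; exists (y1 + z1); exact: dleadD.
    move=> i _; rewrite coef_map /=.
    have := dleadM (dlead_const E (j p`_i)) (leadX i lw); rewrite mul0rn addr0 => h.
    by eexists; exact: h.
  have [x lx] := lp; have /eqP := dlead_uniq lU (dlead_low lx (ltr01 : 0 < 1%Z)).
  by rewrite (negPf u_neq0).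
have sp : (size p <= (size p).-1.+1)%N by exact: leqSpred.
have := lead_horner j m0 sp lw; rewrite -e1 => lU'.
have nz : j p`_(size p).-1 * (u ^+ m * (map_poly j q).[Y]) ^+ (size p).-1 != 0.
  by rewrite mulf_neq0 ?expf_neq0 // fmorph_eq0 -lead_coefE lead_coef_eq0.
have /eqP := lead_level lU lU' u_neq0 nz; rewrite eqz_nat eq_sym muln_eq1 => /andP[_ /eqP e2].
by rewrite -(prednK (n := size p)) ?e2 // size_poly_gt0.
Qed.

End TopStates.

(** * Reduction of an automorphism to one preserving the fibration *)

Section Reduction.
Variable k : fieldType.
Local Notation A := (OS0 k).
Local Notation gen := (gen k).
Implicit Types (Phi Psi : AutS0 k) (p s : {poly k}).

Lemma autA1_exists p : size p = 2%N -> exists psi : AutA1 k, comorph psi 'X = p.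
Proof.
move=> sp; pose a := p`_1; pose b := p`_0.
have a0 : a != 0 by rewrite /a -[1%N]/(2.-1) -sp -lead_coefE lead_coef_eq0 -size_poly_gt0 sp.
have pE : p = a *: 'X + b%:P.
  apply/polyP => -[|[|i]]; rewrite coefD coefZ coefX coefC /= ?mulr0 ?add0r ?mulr1 ?addr0 //.
  by rewrite nth_default // sp.
pose q : {poly k} := a^-1 *: ('X - b%:P).
have hl r : linear (fun f : {poly k} => f \Po r).
  by move=> c f g; rewrite comp_polyD comp_polyZ.
have hm r : monoid_morphism (fun f : {poly k} => f \Po r).
  by split=> [|f g]; rewrite ?comp_polyM // -[1]/(1%:P) comp_polyC.
have pq : p \Po q = 'X.
  rewrite pE comp_polyD comp_polyZ comp_polyX comp_polyC scalerA divff // scale1r.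
  by rewrite subrK.
have qp : q \Po p = 'X.
  rewrite comp_polyZ comp_polyB comp_polyX comp_polyC pE addrK scalerA mulVf //.
  by rewrite scale1r.
have c1 : cancel (fun f : {poly k} => f \Po p) (fun f => f \Po q).
  by move=> f; rewrite -comp_polyA pq comp_polyXr.
have c2 : cancel (fun f : {poly k} => f \Po q) (fun f => f \Po p).
  by move=> f; rewrite -comp_polyA qp comp_polyXr.
by exists (MkAutSpec (hl p) (hm p) c1 c2); rewrite /= comp_polyX.
Qed.

Lemma comp_comorph (psi : AutA1 k) p : comorph psi p = p \Po comorph psi 'X.
Proof.
rewrite -{1}[p]coefK poly_def rmorph_sum comp_polyE; apply: eq_bigr => i _.
by rewrite -[in LHS]mul_polyC rmorphM rmorphXn /= -[(p`_i)%:P]alg_polyC comorph_const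
  alg_polyC mul_polyC.
Qed.

(** The converse has the content: p is of degree one by [comorph_rho0_linear], so it defines an
    automorphism of the line. *)
Lemma AutS0_rho0P Phi : AutS0_rho0 k Phi <-> exists p, comorph Phi (gen 0) = rho0 p.
Proof.
split=> [[psi h]|[p h]]; first by exists (comorph psi 'X); rewrite -h rho0X.
have [C] := coordinateField_exists k; have [E] := degreeField_exists C.
have [psi psiX] := autA1_exists (comorph_rho0_linear E h).
exists psi => r; rewrite comp_comorph psiX.
exact: rmorph_rho0_comp (comorph_const Phi) h r.
Qed.

Lemma rho0_monomial (r : k) b : rho0 (r *: 'X^b) = r *: gen 0 ^+ b.
Proof.
by rewrite -mul_polyC rmorphM rmorphXn /= rho0C rho0X mulr_algl.
Qed.

Lemma is_triangular_rho0 (c1 e : k) s Psi : is_triangular c1 e s Psi -> AutS0_rho0 k Psi.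
Proof.
move=> [_ _ h _]; apply/AutS0_rho0P; exists (c1 *: 'X^1); rewrite rho0_monomial.
by rewrite expr1.
Qed.

Lemma reduction (H : set (AutS0 k)) : is_subgroup H ->
  (forall s Psi, is_fibre s Psi -> H Psi) -> (forall Psi, is_swap Psi -> H Psi) ->
  forall Phi, exists2 Gam, H Gam & AutS0_rho0 k (Phi * Gam)%g.
Proof.
move=> [H1 HM HV] Hfib Hsw Phi.
have [C] := coordinateField_exists k; have [E] := degreeField_exists C.
have [n] : exists n, exists p, topform (comorph Phi (gen 0)) n p.
  have [n [p h]] := topform_exists (comorph_gen0_neq0 E (@cindependent k C) Phi).
  by exists n, p.
elim/ltn_ind: n Phi => n IH Phi [p tp].
have [sw [_ swP _ _]] := swap_exists k.
have reduce Phi' Psi : H Psi -> (exists2 Gam, H Gam & AutS0_rho0 k (Phi' * Psi * Gam)%g) ->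
    exists2 Gam, H Gam & AutS0_rho0 k (Phi' * Gam)%g.
  by move=> hP [Gam hG h]; exists (Psi * Gam)%g; [exact: HM|rewrite mulgA].
have const_case Phi' (d : k) : topform (comorph Phi' (gen 0)) n d%:P ->
    exists2 Gam, H Gam & AutS0_rho0 k (Phi' * Gam)%g.
  move=> [c [tc Fc cn]]; have [sc _] := tc.
  have [ex|none] := pselect (exists i l, [/\ (i <= n)%N, (0 < l)%N & (c i)`_l != 0]).
    have [n0|n0] := posnP n.
      have [i [l [+ l0 /negP[]]]] := ex; rewrite n0 leqn0 => /eqP i0.
      apply/eqP; rewrite nth_default // i0.
      by have := sc 0%N; rewrite muln0 => /leq_trans; apply.
    have [b [r [b0 rt leW]]] := line_poly_root E (@cindependent k C) (@calgebraic k C)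
      (@cderD k C) (@cderM k C) (@cder_const k C) (@cder_u k C) (@cder_Y k C) n0 Fc tc cn ex.
    have [Psi [_ fibP]] := fibre_exists (r *: 'X^b); have [p0 p1] := fibP.
    have {}p1 : comorph Psi (gen 1) = gen 1 + r *: gen 0 ^+ b.+1.
      by rewrite p1 rho0_monomial -scalerAl -exprSr.
    have F0 := comorph_gen0_neq0 E (@cindependent k C) Phi'.
    have [n' [p' tp']] := topform_exists (comorph_gen0_neq0 E (@cindependent k C) (Phi' * Psi)%g).
    have lt := fibre_lowers E (@cindependent k C) (@calgebraic k C) b0 Fc sc rt leW p0 p1 F0 tp'.
    have [|Gam hG h] := IH n' lt (Phi' * Psi)%g; first by exists p'.
    by exists (Psi * Gam)%g; [apply: HM => //; exact: Hfib fibP|rewrite mulgA].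
  (* Here only powers of [gen 0] occur in F, which is thus already a polynomial in u. *)
  exists 1%g; rewrite ?mulg1 //; apply/AutS0_rho0P.
  exists (\poly_(i < n.+1) (c i)`_0); rewrite Fc /comb poly_def rmorph_sum.
  apply: eq_bigr => i _; rewrite big_ord_recl /= big1 ?addr0 => [|l _].
    by rewrite mon0 rho0_monomial.
  have -> : (c i)`_(bump 0 l) = 0; last by rewrite scale0r.
  apply/eqP; apply: contrapT => /negP nz; apply: none; exists i, (bump 0 l); split=> //.
  by rewrite -ltnS.
have [n0|n0] := posnP n.
  have := topform_size tp; rewrite n0 muln0 => /size1_polyC pE.
  by apply: (const_case _ p`_0); rewrite -pE.
have [[d pE]|[r [d pE]]] := topform_comorph E (@cindependent k C) (@calgebraic k C) n0 tp.
  by apply: (const_case _ d); rewrite -pE.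
rewrite pE in tp.
have d0 : d != 0 by apply: contraNneq (topform_neq0 tp) => ->; rewrite scale0r.
(* The translation Y |-> Y + r turns d (Y - r)^(4 n) into d Y^(4 n), and the swap turns this into
   the constant d with the same n. *)
have [Psi [_ fibP]] := fibre_exists r%:P.
apply: (reduce _ Psi (Hfib _ _ fibP)).
have := topform_borel E (fibre_triangular fibP) tp.
rewrite expr1n !scale1r comp_polyZ rmorphXn /= comp_polyB comp_polyX comp_polyC addrK.
rewrite -[X in d *: X ^+ _]subr0 -(polyC0 k) => tp'.
apply: (reduce _ sw (Hsw _ swP)); apply: (const_case _ d).
have := topform_swap_power E swP d0 tp'.
by rewrite scale0r subr0 expr1n -[1]/(1%:P) -mul_polyC mulr1.
Qed.

End Reduction.

(** * Automorphisms preserving the fibration *)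

Section PolynomialLeading.
Variable M : fieldType.
Implicit Types (f g : {poly M}) (m : int) (c : M).

(** The degree is an integer only to fit [Ld_comb]; in negative degree the polynomial has to be
    0. *)
Definition plead f m c := if m is Posz n then (size f <= n.+1)%N /\ f`_n = c
  else f = 0 /\ c = 0.

Lemma plead0 m : plead 0 m 0.
Proof. by case: m => n; split; rewrite ?size_poly0 ?coef0. Qed.

Lemma pleadD f g m c d : plead f m c -> plead g m d -> plead (f + g) m (c + d).
Proof.
case: m => n [h1 h2] [h3 h4]; split; rewrite ?coefD ?h1 ?h2 ?h3 ?h4 ?addr0 //.
by rewrite (leq_trans (size_polyD _ _)) // geq_max h1.
Qed.

Lemma pleadM f g m m' c d : plead f m c -> plead g m' d -> plead (f * g) (m + m') (c * d).
Proof.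
have z0 l x y : x = 0 -> y = 0 -> plead x l y by move=> -> ->; exact: plead0.
case: m m' => n [] n' [h1 h2] [h3 h4]; try by apply: z0; rewrite ?h1 ?h2 ?h3 ?h4 ?mul0r ?mulr0.
rewrite -PoszD; split; last by rewrite coefM_top // h2 h4.
rewrite (leq_trans (size_polyMleq _ _)) //; move: h1 h3.
by move: (size f) (size g) => x y; lia.
Qed.

Lemma plead_low f m m' c : plead f m c -> m < m' -> plead f m' 0.
Proof.
case: m m' => n [] n' [h1 h2] //.
- rewrite ltz_nat => lt; split; first by rewrite (leq_trans h1) // ltnS ltnW.
  by rewrite nth_default // (leq_trans h1).
- by rewrite h1 => _; exact: plead0.
Qed.

Lemma plead_const c : plead c%:P 0 c.
Proof. by split; rewrite ?size_polyC_leq1 ?coefC. Qed.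

End PolynomialLeading.

Section FunctionDegree.
Variables (k M : fieldType) (eta : {rmorphism k -> M}).
Local Notation A := (OS0 k).
Local Notation gen := (gen k).
Implicit Types (f : A) (p P : {poly k}).

(** The leading term in Y, that is for the weights (0, 1), is P(u) Y^d. *)
Definition ytop f d P := exists n (c : nat -> {poly k}), [/\ forall i, (size (c i) <= (4 * i).+1)%N,
  f = comb n c, forall i l, (i <= n)%N -> (d < l)%N -> (c i)`_l = 0 &
  P = \poly_(i < n.+1) (c i)`_d].

Lemma ytop_exists f : f != 0 -> exists d P, ytop f d P /\ P != 0.
Proof.
move=> /comb_exists[n [c [tc ->]]]; have [sc _] := tc.
have [d dmax [i [l [il l4 nz e]]]] := comb_max 0 1 tc.
exists d, (\poly_(i < n.+1) (c i)`_d); split; last first.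
  apply/eqP => /(congr1 (fun p : {poly k} => p`_i)); rewrite coef_poly ltnS il coef0.
  by apply/eqP; move: e; rewrite mul0n mul1n add0n => <-.
exists n, c; split=> // i' l' h1 h2; apply/eqP; apply: contrapT => /negP nz'.
have l4' : (l' <= 4 * i')%N.
  by rewrite leqNgt; apply: contraNN nz' => lt; rewrite nth_default // (leq_trans (sc i')).
by have := dmax i' l' h1 l4' nz'; rewrite mul0n mul1n add0n leqNgt h2.
Qed.

Section Homomorphism.
Variables (h : {rmorphism A -> {poly M}}) (U : M) (V : {poly M}) (D : nat).
Hypotheses (h_const : forall c : k, h c%:A = (eta c)%:P) (U_neq0 : U != 0)
  (h0 : h (gen 0) = U%:P) (h1 : h (gen 1) = U%:P * V)
  (D_gt0 : (0 < D)%N) (sV : (size V <= D.+1)%N).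

Lemma horner_rho0 p : h (rho0 p) = ((map_poly eta p).[U])%:P.
Proof.
rewrite (rmorph_rho0 (eta := polyC \o eta)) // h0 -horner_map; congr (_.[_]).
by rewrite -map_poly_comp.
Qed.

Let unitU : U%:P \is a GRing.unit.
Proof. by rewrite poly_unitE size_polyC U_neq0 coefC /= unitfE. Qed.

Let UVlead n : plead (U%:P * V ^+ n) (D * n)%N%:Z (U * V`_D ^+ n).
Proof.
split; last by rewrite coefCM coefX_top.
by rewrite (leq_trans (size_polyMleq _ _)) // size_polyC U_neq0 /= size_exp_top.
Qed.

Lemma plead_gen l : (l <= 4)%N -> plead (h (gen l)) (0 + D * l)%N (U * V`_D ^+ l).
Proof.
have [h2 h3 h4] := rmorph_gen unitU h0 h1; rewrite add0n.
have low_ (x : {poly M}) m n : (m < n)%N -> plead x (D * m)%N%:Z 0 \/ (exists c, plead x (D * m)%N%:Z c) ->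
    plead x (D * n)%N%:Z 0.
  move=> mn [|[c]] => /plead_low; apply; by rewrite ltz_nat ltn_pmul2l.
have Vl n : exists c, plead (V ^+ n) (D * n)%N%:Z c.
  by exists (V ^+ n)`_(D * n); split=> //; exact: size_exp_top.
case: l => [|[|[|[|[|//]]]]] _.
- by rewrite h0 -[U%:P]mulr1 -[1](expr0 V); exact: UVlead.
- by rewrite h1 -{1}[V]expr1; exact: UVlead.
- by rewrite h2; exact: UVlead.
- rewrite h3 -[U * _]addr0; apply: pleadD; first exact: UVlead.
  have [c hc] := Vl 1%N; rewrite expr1 in hc.
  have := pleadM (plead_const (- 1)) hc; rewrite add0r polyCN mulN1r => h5.
  by apply: (low_ _ 1%N) => //; right; eexists; exact: h5.
- rewrite h4 -[U * _]addr0 -[U * _ as X in X + 0]addr0.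
  apply: pleadD; first apply: pleadD; first exact: UVlead.
    have [c hc] := Vl 2%N.
    have := pleadM (plead_const (- 2)) hc; rewrite add0r polyCN polyC_natr mulNr => h5.
    by apply: (low_ _ 2%N) => //; right; eexists; exact: h5.
  apply: (low_ _ 0%N) => //; right; exists U^-1; rewrite muln0.
  by have -> : (U%:P)^-1 = (U^-1)%:P; [rewrite polyCV|exact: plead_const].
Qed.

Lemma ytop_lead f d P : ytop f d P ->
  (size (h f) <= (D * d).+1)%N /\ (h f)`_(D * d) = (map_poly eta P).[U] * V`_D ^+ d.
Proof.
move=> [n [c [sc -> high ->]]].
have hW i l : (i <= n)%N -> (l <= 4 * i)%N -> (c i)`_l != 0 -> (0 * i + D * l <= D * d)%N.
  move=> h2 _; apply: contraNT; rewrite -ltnNge mul0n add0n ltn_pmul2l // => lt.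
  by rewrite high.
have := @Ld_comb k _ _ (@plead M) eta h (@plead0 M) (@pleadD M) (@pleadM M) _ (@plead_low M) _ _ _ _ plead_gen n c _ hW.
case.
  exact: (plead_const 1).
  by move=> x; rewrite h_const; exact: plead_const.
move=> s ->; split=> //; rewrite /comb_top (@horner_coef_wide _ n.+1); last first.
  by rewrite (leq_trans (size_poly _ _)) ?size_poly.
rewrite mulr_suml; apply: eq_bigr => i _; rewrite coef_map coef_poly ltn_ord /=.
have [lt|le] := ltnP d (4 * i).+1.
  rewrite (bigD1 (Ordinal lt)) //= mul0n add0n eqxx big1 ?addr0 => [|l ne].
    by rewrite (@mon_top_monomial _ _ U V`_D) ?mulrA.
  rewrite add0n eqn_pmul2l // ifF ?rmorph0 ?mul0r //.
  by apply: contraNF ne => /eqP e; apply/eqP/val_inj.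
have -> : (c i)`_d = 0 by rewrite nth_default // (leq_trans (sc i)).
rewrite rmorph0 !mul0r big1 // => l _.
rewrite mul0n add0n eqn_pmul2l // ltn_eqF ?rmorph0 ?mul0r //.
exact: leq_trans (ltn_ord l) le.
Qed.

End Homomorphism.

End FunctionDegree.

Section Fibration.
Variables (k : fieldType) (C : coordinateField k).
Local Notation M := (cfield C).
Local Notation eta := (@cemb k C).
Local Notation v := (cu C).
Local Notation A := (OS0 k).
Local Notation gen := (gen k).
Implicit Types (f : A) (p P : {poly k}) (Phi : AutS0 k).

Lemma transcendental_u p : (map_poly eta p).[v] = 0 -> p = 0.
Proof.
move=> pv; apply/polyP => i; rewrite coef0; have [lt|le] := ltnP i (size p); last first.
  by rewrite nth_default.
have := @cindependent k C (size p) (fun i => (p`_i)%:P) _ i lt.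
move=> /(_ _)/polyC_inj -> //; rewrite -[RHS]pv (@horner_coef_wide _ (size p)) ?size_poly //.
by apply: eq_bigr => l _; rewrite map_polyC hornerC coef_map mulrC.
Qed.

Lemma horner_u_inj p q : (map_poly eta p).[v] = (map_poly eta q).[v] -> p = q.
Proof.
move=> e; apply/eqP; rewrite -subr_eq0; apply/eqP/transcendental_u.
by rewrite rmorphB hornerD hornerN e subrr.
Qed.

Lemma v_neq0 : v != 0. Proof. exact: u_neq0 (@cindependent k C). Qed.

Let unitv : (v%:P : {poly M}) \is a GRing.unit.
Proof. by rewrite poly_unitE size_polyC v_neq0 coefC /= unitfE v_neq0. Qed.

(** Restriction to the generic fibre of rho_0: u is sent to a transcendental constant and Y to the
    variable. *)
Lemma ypoly_exists : exists h : {rmorphism A -> {poly M}},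
  [/\ forall c : k, h c%:A = (eta c)%:P, h (gen 0) = v%:P & h (gen 1) = v%:P * 'X].
Proof. exact: (point_exists (polyC \o eta) 'X unitv). Qed.

Definition ypoly : {rmorphism A -> {poly M}} := projT1 (cid ypoly_exists).

Lemma ypolyP : [/\ forall c : k, ypoly c%:A = (eta c)%:P, ypoly (gen 0) = v%:P
  & ypoly (gen 1) = v%:P * 'X].
Proof. exact: projT2 (cid ypoly_exists). Qed.

Lemma ypoly_rho0 p : ypoly (rho0 p) = ((map_poly eta p).[v])%:P.
Proof. by have [hc h0 _] := ypolyP; exact: horner_rho0. Qed.

Lemma ytop_ypoly f d P : ytop f d P -> P != 0 -> size (ypoly f) = d.+1.
Proof.
have [hc h0 h1] := ypolyP => tf P0.
have [|sz e] := @ytop_lead _ _ eta ypoly v 'X 1 hc v_neq0 h0 h1 isT _ _ _ _ tf.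
  by rewrite size_polyX.
rewrite mul1n coefX expr1n mulr1 in sz e.
apply/eqP; rewrite eqn_leq sz ltnNge; apply: contraNN P0 => le.
by rewrite -(transcendental_u (p := P)) // -e nth_default.
Qed.

(** The standard monomials of degree 0, 1, 2 in Y are powers of [gen 0] times 1, [gen 1] or [gen 2].
    Hence in such a function the constant term is a polynomial in u and the coefficients of Y and
    Y^2 are divisible by u. This condition along the fibre u = 0 drives the classification below. *)
Lemma low_degree f : (size (ypoly f) <= 3)%N ->
  exists P0 P1 P2, f = rho0 P0 + rho0 P1 * gen 1 + rho0 P2 * gen 2.
Proof.
move=> sf; have [->|f0] := eqVneq f 0.
  by exists 0, 0, 0; rewrite !rmorph0 !mul0r !addr0.
have [d [P [tf P0]]] := ytop_exists f0.
move: sf; rewrite (ytop_ypoly tf P0) !ltnS => d2.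
have [n [c [sc -> high _]]] := tf.
pose Q g := exists P0 P1 P2, g = rho0 P0 + rho0 P1 * gen 1 + rho0 P2 * gen 2.
have Q0 : Q 0 by exists 0, 0, 0; rewrite !rmorph0 !mul0r !addr0.
have QD a b : Q a -> Q b -> Q (a + b).
  move=> [a0 [a1 [a2 ->]]] [b0 [b1 [b2 ->]]]; exists (a0 + b0), (a1 + b1), (a2 + b2).
  by rewrite !rmorphD /= !mulrDl addrACA; congr (_ + _); rewrite addrACA.
apply: (big_ind Q) => // i _; apply: (big_ind Q) => // l _.
have [lt|le] := ltnP d l; first by rewrite high ?scale0r // -ltnS.
have l2 := leq_trans le d2; have l4 : (l <= 4 * i)%N by rewrite -ltnS.
move: {le} (l : nat) l2 l4 => {}l l2 l4; set a := (c i)`_l.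
move: l l2 l4 @a => [|[|[|//]]] _.
- by move=> _ a; exists (a *: 'X^i), 0, 0; rewrite mon0 rho0_monomial !rmorph0 !mul0r !addr0.
- case: (i : nat) => // i' _ a; exists 0, (a *: 'X^i'), 0.
  by rewrite rho0_monomial !rmorph0 mul0r addr0 add0r /= -scalerAl mulrC.
- case: (i : nat) => // i' _ a; exists 0, 0, (a *: 'X^i').
  by rewrite rho0_monomial !rmorph0 mul0r !add0r /= -scalerAl mulrC.
Qed.

Lemma ypoly_low P0 P1 P2 : ypoly (rho0 P0 + rho0 P1 * gen 1 + rho0 P2 * gen 2) =
  ((map_poly eta P0).[v])%:P + ((map_poly eta P1).[v] * v)%:P * 'X
   + ((map_poly eta P2).[v] * v)%:P * 'X^2.
Proof.
have [hc h0 h1] := ypolyP; have [h2 _ _] := rmorph_gen unitv h0 h1.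
by rewrite !rmorphD !rmorphM /= !ypoly_rho0 h1 h2 !mulrA -!polyCM.
Qed.

Lemma coef_quadratic (R : nzRingType) (a b c : R) : let q := a%:P + b%:P * 'X + c%:P * 'X^2 in
  [/\ q`_0 = a, q`_1 = b & q`_2 = c].
Proof.
by split; rewrite !coefD !coefCM coefX coefXn coefC /= ?mulr0 ?mulr1 ?addr0 ?add0r.
Qed.

End Fibration.

Section Classification.
Variables (k : fieldType) (C : coordinateField k).
Local Notation M := (cfield C).
Local Notation eta := (@cemb k C).
Local Notation v := (cu C).
Local Notation A := (OS0 k).
Local Notation gen := (gen k).
Local Notation ypoly := (ypoly C).
Local Notation v_neq0 := (v_neq0 C).
Implicit Types (f : A) (p P : {poly k}) (Phi : AutS0 k).

Let sq_coef (x y : M) : let q := (x%:P + y%:P * 'X) ^+ 2 in q`_0 = x ^+ 2 /\ q`_2 = y ^+ 2.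
Proof.
have [c0 _ c2] := @coef_quadratic M (x ^+ 2) (x * y *+ 2) (y ^+ 2).
have -> : (x%:P + y%:P * 'X) ^+ 2 = (x ^+ 2)%:P + (x * y *+ 2)%:P * 'X + (y ^+ 2)%:P * 'X^2.
  by rewrite sqrrD polyCMn !polyC_exp polyCM; ring.
by [].
Qed.

(** On generic fibres Phi is an isomorphism of affine lines, so it is affine in Y; the inverse makes
    its linear coefficient a unit of k[u], and regularity at u = 0 fixes the origin of the base. *)
Lemma fibration_affine Phi : AutS0_rho0 k Phi -> exists a b S, [/\ a != 0, b != 0,
  comorph Phi (gen 0) = a *: gen 0 & comorph Phi (gen 1) = b *: gen 1 + rho0 S * gen 0].
Proof.
move=> /AutS0_rho0P[p e0]; have [E] := degreeField_exists C.
have sp := comorph_rho0_linear E e0.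
have [yc y0 y1] := ypolyP C.
pose U := (map_poly eta p).[v].
have UE q : (map_poly eta q).[U] = (map_poly eta (q \Po p)).[v].
  by rewrite map_comp_poly horner_comp.
have U0 : U != 0.
  by apply/eqP => /transcendental_u z; rewrite z size_poly0 in sp.
pose h : {rmorphism A -> {poly M}} := ypoly \o comorph Phi.
have hE f : h f = ypoly (comorph Phi f) by [].
have hc (c : k) : h c%:A = (eta c)%:P by rewrite hE comorph_const yc.
have h0 : h (gen 0) = U%:P by rewrite hE e0 ypoly_rho0.
pose W := h (gen 1); pose V := U^-1 *: W.
have WE : W = U *: V by rewrite /V scalerA divff // scale1r.
have h1 : h (gen 1) = U%:P * V by rewrite mul_polyC -WE.
pose g := comorphV Phi (gen 1).
have hg : h g = v%:P * 'X by rewrite hE comorphVK.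
have sg : size (h g) = 2%N.
  by rewrite hg size_mulX ?polyC_eq0 ?v_neq0 // size_polyC v_neq0.
(* Otherwise the image of every function would be constant in Y, contrary to that of g, which is u
   Y. *)
have sV : (1 < size V)%N.
  rewrite ltnNge; apply/negP => /size1_polyC Vc.
  pose h2 : {rmorphism A -> {poly M}} := polyC \o (horner_eval 0 \o h).
  have h2E f : h2 f = ((h f).[0])%:P by [].
  have eh : h =1 h2.
    apply: eq_rmorphism_OS0 => [c|||].
    - by rewrite h2E hc hornerC.
    - by rewrite h2E h0 hornerC.
    - by rewrite h2E h1 Vc -polyCM hornerC.
    - by rewrite h0 polyC_eq0.
  by move: sg; rewrite eh h2E size_polyC; case: eqP.
pose D := (size V).-1.
have sVD : size V = D.+1 by rewrite prednK // ltnW.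
have D0 : (0 < D)%N by rewrite -ltnS -sVD.
have g0 : g != 0 by apply: contra_eq_neq sg => ->; rewrite rmorph0 size_poly0.
have [d [P [tg P0]]] := ytop_exists g0.
have [|sz eP] := ytop_lead hc U0 h0 h1 D0 _ tg; first by rewrite sVD.
have lt : (D * d < size (h g))%N.
  rewrite ltnNge; apply/negP => /(nth_default 0); rewrite eP => /eqP.
  rewrite mulf_eq0 expf_eq0 UE => /orP[/eqP/transcendental_u/eqP|/andP[_]].
    by rewrite comp_poly_eq0 ?sp // (negPf P0).
  by rewrite -[D]/((size V).-1) -lead_coefE lead_coef_eq0 -size_poly_eq0 sVD.
(* Degrees in Y multiply under composition, and the composite of Phi with its inverse has degree
   one. *)
have Dd : (D * d = 1)%N by apply/eqP; rewrite eqn_leq -ltnS -sg lt -ltnS -[2%N]sg.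
have /andP[/eqP D1 /eqP d1] : (D == 1%N) && (d == 1%N) by rewrite -muln_eq1 Dd.
have sW : size W = 2%N by rewrite WE size_scale // sVD D1.
have [P0' [P1 [P2 e1]]] : exists P0 P1 P2,
    comorph Phi (gen 1) = rho0 P0 + rho0 P1 * gen 1 + rho0 P2 * gen 2.
  by apply: (low_degree (C := C)); rewrite -hE -/W sW.
have [w0 w1 w2] := coef_quadratic ((map_poly eta P0').[v])
  ((map_poly eta P1).[v] * v) ((map_poly eta P2).[v] * v).
rewrite -ypoly_low -e1 -hE -/W in w0 w1 w2.
have {w2} P20 : P2 = 0.
  apply: (transcendental_u (C := C)); apply: (mulIf v_neq0).
  by rewrite mul0r -w2 nth_default ?sW.
have [G0 [G1 [G2 eg]]] : exists P0 P1 P2, g = rho0 P0 + rho0 P1 * gen 1 + rho0 P2 * gen 2.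
  by apply: (low_degree (C := C)); rewrite (ytop_ypoly C tg P0) d1.
have G20 : G2 = 0.
  apply: (transcendental_u (C := C)); apply: (mulIf v_neq0).
  have [_ _ c2] := coef_quadratic ((map_poly eta G0).[v])
    ((map_poly eta G1).[v] * v) ((map_poly eta G2).[v] * v).
  by rewrite mul0r -c2 -ypoly_low -eg nth_default // (ytop_ypoly C tg P0) d1.
have hD f1 f2 : h (f1 + f2) = h f1 + h f2 by rewrite rmorphD.
have hM f1 f2 : h (f1 * f2) = h f1 * h f2 by rewrite rmorphM.
have hr q : h (rho0 q) = ((map_poly eta (q \Po p)).[v])%:P.
  by rewrite -UE; exact: horner_rho0.
(* The coefficient of Y in [h g], which is u Y, is the product of the linear coefficients of Phi and
   of its inverse, times u. *)
have unit1 : (G1 \Po p) * P1 = 1.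
  apply: (horner_u_inj (C := C)); rewrite rmorph1 hornerC rmorphM hornerM.
  apply: (mulIf v_neq0); rewrite mul1r -mulrA -w1.
  have := congr1 (fun q : {poly M} => q`_1) hg.
  rewrite eg G20 rmorph0 mul0r addr0 hD hM !hr.
  by rewrite coefD !coefCM coefC coefX mulr1 add0r.
have [_ P1c] : is_const (G1 \Po p) /\ is_const P1.
  by apply: is_constM; rewrite unit1 ?oner_neq0 // /is_const size_poly1.
have P1E := size1_polyC P1c; set b := P1`_0 in P1E.
have b0 : b != 0.
  apply: contra_eq_neq unit1 => z; rewrite P1E z mulr0 eq_sym; exact: oner_neq0.
have WE2 : W = ((map_poly eta P0').[v])%:P + (eta b * v)%:P * 'X.
  by rewrite /W hE e1 ypoly_low P20 rmorph0 horner0 mul0r mul0r addr0 P1E map_polyC hornerC.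
(* The relation between [gen 0], [gen 1] and [gen 2], combined with [low_degree] for the image of
   [gen 2], shows that p divides b^2 u and P0'^2. So p has its zero at 0, and P0' vanishes there. *)
have rel : U *: h (gen 2) = W ^+ 2.
  have gm : gen 1 * gen 1 = gen 0 * gen 2 by rewrite gen_mul // /low addr0.
  by rewrite expr2 /W -hM gm hM h0 mul_polyC.
have [Q0 [Q1 [Q2 e2]]] : exists P0 P1 P2,
    comorph Phi (gen 2) = rho0 P0 + rho0 P1 * gen 1 + rho0 P2 * gen 2.
  apply: (low_degree (C := C)); rewrite -hE -(size_scale _ U0) rel expr2.
  by rewrite (leq_trans (size_polyMleq _ _)) // sW.
have [c0 _ c2] := coef_quadratic ((map_poly eta Q0).[v])
  ((map_poly eta Q1).[v] * v) ((map_poly eta Q2).[v] * v).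
rewrite -ypoly_low -e2 -hE in c0 c2.
have [r0 r2] := sq_coef ((map_poly eta P0').[v]) (eta b * v).
rewrite -WE2 -rel !coefZ c0 in r0; rewrite -WE2 -rel !coefZ c2 in r2.
have pQ0 : p * Q0 = P0' ^+ 2.
  by apply: (horner_u_inj (C := C)); rewrite rmorphM rmorphXn hornerM horner_exp.
have pQ2 : p * Q2 = (b ^+ 2) *: 'X.
  apply: (horner_u_inj (C := C)); apply: (mulIf v_neq0).
  rewrite rmorphM hornerM map_polyZ hornerZ map_polyX hornerX -mulrA r2.
  by rewrite exprMn rmorphXn -[RHS]mulrA.
have a0 : p`_1 != 0.
  by rewrite -[1%N]/(2.-1) -sp -lead_coefE lead_coef_eq0 -size_poly_gt0 sp.
have pE : p = p`_1 *: 'X + (p`_0)%:P.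
  apply/polyP => -[|[|i]]; rewrite coefD coefZ coefX coefC /= ?mulr0 ?add0r ?mulr1 ?addr0 //.
  by rewrite nth_default // sp.
have p00 : p`_0 = 0.
  have := congr1 (fun q : {poly k} => q.[- (p`_0 / p`_1)]) pQ2.
  rewrite hornerM {1}pE hornerD !hornerZ !hornerX hornerC mulrN mulrCA divff // mulr1.
  rewrite addNr mul0r => /esym/eqP; rewrite mulf_eq0 expf_eq0 (negPf b0) andbF /=.
  by rewrite oppr_eq0 mulf_eq0 invr_eq0 (negPf a0) orbF => /eqP.
rewrite p00 addr0 in pE.
have /factor_theorem[S SE] : root P0' 0.
  have := congr1 (fun q : {poly k} => q.[0]) pQ0.
  rewrite hornerM pE hornerZ hornerX mulr0 mul0r horner_exp => /esym/eqP.
  by rewrite expf_eq0.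
exists p`_1, b, S; split=> //.
  by rewrite e0 pE -['X]expr1 rho0_monomial expr1 coefZ coefX mulr1.
rewrite e1 P20 rmorph0 mul0r addr0 addrC P1E rho0C mulr_algl SE polyC0 subr0.
by rewrite rmorphM /= rho0X.
Qed.

(** The diagonal map has to keep z^2 / q0 = u Y^4 - 2 Y^2 + u^-1 regular. A multiple of [gen 4]
    cancels the term in Y^4, and [low_degree] then kills the multiples of u^-1 and of Y^2 that
    remain. *)
Lemma gen4_affine Phi (a b : k) : a != 0 -> comorph Phi (gen 0) = a *: gen 0 ->
  comorph Phi (gen 1) = b *: gen 1 -> b ^+ 2 = a.
Proof.
move=> a0 e0 e1; have [yc y0 y1] := ypolyP C.
pose h : {rmorphism A -> {poly M}} := ypoly \o comorph Phi.
have hE f : h f = ypoly (comorph Phi f) by [].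
have yZ c f : ypoly (c *: f) = (eta c)%:P * ypoly f.
  by rewrite -mulr_algl rmorphM /= yc.
have ea0 : eta a != 0 by rewrite fmorph_eq0.
have unitP (x : M) : x != 0 -> x%:P \is a GRing.unit.
  by move=> x0; rewrite poly_unitE size_polyC x0 coefC /= unitfE x0.
have av0 : eta a * v != 0 by rewrite mulf_neq0 // v_neq0.
pose e := b / a.
have h0 : h (gen 0) = (eta a * v)%:P by rewrite hE e0 yZ y0 polyCM.
have h1 : h (gen 1) = (eta a * v)%:P * ((eta e)%:P * 'X).
  rewrite hE e1 yZ y1 !mulrA -!polyCM; congr (_%:P * _).
  by rewrite mulrAC -rmorphM mulrCA divff // mulr1.
have [_ _ h4] := rmorph_gen (unitP _ av0) h0 h1.
have [_ _ y4] := rmorph_gen (unitP _ v_neq0) y0 y1.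
pose f := comorph Phi (gen 4) - (a * e ^+ 4) *: gen 4.
pose l2 := 2 * (a * e ^+ 4 - e ^+ 2); pose l0 := a^-1 - a * e ^+ 4.
have fE : ypoly f = (eta l0 / v)%:P + 0%:P * 'X + (eta l2)%:P * 'X^2.
  have wl1 : (eta (a * e ^+ 4))%:P = (eta a)%:P * (eta e)%:P ^+ 4.
    by rewrite rmorphM rmorphXn polyCM polyC_exp.
  have wl0 : (eta l0)%:P = ((eta a)^-1)%:P - (eta a)%:P * (eta e)%:P ^+ 4.
    by rewrite /l0 rmorphB polyCB wl1 fmorphV.
  have wl2 : (eta l2)%:P = 2 * ((eta a)%:P * (eta e)%:P ^+ 4 - (eta e)%:P ^+ 2).
    by rewrite /l2 rmorphM rmorph_nat polyCM polyC_natr rmorphB polyCB wl1 rmorphXn polyC_exp.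
  have -> : ypoly f = h (gen 4) - (eta (a * e ^+ 4))%:P * ypoly (gen 4).
    by rewrite -yZ hE -rmorphB.
  rewrite h4 y4 (polyCM (eta l0)) wl0 wl1 wl2 mul0r addr0.
  have -> : (eta a * v)%:P^-1 = ((eta a)^-1)%:P * (v^-1)%:P.
    by rewrite -polyCM -invfM polyCV.
  rewrite (polyCM (eta a) v) (polyCV v).
  move: (v%:P) ((v^-1)%:P) ((eta a)^-1)%:P (eta a)%:P (eta e)%:P => x x' a' y z; ring.
have [|Q0 [Q1 [Q2 ef]]] := @low_degree k C f.
  rewrite fE mul0r addr0 (leq_trans (size_polyD _ _)) // geq_max.
  rewrite (leq_trans (size_polyC_leq1 _)) //= (leq_trans (size_polyMleq _ _)) //.
  by rewrite size_polyXn; have := size_polyC_leq1 (eta l2); case: (size _) => [|[|]].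
have [c0 _ c2] := coef_quadratic ((map_poly eta Q0).[v])
  ((map_poly eta Q1).[v] * v) ((map_poly eta Q2).[v] * v).
have [d0 _ d2] := coef_quadratic (eta l0 / v) 0 (eta l2).
rewrite -ypoly_low -ef fE d0 in c0; rewrite -ypoly_low -ef fE d2 in c2.
have l00 : l0 = 0.
  have /(congr1 (fun q : {poly k} => q.[0])) : l0%:P = Q0 * 'X.
    apply: (horner_u_inj (C := C)); rewrite map_polyC hornerC rmorphM /= map_polyX hornerM hornerX.
    by rewrite -c0 divfK // v_neq0.
  by rewrite hornerC hornerM hornerX mulr0.
have l20 : l2 = 0.
  have /(congr1 (fun q : {poly k} => q.[0])) : l2%:P = Q2 * 'X.
    by apply: (horner_u_inj (C := C)); rewrite map_polyC hornerC rmorphM /= map_polyX hornerM hornerX.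
  by rewrite hornerC hornerM hornerX mulr0.
have bE : b = a * e by rewrite /e mulrCA divff // mulr1.
have e4 : a ^+ 2 * e ^+ 4 = 1.
  have : a * l0 = 0 by rewrite l00 mulr0.
  by rewrite /l0 mulrBr divff // mulrA -expr2 => /subr0_eq.
(* The term in u^-1 gives (a e^2)^2 = 1, and the one in Y^2 gives 2 (a e^2 - 1) = 0, which is void
   in characteristic 2. Together they make a e^2 - 1 square to 0 in every characteristic. *)
have e2 : (a * e ^+ 2 - 1) ^+ 2 = 0 \/ a * e ^+ 2 = 1.
  have sq : (a * e ^+ 2 - 1) * (a * e ^+ 2 + 1) = 0.
    have -> : (a * e ^+ 2 - 1) * (a * e ^+ 2 + 1) = a ^+ 2 * e ^+ 4 - 1 by ring.
    by rewrite e4 subrr.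
  have tw : 2 * (a * e ^+ 2 - 1) = 0.
    have e0' : e ^+ 2 != 0.
      rewrite expf_neq0 //; apply: contra_eq_neq e4 => ->.
      by rewrite expr0n mulr0 eq_sym oner_eq0.
    apply: (mulIf e0'); rewrite mul0r -l20 /l2; ring.
  left; have -> : (a * e ^+ 2 - 1) ^+ 2
      = (a * e ^+ 2 - 1) * (a * e ^+ 2 + 1) - 2 * (a * e ^+ 2 - 1) by ring.
  by rewrite sq tw subr0.
have {}e2 : a * e ^+ 2 = 1.
  by case: e2 => // /eqP; rewrite expf_eq0 subr_eq0 => /eqP.
by rewrite bE exprMn expr2 -mulrA e2 mulr1.
Qed.

End Classification.

Section FibrationGroup.
Variable k : fieldType.
Local Notation gen := (gen k).

(** A fibred letter removes the translation part S; the diagonal map that is left is a torus element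
    by [gen4_affine]. *)
Lemma AutS0_rho0_torus_fibre (Phi : AutS0 k) : AutS0_rho0 k Phi ->
  exists s b Tor Fib, [/\ b != 0, is_torus b Tor, is_fibre s Fib & Phi = (Tor * Fib)%g].
Proof.
move=> hPhi; have [C] := coordinateField_exists k.
have [a [b [S [a0 b0 e0 e1]]]] := fibration_affine C hPhi.
have [Fib [_ fib]] := fibre_exists (- b^-1 *: S); have [f0 f1] := fib.
have e0' : comorph (Phi * Fib)%g (gen 0) = a *: gen 0 by rewrite comorphM e0 comorphZ f0.
have e1' : comorph (Phi * Fib)%g (gen 1) = b *: gen 1.
  rewrite comorphM e1 (rmorphD (comorph Fib)) /= (comorphZ Fib).
  rewrite (rmorphM (comorph Fib) (rho0 S)) /= f0 f1 comorph_rho0 //.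
  have -> : rho0 (- b^-1 *: S) = - b^-1 *: rho0 S.
    by rewrite -mul_polyC rmorphM /= rho0C mulr_algl.
  by rewrite scalerDr -scalerAl scalerA mulrN divff // scaleN1r subrK.
have ba := gen4_affine C a0 e0' e1'.
exists (- (- b^-1 *: S)), b, (Phi * Fib)%g, Fib^-1%g; split=> //.
- by split; rewrite ?ba.
- exact: is_fibreV.
by rewrite mulgK.
Qed.

End FibrationGroup.

(** * Automorphisms of the conic *)

Section Matrices3.
Variable R : nzRingType.
Local Notation o0 := (@Ordinal 3 0 isT).
Local Notation o1 := (@Ordinal 3 1 isT).
Local Notation o2 := (@Ordinal 3 2 isT).

Definition mx3 (a b c d e f g h i : R) : 'M[R]_3 :=
  \matrix_(r, s) nth 0 (nth [::] [:: [:: a; b; c]; [:: d; e; f]; [:: g; h; i]] r) s.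

Lemma mx3_eta (M : 'M[R]_3) : M = mx3 (M o0 o0) (M o0 o1) (M o0 o2) (M o1 o0) (M o1 o1)
  (M o1 o2) (M o2 o0) (M o2 o1) (M o2 o2).
Proof. by apply/matrixP => i j; rewrite mxE; move: i j; do 2!apply: ord3P. Qed.

Lemma sum3 (V : nmodType) (F : 'I_3 -> V) : \sum_i F i = F o0 + F o1 + F o2.
Proof.
rewrite !big_ord_recl big_ord0 addr0 addrA.
by congr (_ + _ + _); congr F; apply: val_inj.
Qed.

Lemma mx3M a b c d e f g h i a' b' c' d' e' f' g' h' i' :
  mx3 a b c d e f g h i *m mx3 a' b' c' d' e' f' g' h' i' =
  mx3 (a * a' + b * d' + c * g') (a * b' + b * e' + c * h') (a * c' + b * f' + c * i')
      (d * a' + e * d' + f * g') (d * b' + e * e' + f * h') (d * c' + e * f' + f * i')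
      (g * a' + h * d' + i * g') (g * b' + h * e' + i * h') (g * c' + h * f' + i * i').
Proof. by apply/matrixP => r s; rewrite !mxE sum3 !mxE; move: r s; do 2!apply: ord3P. Qed.

Lemma eq_mx3 a b c d e f g h i a' b' c' d' e' f' g' h' i' :
  a = a' -> b = b' -> c = c' -> d = d' -> e = e' -> f = f' -> g = g' -> h = h' -> i = i' ->
  mx3 a b c d e f g h i = mx3 a' b' c' d' e' f' g' h' i'.
Proof. by do 9!move=> ->. Qed.

Lemma mx31 : 1%:M = mx3 1 0 0 0 1 0 0 0 1.
Proof. by apply/matrixP => r s; rewrite !mxE; move: r s; do 2!apply: ord3P. Qed.

Lemma mx3Z x a b c d e f g h i : x *: mx3 a b c d e f g h i =
  mx3 (x * a) (x * b) (x * c) (x * d) (x * e) (x * f) (x * g) (x * h) (x * i).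
Proof. by apply/matrixP => r s; rewrite !mxE; move: r s; do 2!apply: ord3P. Qed.

End Matrices3.

Section Conic.
Variable k : fieldType.
Local Notation o0 := (@Ordinal 3 0 isT).
Local Notation o1 := (@Ordinal 3 1 isT).
Local Notation o2 := (@Ordinal 3 2 isT).
Local Notation P := {mpoly k[3]}.
Implicit Types (M N : 'M[k]_3) (a b c : k).

Definition unip b : 'M[k]_3 := mx3 1 0 0 b 1 0 (- b ^+ 2) (- (2 * b)) 1.
Definition torus a : 'M[k]_3 := mx3 a 0 0 0 1 0 0 0 a^-1.
Definition weyl : 'M[k]_3 := mx3 0 0 1 0 (- 1) 0 1 0 0.

Lemma unipK b : unip (- b) *m unip b = 1%:M.
Proof. by rewrite mx3M mx31; apply: eq_mx3; ring. Qed.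

Lemma weylK : weyl *m weyl = 1%:M.
Proof. by rewrite mx3M mx31; apply: eq_mx3; ring. Qed.

Lemma torusK a : a != 0 -> torus a^-1 *m torus a = 1%:M.
Proof. move=> a0; rewrite mx3M mx31; apply: eq_mx3;
  by rewrite ?(mul0r, mulr0, addr0, add0r, mulr1) ?mulVf ?invr_eq0. Qed.

(* The six coefficients of (M_0 v) (M_2 v) + (M_1 v)^2 = c (v_0 v_2 + v_1^2). *)
Definition conformal c M :=
  [/\ M o0 o0 * M o2 o0 + M o1 o0 ^+ 2 = 0, M o0 o1 * M o2 o1 + M o1 o1 ^+ 2 = c,
      M o0 o2 * M o2 o2 + M o1 o2 ^+ 2 = 0
    & [/\ M o0 o0 * M o2 o1 + M o0 o1 * M o2 o0 + 2 * M o1 o0 * M o1 o1 = 0,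
      M o0 o0 * M o2 o2 + M o0 o2 * M o2 o0 + 2 * M o1 o0 * M o1 o2 = c
    & M o0 o1 * M o2 o2 + M o0 o2 * M o2 o1 + 2 * M o1 o1 * M o1 o2 = 0]].

Lemma conformalE c x0 x1 x2 y0 y1 y2 z0 z1 z2 : conformal c (mx3 x0 x1 x2 y0 y1 y2 z0 z1 z2) =
  [/\ x0 * z0 + y0 ^+ 2 = 0, x1 * z1 + y1 ^+ 2 = c, x2 * z2 + y2 ^+ 2 = 0
    & [/\ x0 * z1 + x1 * z0 + 2 * y0 * y1 = 0, x0 * z2 + x2 * z0 + 2 * y0 * y2 = c
        & x1 * z2 + x2 * z1 + 2 * y1 * y2 = 0]].
Proof. by rewrite /conformal !mxE. Qed.

Lemma conformal_unip b c M : conformal c M -> conformal c (unip b *m M).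
Proof.
rewrite [M]mx3_eta mx3M !conformalE => -[h1 h2 h3 [h4 h5 h6]].
by split; [apply: etrans h1|apply: etrans h2|apply: etrans h3|
  split; [apply: etrans h4|apply: etrans h5|apply: etrans h6]]; ring.
Qed.

Lemma conformal_weyl c M : conformal c M -> conformal c (weyl *m M).
Proof.
rewrite [M]mx3_eta mx3M !conformalE => -[h1 h2 h3 [h4 h5 h6]].
by split; [apply: etrans h1|apply: etrans h2|apply: etrans h3|
  split; [apply: etrans h4|apply: etrans h5|apply: etrans h6]]; ring.
Qed.

Lemma tnth_lin_forms (M : GLmx k 3) i :
  tnth (lin_forms M) i = M i o0 *: px k + M i o1 *: py k + M i o2 *: pz k.
Proof. by rewrite tnth_mktuple sum3. Qed.

Lemma q0_lin_forms (M : GLmx k 3) : q0 k \mPo lin_forms M =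
  tnth (lin_forms M) o0 * tnth (lin_forms M) o2 + tnth (lin_forms M) o1 ^+ 2.
Proof. by rewrite /q0 rmorphD rmorphM rmorphXn /= !comp_mpolyXU -!tnth_nth. Qed.

Lemma conformalP c (M : GLmx k 3) : q0 k \mPo lin_forms M = c *: q0 k <-> conformal c M.
Proof.
rewrite q0_lin_forms !tnth_lin_forms; split=> [e|[h1 h2 h3 [h4 h5 h6]]].
  (* The values at three basis vectors and at their three sums of two determine a quadratic form
     over any field, including the field with two elements. *)
  have ev x y z : let v := fun i : 'I_3 => nth 0 [:: x; y; z] i in
      let r (i : 'I_3) := M i o0 * x + M i o1 * y + M i o2 * z in
      r o0 * r o2 + r o1 ^+ 2 = c * (x * z + y ^+ 2).
    move=> v r; have := congr1 (meval v) e.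
    rewrite /q0 !(mevalD, mevalM, mevalZ, expr2, mevalXU) /v /r /= => <-.
    by [].
  have e100 : M o0 o0 * M o2 o0 + M o1 o0 ^+ 2 = 0.
    by apply: etrans (etrans _ (ev 1 0 0)) _ => /=; ring.
  have e010 : M o0 o1 * M o2 o1 + M o1 o1 ^+ 2 = c.
    by apply: etrans (etrans _ (ev 0 1 0)) _ => /=; ring.
  have e001 : M o0 o2 * M o2 o2 + M o1 o2 ^+ 2 = 0.
    by apply: etrans (etrans _ (ev 0 0 1)) _ => /=; ring.
  have e110 : (M o0 o0 + M o0 o1) * (M o2 o0 + M o2 o1) + (M o1 o0 + M o1 o1) ^+ 2 = c.
    by apply: etrans (etrans _ (ev 1 1 0)) _ => /=; ring.
  have e101 : (M o0 o0 + M o0 o2) * (M o2 o0 + M o2 o2) + (M o1 o0 + M o1 o2) ^+ 2 = c.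
    by apply: etrans (etrans _ (ev 1 0 1)) _ => /=; ring.
  have e011 : (M o0 o1 + M o0 o2) * (M o2 o1 + M o2 o2) + (M o1 o1 + M o1 o2) ^+ 2 = c.
    by apply: etrans (etrans _ (ev 0 1 1)) _ => /=; ring.
  split=> //; split.
  - have -> : M o0 o0 * M o2 o1 + M o0 o1 * M o2 o0 + 2 * M o1 o0 * M o1 o1 =
      ((M o0 o0 + M o0 o1) * (M o2 o0 + M o2 o1) + (M o1 o0 + M o1 o1) ^+ 2)
      - (M o0 o0 * M o2 o0 + M o1 o0 ^+ 2) - (M o0 o1 * M o2 o1 + M o1 o1 ^+ 2) by ring.
    by rewrite e110 e100 e010; ring.
  - have -> : M o0 o0 * M o2 o2 + M o0 o2 * M o2 o0 + 2 * M o1 o0 * M o1 o2 =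
      ((M o0 o0 + M o0 o2) * (M o2 o0 + M o2 o2) + (M o1 o0 + M o1 o2) ^+ 2)
      - (M o0 o0 * M o2 o0 + M o1 o0 ^+ 2) - (M o0 o2 * M o2 o2 + M o1 o2 ^+ 2) by ring.
    by rewrite e101 e100 e001; ring.
  - have -> : M o0 o1 * M o2 o2 + M o0 o2 * M o2 o1 + 2 * M o1 o1 * M o1 o2 =
      ((M o0 o1 + M o0 o2) * (M o2 o1 + M o2 o2) + (M o1 o1 + M o1 o2) ^+ 2)
      - (M o0 o1 * M o2 o1 + M o1 o1 ^+ 2) - (M o0 o2 * M o2 o2 + M o1 o2 ^+ 2) by ring.
    by rewrite e011 e010 e001; ring.
have C0 (x : k) : x%:MP = x *: (1 : P) by rewrite -mul_mpolyC mulr1.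
rewrite -!mul_mpolyC /q0.
pose m i l : P := (M i l)%:MP; rewrite -!/(m _ _).
have mE : [/\ m o0 o0 * m o2 o0 + m o1 o0 ^+ 2 = 0, m o0 o1 * m o2 o1 + m o1 o1 ^+ 2 = c%:MP,
      m o0 o2 * m o2 o2 + m o1 o2 ^+ 2 = 0
    & [/\ m o0 o0 * m o2 o1 + m o0 o1 * m o2 o0 + 2 * m o1 o0 * m o1 o1 = 0,
      m o0 o0 * m o2 o2 + m o0 o2 * m o2 o0 + 2 * m o1 o0 * m o1 o2 = c%:MP
    & m o0 o1 * m o2 o2 + m o0 o2 * m o2 o1 + 2 * m o1 o1 * m o1 o2 = 0]].
  have two : (2 : P) = (2 : k)%:MP by rewrite mpolyC_nat.
  by rewrite /m two; split; last split; rewrite -?mpolyCM -?rmorphXn -!mpolyCD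
     ?h1 ?h2 ?h3 ?h4 ?h5 ?h6 ?mpolyC0.
move: mE => [m1 m2 m3 [m4 m5 m6]].
move: (px k) (py k) (pz k) => x y z.
transitivity ((m o0 o0 * m o2 o0 + m o1 o0 ^+ 2) * x ^+ 2
  + (m o0 o1 * m o2 o1 + m o1 o1 ^+ 2) * y ^+ 2 + (m o0 o2 * m o2 o2 + m o1 o2 ^+ 2) * z ^+ 2
  + (m o0 o0 * m o2 o1 + m o0 o1 * m o2 o0 + 2 * m o1 o0 * m o1 o1) * (x * y)
  + (m o0 o0 * m o2 o2 + m o0 o2 * m o2 o0 + 2 * m o1 o0 * m o1 o2) * (x * z)
  + (m o0 o1 * m o2 o2 + m o0 o2 * m o2 o1 + 2 * m o1 o1 * m o1 o2) * (y * z)).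
  by move: (m o0 o0) (m o0 o1) (m o0 o2) (m o1 o0) (m o1 o1) (m o1 o2) (m o2 o0)
    (m o2 o1) (m o2 o2) => ? ? ? ? ? ? ? ? ?; ring.
by rewrite m1 m2 m3 m4 m5 m6; move: (c%:MP) => ?; ring.
Qed.

(** The two zero entries say that M fixes p_0. The remaining equations then determine M from x0, y0
    and y1, invertibility making the diagonal nonzero. *)
Lemma borel_form c (M : GLmx k 3) : conformal c M -> M o0 o2 = 0 -> M o1 o2 = 0 ->
  c != 0 /\ exists a b y, [/\ a != 0, y != 0 & GLmx_val M = y *: (torus a *m unip b)].
Proof.
case: M => M Mu /=; move: Mu; rewrite [M]mx3_eta.
move: (M o0 o0) (M o0 o1) (M o0 o2) (M o1 o0) (M o1 o1) (M o1 o2) (M o2 o0) (M o2 o1) (M o2 o2).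
move=> x0 x1 x2 y0 y1 y2 z0 z1 z2; rewrite conformalE !mxE /=.
move=> Mu [h1 h2 h3 [h4 h5 h6]] x20 y20; rewrite {}x20 {}y20 in Mu h3 h5 h6 *.
have z20 : z2 != 0.
  apply: contraTneq Mu => z; rewrite unitmxE z; suff -> : \det (mx3 x0 x1 0 y0 y1 0 z0 z1 0) = 0.
    by rewrite unitr0.
  rewrite (expand_det_col _ o2) big1 // => i _; rewrite mxE.
  by move: i; apply: ord3P; rewrite /= mul0r.
have x10 : x1 = 0.
  by move/eqP: h6; rewrite mulr0 addr0 mul0r addr0 mulf_eq0 (negPf z20) orbF => /eqP.
rewrite {}x10 in Mu h2 h4 h6 *; rewrite !(mul0r, mulr0, addr0, add0r) in h2 h4 h5.
have c0 : c != 0.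
  apply: contraTneq Mu => cz; rewrite unitmxE; suff -> : \det (mx3 x0 0 0 y0 y1 0 z0 z1 z2) = 0.
    by rewrite unitr0.
  have y10 : y1 = 0 by apply/eqP; rewrite -sqrf_eq0 h2 cz.
  have x00 : x0 = 0.
    by move/eqP: h5; rewrite cz mulf_eq0 (negPf z20) orbF => /eqP.
  rewrite (expand_det_row _ o0) big1 // => i _; rewrite mxE.
  by move: i; apply: ord3P; rewrite /= ?x00 mul0r.
have y10 : y1 != 0 by rewrite -sqrf_eq0 h2.
have x00 : x0 != 0 by apply: contra_neq c0 => z; rewrite -h5 z mul0r.
have z2E : z2 = y1 ^+ 2 / x0 by rewrite h2 -h5 mulrC mulKf.
have z1E : z1 = - (2 * y0 * y1) / x0.
  by apply: (mulfI x00); rewrite [RHS]mulrC divfK //; apply/eqP; rewrite -addr_eq0 h4.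
have z0E : z0 = - y0 ^+ 2 / x0.
  by apply: (mulfI x00); rewrite [RHS]mulrC divfK //; apply/eqP; rewrite -addr_eq0 h1.
split=> //; exists (x0 / y1), (y0 / y1), y1; split=> //; first by rewrite mulf_neq0 ?invr_eq0.
rewrite mx3M mx3Z z2E z1E z0E; clear - x00 y10.
by apply: eq_mx3; field; rewrite ?x00 ?y10.
Qed.

(** The last column of M is the image of p_0, a point of the conic. If x2 = 0 it is p_0; otherwise a
    unipotent map brings it to [1 : 0 : 0], which the swap exchanges with p_0. *)
Lemma bruhat c (M : GLmx k 3) : conformal c M ->
  (M o0 o2 = 0 /\ M o1 o2 = 0) \/
  exists b, let N := weyl *m (unip b *m M) in N o0 o2 = 0 /\ N o1 o2 = 0.
Proof.
case: M => M Mu /=; rewrite [M]mx3_eta.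
move: (M o0 o0) (M o0 o1) (M o0 o2) (M o1 o0) (M o1 o1) (M o1 o2) (M o2 o0) (M o2 o1) (M o2 o2).
move=> x0 x1 x2 y0 y1 y2 z0 z1 z2; rewrite conformalE !mxE /= => -[_ _ h3 _].
have [x20|x20] := eqVneq x2 0.
  left; split=> //; move: h3; rewrite x20 mul0r add0r => /eqP.
  by rewrite sqrf_eq0 => /eqP.
right; exists (- (y2 / x2)); rewrite !mx3M !mxE /=; split.
  have z2E : z2 = - y2 ^+ 2 / x2.
    by apply: (mulfI x20); rewrite [RHS]mulrC divfK //; apply/eqP; rewrite -addr_eq0 h3.
  by rewrite z2E; field.
by field.
Qed.

(** The action on the plane induced by the parametrization [s : t] |-> [s^2 : s t : - t^2] of the
    conic. *)
Definition sym2 (g : 'M[k]_2) : 'M[k]_3 :=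
  let p := g ord0 ord0 in let q := g ord0 ord_max in
  let r := g ord_max ord0 in let v := g ord_max ord_max in
  mx3 (p ^+ 2) (2 * p * q) (- q ^+ 2) (p * r) (p * v + q * r) (- (q * v))
      (- r ^+ 2) (- (2 * r * v)) (v ^+ 2).

Lemma sym2M g h : sym2 (g *m h) = sym2 g *m sym2 h.
Proof.
have sum2 (F : 'I_2 -> k) : \sum_i F i = F ord0 + F ord_max.
  by rewrite !big_ord_recl big_ord0 addr0; congr (_ + F _); apply: val_inj.
rewrite /sym2 mx3M !mxE !sum2.
move: (g ord0 ord0) (g ord0 ord_max) (g ord_max ord0) (g ord_max ord_max).
move: (h ord0 ord0) (h ord0 ord_max) (h ord_max ord0) (h ord_max ord_max).
by move=> p q r v p' q' r' v'; apply: eq_mx3; ring.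
Qed.

Lemma sym21 : sym2 1%:M = 1%:M.
Proof. by rewrite /sym2 !mxE /= mx31; apply: eq_mx3; ring. Qed.

Lemma sym2Z c g : sym2 (c *: g) = c ^+ 2 *: sym2 g.
Proof. by rewrite /sym2 mx3Z !mxE; apply: eq_mx3; ring. Qed.

Lemma sym2_unit g : g \in unitmx -> sym2 g \in unitmx.
Proof.
by move=> gu; have /mulmx1_unit[] : sym2 g *m sym2 (invmx g) = 1%:M
  by rewrite -sym2M mulmxV // sym21.
Qed.

Definition sym2_GL (g : GLmx k 2) : GLmx k 3 := MkGLmx (sym2_unit (GLmx_unit g)).

Lemma sym2_conformal g : exists c, conformal c (sym2 g).
Proof.
exists ((g ord0 ord0 * g ord_max ord_max - g ord0 ord_max * g ord_max ord0) ^+ 2).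
by rewrite conformalE; split; last split; ring.
Qed.

Definition sym2_PGL (g : PGL k 2) : PGL k 3 := PGL_class (sym2_GL (PGL_repr g)).

Lemma sym2_class g : sym2_PGL (PGL_class g) = PGL_class (sym2_GL g).
Proof.
have [c c0 e] := PGL_repr_class g; apply/eqP/PGL_classP; exists (c ^+ 2).
  by rewrite expf_neq0.
by rewrite /= e sym2Z.
Qed.

Lemma sym2_PGLM : {morph sym2_PGL : g h / (g * h)%g >-> (g * h)%g}.
Proof.
move=> g h; rewrite -(PGL_reprK g) -(PGL_reprK h).
rewrite -[(PGL_class _ * PGL_class _)%g]/(PGL_mul _ _) PGL_classM !sym2_class.
rewrite -[RHS]/(PGL_mul _ _) PGL_classM; congr PGL_class; apply: val_inj => /=.
exact: sym2M.
Qed.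

Lemma sym2_PGL_inj : injective sym2_PGL.
Proof.
have f1 : sym2_PGL 1%g = 1%g.
  by apply: (mulgI (sym2_PGL 1%g)); rewrite -sym2_PGLM !mulg1.
have ker g : sym2_PGL g = 1%g -> g = 1%g.
  rewrite -(PGL_reprK g) sym2_class; move: (PGL_repr g) => [m mu] /eqP/PGL_classP[c c0 e].
  apply/eqP/PGL_classP; move: e; rewrite /= mx31 mx3Z /sym2.
  set p := m ord0 ord0; set q := m ord0 ord_max; set r := m ord_max ord0; set v := m ord_max ord_max.
  move=> /matrixP e; have := e o0 o0; have := e o0 o2; have := e o2 o0; have := e o2 o2.
  have := e o1 o1; rewrite !mxE /= !mulr1 !mulr0 => e11 e22 e20 e02 e00.
  have q0' : q = 0 by apply/eqP; rewrite -sqrf_eq0 -oppr_eq0 e02.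
  have r0' : r = 0 by apply/eqP; rewrite -sqrf_eq0 -oppr_eq0 e20.
  have p0' : p != 0 by rewrite -sqrf_eq0 e00.
  (* The middle entry gives p v = p^2; the corner entries alone would leave a sign undetermined. *)
  have vp : v = p.
    by move: e11; rewrite q0' mul0r addr0 -e00 expr2 => /(mulfI p0').
  exists p => //; apply/matrixP => i l; rewrite !mxE.
  have two (i' : 'I_2) : i' = ord0 \/ i' = ord_max.
    by case: i' => [[|[|//]] lt]; [left|right]; apply: val_inj.
  by case: (two i) => ->; case: (two l) => ->; rewrite ?mulr1 ?mulr0 -?/p -?/q -?/r -?/v.
move=> g h e; suff /ker eg : sym2_PGL (g * h^-1)%g = 1%g.
  by apply: (mulIg h^-1%g); rewrite mulgV.
apply: (mulIg (sym2_PGL h)); rewrite -sym2_PGLM -mulgA mulVg mulg1 mul1g //.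
Qed.

End Conic.

(** * Restriction of automorphisms of the conic to its complement *)

Section LinearRestrictions.
Variable k : fieldType.
Local Notation "f %:F" := (@FracField.tofrac _ f).
Local Notation P := {mpoly k[3]}.
Local Notation K := {fraction {mpoly k[3]}}.
Local Notation A := (OS0 k).
Local Notation gen := (gen k).
Local Notation q0 := (q0 k).
Local Notation o0 := (@Ordinal 3 0 isT).
Local Notation o1 := (@Ordinal 3 1 isT).
Local Notation o2 := (@Ordinal 3 2 isT).
Local Notation tof F := [tuple of map (@FracField.tofrac P) F].
Local Notation linF M := (tof (lin_forms M)).
Implicit Types (M N : GLmx k 3) (p : P) (Psi Phi : AutS0 k).

Lemma rmorph_mmap (R : comNzRingType) (h : {rmorphism P -> R}) p :
  h p = mmap (fun c => h c%:MP) (fun i => h 'X_i) p.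
Proof.
rewrite {1}[p]mpolyE rmorph_sum; apply: eq_bigr => m _.
rewrite -mul_mpolyC rmorphM /=; congr (_ * _).
by rewrite mpolyXE_id rmorph_prod; apply: eq_bigr => i _; rewrite rmorphXn.
Qed.

Lemma mmap_homog (R : comNzRingType) (f : k -> R) (X : 'I_3 -> R) y d p : p \is d.-homog ->
  mmap f (fun i => y * X i) p = y ^+ d * mmap f X p.
Proof.
move/dhomogP => hp; rewrite /mmap mulr_sumr; apply: eq_big_seq => m /hp md.
have {}md : mdeg m = d := md.
rewrite mulrCA; congr (_ * _); rewrite /mmap1 -{}md mdegE.
rewrite (big_morph (fun d => y ^+ d) (exprD y) (expr0 y)) -big_split.
by apply: eq_bigr => i _; rewrite exprMn.
Qed.

Lemma subst_linF M p : subst_rat (linF M) p = (p \mPo lin_forms M)%:F.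
Proof.
pose h : {rmorphism P -> K} := @FracField.tofrac P \o comp_mpoly (lin_forms M).
have hE r : h r = (r \mPo lin_forms M)%:F by [].
rewrite -hE rmorph_mmap /subst_rat; apply: eq_bigr => m _.
congr (_ * _); first by rewrite hE comp_mpolyC.
by apply: eq_bigr => i _; rewrite hE comp_mpolyXU -tnth_nth tnth_map.
Qed.

Lemma comp_lin_forms M N p :
  (p \mPo lin_forms M) \mPo lin_forms N = p \mPo lin_forms (M * N)%g.
Proof.
have [h hE] : exists h : {rmorphism P -> P},
    forall r, h r = (r \mPo lin_forms M) \mPo lin_forms N.
  by exists (comp_mpoly (lin_forms N) \o comp_mpoly (lin_forms M)).
have [h' h'E] : exists h : {rmorphism P -> P}, forall r, h r = r \mPo lin_forms (M * N)%g.
  by exists (comp_mpoly (lin_forms (M * N)%g)).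
rewrite -hE -h'E (rmorph_mmap h) (rmorph_mmap h'); apply: eq_bigr => m _.
congr (_ * _); first by rewrite hE h'E !comp_mpolyC.
apply: eq_bigr => i _; congr (_ ^+ _); rewrite hE h'E !comp_mpolyXU -!tnth_nth.
rewrite !tnth_mktuple rmorph_sum /=.
rewrite (eq_bigr (fun l => \sum_j (M i l * N l j) *: 'X_j)); last first.
  move=> l _; rewrite comp_mpolyZ comp_mpolyXU -tnth_nth tnth_mktuple scaler_sumr.
  by apply: eq_bigr => j _; rewrite scalerA.
rewrite exchange_big; apply: eq_bigr => j _; rewrite -scaler_suml; congr (_ *: _).
by rewrite mxE.
Qed.

(** Since q0 composed with M is c q0, the first pullback is again a fraction with denominator q0^n,
    up to the scalar c^-n, and the second one can be applied to it. *)
Lemma pulls_back_comp M N c Phi Psi : c != 0 -> conformal c M ->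
  pulls_back (linF M) Phi -> pulls_back (linF N) Psi ->
  pulls_back (linF (M * N)%g) (Phi * Psi)%g.
Proof.
move=> c0 /conformalP cM hPhi hPsi n p f vf.
have C0 : constK c != 0 by rewrite fmorph_eq0.
have tZ (x : k) (r : P) : (x *: r)%:F = constK x * r%:F by rewrite -mul_mpolyC tofracM.
have v1 : OS0_val (comorph Phi f) = (c ^- n *: (p \mPo lin_forms M))%:F / q0%:F ^+ n.
  rewrite (hPhi _ _ _ vf) !subst_linF cM !tZ exprMn invfM mulrA.
  congr (_ * _); rewrite mulrC; congr (_ * _).
  have cV : constK c^-1 = (constK c)^-1 by rewrite fmorphV.
  have cX (x : k) : constK (x ^+ n) = constK x ^+ n by rewrite rmorphXn.
  by rewrite -exprVn -exprVn -cV cX.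
rewrite comorphM (hPsi _ _ _ v1) !subst_linF -!comp_lin_forms cM !comp_mpolyZ !tZ.
have cV : constK (c ^- n) = (constK c ^+ n)^-1 by rewrite -rmorphXn -fmorphV.
by rewrite exprMn invfM cV [RHS]mulrCA [RHS]mulrA.
Qed.

(** The place where homogeneity of the numerator is used: y^(2 n) cancels against the denominator,
    so only the class in PGL matters. *)
Lemma restricts_scale M N y Psi : y != 0 -> GLmx_val M = y *: GLmx_val N ->
  restricts_to (linF N) Psi -> restricts_to (linF M) Psi.
Proof.
move=> y0 e h n p f hp vf; rewrite (h _ _ _ hp vf).
have tZ (x : k) (r : P) : (x *: r)%:F = constK x * r%:F by rewrite -mul_mpolyC tofracM.
have sE d r : r \is d.-homog -> subst_rat (linF M) r = constK y ^+ d * subst_rat (linF N) r.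
  move=> hr; rewrite /subst_rat -(mmap_homog _ _ _ hr); apply: eq_bigr => m _.
  congr (_ * _); apply: eq_bigr => i _; congr (_ ^+ _).
  have tm (F : 3.-tuple P) (l : 'I_3) : tnth (tof F) l = (tnth F l)%:F by rewrite tnth_map.
  rewrite !tm -tZ !tnth_lin_forms e; congr (_%:F).
  by rewrite !scalerDr !scalerA !mxE.
have Y0 : constK y != 0 by rewrite fmorph_eq0.
rewrite (sE _ _ hp) (sE _ _ (q0_homog k)) exprMn -exprM invfM.
have z0 : constK y ^+ (2 * n) != 0 by rewrite expf_neq0.
by rewrite mulrACA (@divff K _ z0) mul1r.
Qed.

Lemma unip_unit (b : k) : unip b \in unitmx.
Proof. by have /mulmx1_unit[] := unipK b. Qed.
Lemma weyl_unit : weyl k \in unitmx.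
Proof. by have /mulmx1_unit[] := weylK k. Qed.
Lemma torus_unit (a : k) : a != 0 -> torus a \in unitmx.
Proof. by move=> /torusK/mulmx1_unit[]. Qed.

Definition unipGL (b : k) := MkGLmx (unip_unit b).
Definition weylGL := MkGLmx weyl_unit.
Definition torusGL (a : k) a0 := MkGLmx (@torus_unit a a0).

Lemma lin_forms_unip b : lin_forms (unipGL b) = unip_map b.
Proof.
apply: eq_from_tnth => i; rewrite tnth_lin_forms (tnth_nth 0) /= !mxE; move: i.
apply: ord3P; rewrite /= ?scale1r ?scale0r ?addr0 ?add0r //; first by rewrite addrC.
by rewrite !scaleNr addrC [- _ - _]addrC addrA.
Qed.

Lemma lin_forms_torus a a0 : lin_forms (@torusGL a a0) = torus_map a.
Proof.
apply: eq_from_tnth => i; rewrite tnth_lin_forms (tnth_nth 0) /= !mxE; move: i.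
by apply: ord3P; rewrite /= ?scale1r ?scale0r ?addr0 ?add0r.
Qed.

Lemma lin_forms_weyl : lin_forms weylGL = swap_map k.
Proof.
apply: eq_from_tnth => i; rewrite tnth_lin_forms (tnth_nth 0) /= !mxE; move: i.
by apply: ord3P; rewrite /= ?scaleN1r ?scale1r ?scale0r ?addr0 ?add0r.
Qed.

Lemma fibre_map_const (b : k) : fibre_map b%:P = tof (unip_map b).
Proof.
have tZ (x : k) (r : P) : (x *: r)%:F = constK x * r%:F by rewrite -mul_mpolyC tofracM.
apply: eq_from_tnth => i; rewrite tnth_map !(tnth_nth 0); move: i.
rewrite /fibre_map map_polyC hornerC; apply: ord3P => //=.
  by rewrite tofracD tZ.
have c2 : constK (2 * b) = 2 * constK b by rewrite rmorphM rmorph_nat.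
have cX : constK (b ^+ 2) = constK b ^+ 2 by rewrite rmorphXn.
rewrite !tofracB !tZ c2 cX; congr (_ - _ - _); last by rewrite mulrC.
by rewrite mulrAC.
Qed.

Lemma is_fibre_pulls_back s Psi : is_fibre s Psi -> pulls_back (fibre_map s) Psi.
Proof.
move=> [f0 f1]; have [Psi' [h [g0 g1]]] := fibre_exists s.
by have -> : Psi = Psi' by apply: eq_autS0; rewrite ?f0 ?f1 ?g0 ?g1.
Qed.

Lemma is_fibre_unip (b : k) Psi : is_fibre b%:P Psi -> pulls_back (linF (unipGL b)) Psi.
Proof. by move/is_fibre_pulls_back; rewrite fibre_map_const lin_forms_unip. Qed.

Lemma is_torus_linF a a0 Psi : is_torus a Psi -> pulls_back (linF (@torusGL a a0)) Psi.
Proof.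
move=> [f0 f1]; have [Psi' [h [g0 g1]]] := torus_exists a0; rewrite lin_forms_torus.
by have -> : Psi = Psi' by apply: eq_autS0; rewrite ?f0 ?f1 ?g0 ?g1.
Qed.

Lemma is_swap_linF Psi : is_swap Psi -> pulls_back (linF weylGL) Psi.
Proof.
move=> [f0 f1]; have [Psi' [h [g0 g1] _ _]] := swap_exists k; rewrite lin_forms_weyl.
by have -> : Psi = Psi' by apply: eq_autS0; rewrite ?f0 ?f1 ?g0 ?g1.
Qed.

Lemma conformal_torus_unip (a b : k) : a != 0 -> conformal 1 (torus a *m unip b).
Proof.
by move=> a0; rewrite mx3M conformalE; split; last split; field.
Qed.

Lemma conformal1 : conformal (1 : k) 1%:M.
Proof. by rewrite mx31 conformalE; split; last split; ring. Qed.

Lemma conformal_unip1 (b : k) : conformal 1 (unip b : 'M[k]_3).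
Proof. by rewrite -[unip b]mulmx1; apply: conformal_unip conformal1. Qed.

Lemma conformal_weyl1 : conformal 1 (weyl k).
Proof. by rewrite -[weyl k]mulmx1; apply: conformal_weyl conformal1. Qed.

Lemma conformal_torus1 (a : k) : a != 0 -> conformal 1 (torus a).
Proof. by move=> a0; rewrite conformalE; split; last split; field. Qed.

Lemma conformalZ (y c : k) (M : 'M[k]_3) : conformal c M -> conformal (y ^+ 2 * c) (y *: M).
Proof.
rewrite [M]mx3_eta mx3Z !conformalE => -[h1 h2 h3 [h4 h5 h6]].
have z0 : y ^+ 2 * 0 = 0 by rewrite mulr0.
by split; [apply: etrans (etrans _ (congr1 (fun x => y ^+ 2 * x) h1)) z0
  |apply: etrans (congr1 (fun x => y ^+ 2 * x) h2)
  |apply: etrans (etrans _ (congr1 (fun x => y ^+ 2 * x) h3)) z0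
  |split; [apply: etrans (etrans _ (congr1 (fun x => y ^+ 2 * x) h4)) z0
    |apply: etrans (congr1 (fun x => y ^+ 2 * x) h5)
    |apply: etrans (etrans _ (congr1 (fun x => y ^+ 2 * x) h6)) z0]]; ring.
Qed.

Lemma unipGLK b : (unipGL (- b) * unipGL b)%g = 1%g.
Proof. by apply: val_inj; exact: unipK. Qed.

Lemma weylGLK : (weylGL * weylGL)%g = 1%g.
Proof. by apply: val_inj; exact: weylK. Qed.

Lemma bruhat_GL c M : conformal c M -> c != 0 /\ exists a (a0 : a != 0) b y, y != 0 /\
  (GLmx_val M = y *: GLmx_val (torusGL a0 * unipGL b)%g \/
   exists b', GLmx_val M = y *: GLmx_val (unipGL b' * (weylGL * (torusGL a0 * unipGL b)))%g).
Proof.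
move=> cM; have [[m0 m1]|[b' [m0 m1]]] := bruhat cM.
  have [c0 [a [b [y [a0 y0 e]]]]] := borel_form cM m0 m1.
  by split=> //; exists a, a0, b, y; split=> //; left.
have cN : conformal c (weylGL * (unipGL b' * M))%g.
  by apply: conformal_weyl; apply: conformal_unip.
have [c0 [a [b [y [a0 y0 e]]]]] := borel_form cN m0 m1.
split=> //; exists a, a0, b, y; split=> //; right; exists (- b').
have -> : M = (unipGL (- b') * (weylGL * (weylGL * (unipGL b' * M))))%g.
  by rewrite (mulgA weylGL) weylGLK mul1g mulgA unipGLK mul1g.
by rewrite -[LHS]/(unip (- b') *m (weyl k *m GLmx_val (weylGL * (unipGL b' * M))%g)) e -!scalemxAr.
Qed.

End LinearRestrictions.

Section LinearGroup.
Variable k : fieldType.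
Local Notation P := {mpoly k[3]}.
Local Notation gen := (gen k).
Local Notation o0 := (@Ordinal 3 0 isT).
Local Notation o1 := (@Ordinal 3 1 isT).
Local Notation o2 := (@Ordinal 3 2 isT).
Local Notation linF M := [tuple of map (@FracField.tofrac P) (lin_forms M)].
Implicit Types (M N : GLmx k 3) (Psi Phi : AutS0 k).

Definition is_borel Psi := exists a b Tor Fib,
  [/\ a != 0, is_torus a Tor, is_fibre b%:P Fib & Psi = (Tor * Fib)%g].

Definition is_big_cell Psi := exists b Fib Sw B,
  [/\ is_fibre b%:P Fib, is_swap Sw, is_borel B & Psi = (Fib * (Sw * B))%g].

Let pulls_back_borel a (a0 : a != 0) b Tor Fib : is_torus a Tor -> is_fibre b%:P Fib ->
  pulls_back (linF (torusGL a0 * unipGL b)%g) (Tor * Fib)%g.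
Proof.
move=> t f; apply: (pulls_back_comp (oner_neq0 k) (conformal_torus1 a0 : conformal 1 (torusGL a0))).
  exact: is_torus_linF.
exact: is_fibre_unip.
Qed.

Let pulls_back_big_cell a (a0 : a != 0) b b' Tor Fib Fib' Sw :
  is_torus a Tor -> is_fibre b%:P Fib -> is_fibre b'%:P Fib' -> is_swap Sw ->
  pulls_back (linF (unipGL b' * (weylGL k * (torusGL a0 * unipGL b)))%g)
    (Fib' * (Sw * (Tor * Fib)))%g.
Proof.
move=> t f f' s; apply: (pulls_back_comp (oner_neq0 k) (conformal_unip1 b' : conformal 1 (unipGL b'))).
  exact: is_fibre_unip.
apply: (pulls_back_comp (oner_neq0 k) (conformal_weyl1 k : conformal 1 (weylGL k))); first exact: is_swap_linF.
exact: pulls_back_borel.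
Qed.

Lemma conformal_lift c M : conformal c M -> exists y N Psi,
  [/\ y != 0, GLmx_val M = y *: GLmx_val N, conformal 1 N, pulls_back (linF N) Psi &
      is_borel Psi \/ is_big_cell Psi].
Proof.
move=> /bruhat_GL[c0 [a [a0 [b [y [y0 e]]]]]].
have [Tor [_ t]] := torus_exists a0; have [Fib [_ f]] := fibre_exists b%:P.
have cB : conformal 1 (torusGL a0 * unipGL b)%g by exact: conformal_torus_unip.
have hB : is_borel (Tor * Fib)%g by exists a, b, Tor, Fib.
case: e => [e|[b' e]].
  exists y, (torusGL a0 * unipGL b)%g, (Tor * Fib)%g; split=> //; last by left.
  exact: pulls_back_borel.
have [Fib' [_ f']] := fibre_exists b'%:P; have [Sw [_ s _ _]] := swap_exists k.
exists y, (unipGL b' * (weylGL k * (torusGL a0 * unipGL b)))%g.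
exists (Fib' * (Sw * (Tor * Fib)))%g; split=> //.
- by apply: conformal_unip; apply: conformal_weyl.
- exact: pulls_back_big_cell.
- by right; exists b', Fib', Sw, (Tor * Fib)%g.
Qed.

Definition linear_aut Psi := exists N c,
  [/\ c != 0, conformal c N & pulls_back (linF N) Psi].

Lemma class_conformal M1 M2 c : c != 0 -> conformal c M1 -> PGL_class M1 = PGL_class M2 ->
  exists d, conformal d M2.
Proof.
move=> c0 h /esym/eqP/PGL_classP[y y0 e]; exists (y ^+ 2 * c).
by rewrite e; exact: conformalZ.
Qed.

(** A representative of the class is factored by [bruhat], and the product of explicit automorphisms
    thus obtained is Psi itself, because coordinates determine a restriction. *)
Lemma restrict_linear Psi : restrict_S0 (AutP2_Q0 k) Psi ->
  linear_aut Psi /\ (is_borel Psi \/ is_big_cell Psi).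
Proof.
move=> [g [M1 gM1 [c c0 /conformalP cM1]] [F [M2 gM2 <-] r]].
have [d cM2] : exists d, conformal d M2.
  by apply: (class_conformal c0 cM1); rewrite -gM1 -gM2.
have [y [N [Psi' [y0 e cN pN form]]]] := conformal_lift cM2.
have -> : Psi = Psi'.
  by apply: (restricts_uniq r); apply: (restricts_scale y0 e); exact: pulls_back_restricts.
by split=> //; exists N, 1; rewrite oner_neq0.
Qed.

Lemma linear_restrict Psi : linear_aut Psi -> restrict_S0 (AutP2_Q0 k) Psi.
Proof.
move=> [N [c [c0 cN pN]]]; exists (PGL_class N).
  by exists N => //; exists c => //; apply/conformalP.
by exists (lin_forms N); [exists N|exact: pulls_back_restricts].
Qed.

Lemma borel_restrict Psi : is_borel Psi -> restrict_S0 (AutP2_Q0 k) Psi.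
Proof.
move=> [a [b [Tor [Fib [a0 t f ->]]]]]; apply: linear_restrict.
exists (torusGL a0 * unipGL b)%g, 1; split; first exact: oner_neq0.
  exact: conformal_torus_unip.
exact: pulls_back_borel.
Qed.

Lemma swap_restrict Psi : is_swap Psi -> restrict_S0 (AutP2_Q0 k) Psi.
Proof.
move=> s; apply: linear_restrict; exists (weylGL k), 1; split; first exact: oner_neq0.
  exact: conformal_weyl1.
exact: is_swap_linF.
Qed.

Lemma conformalM c d M N : conformal c M -> conformal d N -> conformal (c * d) (M * N)%g.
Proof.
move=> /conformalP cM /conformalP cN; apply/conformalP.
by rewrite -comp_lin_forms cM comp_mpolyZ cN scalerA.
Qed.

Lemma conformal_1 : conformal 1 (1%g : GLmx k 3).
Proof. exact: conformal1. Qed.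

Lemma conformalV c M : c != 0 -> conformal c M -> conformal c^-1 (M^-1)%g.
Proof.
move=> c0 /conformalP cM; apply/conformalP.
have /conformalP := conformal_1; rewrite -(mulgV M) -comp_lin_forms cM comp_mpolyZ scale1r.
by move=> e; rewrite -{2}e scalerA mulVf // scale1r.
Qed.

Lemma pulls_back1 : pulls_back (linF (1%g : GLmx k 3)) (1%g : AutS0 k).
Proof.
move=> n p f vf; have idE r : r \mPo lin_forms (1%g : GLmx k 3) = r.
  have -> : lin_forms (1%g : GLmx k 3) = [tuple 'X_i | i < 3].
    apply: eq_from_tnth => i; rewrite tnth_lin_forms tnth_mktuple /= !mxE.
    by move: i; apply: ord3P; rewrite /= ?scale1r ?scale0r ?addr0 ?add0r.
  exact: comp_mpoly_id.
by rewrite !subst_linF !idE.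
Qed.

Lemma restrict_subgroup : is_subgroup (restrict_S0 (AutP2_Q0 k)).
Proof.
split.
- by apply: linear_restrict; exists 1%g, 1; split; [exact: oner_neq0|exact: conformal_1|exact: pulls_back1].
- move=> Phi Psi /restrict_linear[[M [c [c0 cM pM]]] _] /restrict_linear[[N [d [d0 cN pN]]] _].
  apply: linear_restrict; exists (M * N)%g, (c * d); split; first by rewrite mulf_neq0.
    exact: conformalM.
  exact: pulls_back_comp c0 cM pM pN.
- move=> Psi /restrict_linear[[M [c [c0 cM pM]]] _].
  (* The inverse matrix has a lift [Psi']. The product of Psi with it restricts a scalar matrix, so
     it is the identity, and [Psi'] is the inverse of Psi. *)
  have [y [N [Psi' [y0 e cN pN _]]]] := conformal_lift (conformalV c0 cM).
  apply: linear_restrict; exists N, 1; rewrite oner_neq0; split=> //.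
  suff -> : (Psi^-1)%g = Psi' by [].
  apply: (mulgI Psi); rewrite mulgV; apply/esym.
  apply: (@restricts_uniq _ (linF (M * N)%g)).
    by apply: pulls_back_restricts; exact: pulls_back_comp c0 cM pM pN.
  apply: (@restricts_scale _ (M * N)%g 1%g y^-1).
  - by rewrite invr_eq0.
  - rewrite -(mulgV M) -[GLmx_val (M * N)%g]/(GLmx_val M *m GLmx_val N).
    rewrite -[GLmx_val (M * M^-1)%g]/(GLmx_val M *m GLmx_val (M^-1)%g) e -scalemxAr.
    by rewrite scalerA mulVf // scale1r.
  - exact: pulls_back_restricts pulls_back1.
Qed.

Lemma AutP2_Q0P g : AutP2_Q0 k g <-> exists M c, [/\ c != 0, conformal c M & g = PGL_class M].
Proof.
split=> [[M gM [c c0 /conformalP h]]|[M [c [c0 /conformalP h gM]]]]; first by exists M, c.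
by exists M => //; exists c.
Qed.

Definition mx2 (p q r v : k) : 'M[k]_2 :=
  \matrix_(i, l) if i == ord0 then (if l == ord0 then p else q) else (if l == ord0 then r else v).

Lemma mx2_sym2 p q r v : sym2 (mx2 p q r v) = mx3 (p ^+ 2) (2 * p * q) (- q ^+ 2)
  (p * r) (p * v + q * r) (- (q * v)) (- r ^+ 2) (- (2 * r * v)) (v ^+ 2).
Proof. by rewrite /sym2 !mxE. Qed.

Lemma mx2_unit p q r v : p * v - q * r != 0 -> mx2 p q r v \in unitmx.
Proof.
move=> d0; have /mulmx1_unit[] // : mx2 p q r v *m
  ((p * v - q * r)^-1 *: mx2 v (- q) (- r) p) = 1%:M.
have sum2 (F : 'I_2 -> k) : \sum_i F i = F ord0 + F ord_max.
  by rewrite !big_ord_recl big_ord0 addr0; congr (_ + F _); apply: val_inj.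
have two (i : 'I_2) : i = ord0 \/ i = ord_max.
  by case: i => [[|[|//]] lt]; [left|right]; apply: val_inj.
apply/matrixP => i l; rewrite -scalemxAr !mxE sum2 !mxE /=.
by case: (two i) => ->; case: (two l) => -> /=; field.
Qed.

Lemma sym2_range_mx p q r v y N : p * v - q * r != 0 -> y != 0 ->
  sym2 (mx2 p q r v) = y *: GLmx_val N -> range (@sym2_PGL k) (PGL_class N).
Proof.
move=> d0 y0 e; exists (PGL_class (MkGLmx (mx2_unit d0))) => //.
by rewrite sym2_class; apply/eqP/PGL_classP; exists y.
Qed.

Lemma sym2_range : range (@sym2_PGL k) = AutP2_Q0 k.
Proof.
apply/seteqP; split=> [_ [x _ <-]|g /AutP2_Q0P[M [c [c0 cM ->]]]].
  apply/AutP2_Q0P; have [c hc] := sym2_conformal (PGL_repr x).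
  by exists (sym2_GL (PGL_repr x)), c; split=> //; have [] := @bruhat_GL _ _ (sym2_GL (PGL_repr x)) hc.
have rM (x y : PGL k 3) : range (@sym2_PGL k) x -> range (@sym2_PGL k) y ->
    range (@sym2_PGL k) (x * y)%g.
  by move=> [x' _ <-] [y' _ <-]; exists (x' * y')%g => //; rewrite sym2_PGLM.
have classM (x y : GLmx k 3) : PGL_class (x * y)%g = (PGL_class x * PGL_class y)%g.
  by rewrite -PGL_classM.
(* The three kinds of generators come from a lower unipotent matrix, from diag(a, 1) and from the
   transposition, with scalars 1, a and -1. *)
have rn b : range (@sym2_PGL k) (PGL_class (unipGL b)).
  apply: (@sym2_range_mx 1 0 b 1 1); rewrite ?mulr1 ?mul0r ?subr0 ?oner_neq0 //.
  by rewrite scale1r mx2_sym2; apply: eq_mx3; ring.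
have rt a (a0 : a != 0) : range (@sym2_PGL k) (PGL_class (torusGL a0)).
  apply: (@sym2_range_mx a 0 0 1 a) => //; first by rewrite mulr1 mul0r subr0.
  by rewrite mx2_sym2 mx3Z; apply: eq_mx3; field.
have rw : range (@sym2_PGL k) (PGL_class (weylGL k)).
  apply: (@sym2_range_mx 0 1 1 0 (- 1)); rewrite ?mulr1 ?mul0r ?sub0r ?oppr_eq0 ?oner_neq0 //.
  by rewrite mx2_sym2 mx3Z; apply: eq_mx3; ring.
have [_ [a [a0 [b [y [y0 e]]]]]] := bruhat_GL cM.
case: e => [e|[b' e]].
  have -> : PGL_class M = PGL_class (torusGL a0 * unipGL b)%g by apply/eqP/PGL_classP; exists y.
  by rewrite classM; apply: rM.
have -> : PGL_class M = PGL_class (unipGL b' * (weylGL k * (torusGL a0 * unipGL b)))%g.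
  by apply/eqP/PGL_classP; exists y.
by rewrite !classM; do 3!apply: (rM _ _) => //.
Qed.

Lemma AutP2_Q0_subgroup : is_subgroup (AutP2_Q0 k).
Proof.
rewrite -sym2_range; have f1 : @sym2_PGL k 1%g = 1%g.
  by apply: (mulgI (sym2_PGL 1%g)); rewrite -sym2_PGLM !mulg1.
split; first by exists 1%g.
- by move=> _ _ [x _ <-] [y _ <-]; exists (x * y)%g => //; rewrite sym2_PGLM.
- move=> _ [x _ <-]; exists (x^-1)%g => //; apply: (mulgI (sym2_PGL x)).
  by rewrite -sym2_PGLM !mulgV.
Qed.

Lemma AutP2_Q0_gen : AutP2_Q0 k = subgroup_gen
  ([set g | exists b : k, given_by g (unip_map b)] `|`
   [set g | exists2 a : k, a != 0 & given_by g (torus_map a)] `|`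
   [set g | given_by g (swap_map k)]).
Proof.
apply/seteqP; split=> [g /AutP2_Q0P[M [c [c0 cM ->]]] H [H1 HM HV] sub|g]; last first.
  apply; first exact: AutP2_Q0_subgroup.
  have lin N M : lin_forms M = lin_forms N -> conformal 1 N -> AutP2_Q0 k (PGL_class M).
    move=> e /conformalP cN; apply/AutP2_Q0P; exists M, 1; rewrite oner_neq0; split=> //.
    by apply/conformalP; rewrite e.
  move=> x [[[b [M -> e]]|[a a0 [M -> e]]]|[M -> e]].
  - by apply: (lin (unipGL b)); [rewrite lin_forms_unip|exact: conformal_unip1].
  - by apply: (lin (torusGL a0)); [rewrite lin_forms_torus|exact: conformal_torus1].
  - by apply: (lin (weylGL k)); [rewrite lin_forms_weyl|exact: conformal_weyl1].
have classM (x y : GLmx k 3) : PGL_class (x * y)%g = (PGL_class x * PGL_class y)%g.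
  by rewrite -PGL_classM.
have rn b : H (PGL_class (unipGL b)).
  by apply: sub; left; left; exists b, (unipGL b) => //; exact: lin_forms_unip.
have rt a (a0 : a != 0) : H (PGL_class (torusGL a0)).
  by apply: sub; left; right; exists a => //; exists (torusGL a0) => //; exact: lin_forms_torus.
have rw : H (PGL_class (weylGL k)).
  by apply: sub; right; exists (weylGL k) => //; exact: lin_forms_weyl.
have [_ [a [a0 [b [y [y0 e]]]]]] := bruhat_GL cM.
case: e => [e|[b' e]].
  have -> : PGL_class M = PGL_class (torusGL a0 * unipGL b)%g by apply/eqP/PGL_classP; exists y.
  by rewrite classM; apply: HM.
have -> : PGL_class M = PGL_class (unipGL b' * (weylGL k * (torusGL a0 * unipGL b)))%g.
  by apply/eqP/PGL_classP; exists y.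
by rewrite !classM; do 3!apply: (HM _ _) => //.
Qed.

Lemma AutS0_rho0_subgroup : is_subgroup (AutS0_rho0 k).
Proof.
split; first by exists 1%g.
- move=> Phi Psi [phi hphi] [psi hpsi]; exists (phi * psi)%g => p.
  by rewrite comorphM hphi hpsi.
- move=> Phi [phi hphi]; exists (phi^-1)%g => p.
  apply: (can_inj (@comorphK _ _ Phi)); rewrite comorphVE comorphVK hphi.
  by congr rho0; exact: esym (@comorphVK _ _ phi p).
Qed.

Lemma is_fibre_rho0 s Psi : is_fibre s Psi -> AutS0_rho0 k Psi.
Proof. by move/fibre_triangular/is_triangular_rho0. Qed.

Lemma is_torus_rho0 a Psi : is_torus a Psi -> AutS0_rho0 k Psi.
Proof.
move=> [h _]; apply/AutS0_rho0P; exists (a ^+ 2 *: 'X^1).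
by rewrite rho0_monomial expr1.
Qed.

Lemma is_borel_rho0 Psi : is_borel Psi -> AutS0_rho0 k Psi.
Proof.
have [_ HM _] := AutS0_rho0_subgroup.
by move=> [a [b [Tor [Fib [_ /is_torus_rho0 t /is_fibre_rho0 f ->]]]]]; exact: HM.
Qed.

Lemma restrict_p0_borel Psi : restrict_S0 (AutP2_Q0_p0 k) Psi -> is_borel Psi.
Proof.
move=> [g [[M1 gM1 [c c0 /conformalP cM1]] [M3 gM3 [d d0 fix3]]] [F [M2 gM2 <-] r]].
have [e2 cM2] : exists d, conformal d M2.
  by apply: (class_conformal c0 cM1); rewrite -gM1 -gM2.
have [y y0 M23] : exists2 y, y != 0 & GLmx_val M2 = y *: GLmx_val M3.
  by apply/PGL_classP; rewrite -gM2 -gM3.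
have z (i : 'I_3) : (i != 2 :> nat) -> M2 i o2 = 0.
  move=> i2; have /matrixP/(_ i ord0) := fix3; rewrite M23 !mxE sum3 !mxE /=.
  by rewrite !mulr0 !add0r mulr1 (negPf i2) mulr0 => ->; rewrite mulr0.
have [_ [a [b [x [a0 x0 e]]]]] := borel_form cM2 (z o0 isT) (z o1 isT).
have [Tor [_ t]] := torus_exists a0; have [Fib [_ f]] := fibre_exists b%:P.
exists a, b, Tor, Fib; split=> //; apply: (restricts_uniq r).
apply: (@restricts_scale _ M2 (torusGL a0 * unipGL b)%g x _ x0 e).
by apply: pulls_back_restricts; exact: pulls_back_borel.
Qed.

Lemma torus_restrict_p0 a Psi : a != 0 -> is_torus a Psi -> restrict_S0 (AutP2_Q0_p0 k) Psi.
Proof.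
move=> a0 t; exists (PGL_class (torusGL a0)); last first.
  exists (lin_forms (torusGL a0)); first by exists (torusGL a0).
  by apply: pulls_back_restricts; exact: is_torus_linF.
split; first by apply/AutP2_Q0P; exists (torusGL a0), 1; rewrite oner_neq0; split=> //; exact: conformal_torus1.
exists (torusGL a0) => //; exists a^-1; first by rewrite invr_eq0.
apply/matrixP => i l; rewrite !mxE sum3 !mxE; move: i; apply: ord3P => /=;
  by rewrite ?mulr0 ?mul0r ?mulr1 ?addr0 ?add0r.
Qed.

Lemma AutS0_rho0_gen : AutS0_rho0 k = subgroup_gen
  ([set Psi | exists s : {poly k}, restricts_to (fibre_map s) Psi]
    `|` restrict_S0 (AutP2_Q0_p0 k)).
Proof.
apply/seteqP; split=> [Phi /AutS0_rho0_torus_fibre[s [b [Tor [Fib [b0 t f ->]]]]] H [_ HM _] sub|Phi].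
  apply: HM; apply: sub; first by right; exact: torus_restrict_p0 b0 t.
  by left; exists s; apply: pulls_back_restricts; exact: is_fibre_pulls_back.
apply; first exact: AutS0_rho0_subgroup.
move=> Psi [[s r]|/restrict_p0_borel/is_borel_rho0 //].
have [Psi' [p f]] := fibre_exists s.
by rewrite (restricts_uniq r (pulls_back_restricts p)); exact: is_fibre_rho0 f.
Qed.

End LinearGroup.

(** * Reduced words *)

Section AmalgamOfAutS0.
Variable k : fieldType.
Local Notation A := (OS0 k).
Local Notation gen := (gen k).
Local Notation H1 := (restrict_S0 (AutP2_Q0 k)).
Local Notation H2 := (AutS0_rho0 k).
Implicit Types (f : A) (Phi Psi : AutS0 k).

Definition top_const n f := exists2 c : k, c != 0 & topform f n c%:P.

(** A linear factor a Y + b in place of Y - r keeps this shape visibly stable under affine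
    substitutions. *)
Definition top_power n f := exists c a b : k,
  [/\ c != 0, a != 0 & topform f n (c *: (a *: 'X + b%:P) ^+ (4 * n))].

Lemma torus_triangular (a : k) Psi : a != 0 -> is_torus a Psi ->
  is_triangular (a ^+ 2) a^-1 0%:P Psi.
Proof.
move=> a0 [h0 h1]; split; rewrite ?expf_neq0 ?invr_eq0 //.
by rewrite polyC0 rmorph0 mul0r addr0 h1 scalerA expr2 -mulrA divff // mulr1.
Qed.

Section States.
Variables (C : coordinateField k) (E : degreeField C).

Lemma top_const_borel c1 e s n f Psi : is_triangular c1 e s%:P Psi ->
  top_const n f -> top_const n (comorph Psi f).
Proof.
move=> tr [c c0 tf]; have [c10 _ _ _] := tr; exists (c1 ^+ n * c).
  by rewrite mulf_neq0 ?expf_neq0.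
by have := topform_borel E tr tf; rewrite comp_polyC -mul_polyC -polyCM.
Qed.

Lemma top_power_borel c1 e s n f Psi : is_triangular c1 e s%:P Psi ->
  top_power n f -> top_power n (comorph Psi f).
Proof.
move=> tr [c [a [b [c0 a0 tf]]]]; have [c10 e0 _ _] := tr.
exists (c1 ^+ n * c), (a * e), (a * s + b); split.
- by rewrite mulf_neq0 ?expf_neq0.
- by rewrite mulf_neq0.
have := topform_borel E tr tf; rewrite comp_polyZ scalerA rmorphXn /= comp_polyD.
rewrite comp_polyZ comp_polyX comp_polyC scalerDr scalerA -addrA.
by rewrite -[a *: s%:P]mul_polyC -polyCM -polyCD.
Qed.

Lemma top_const_big_cell n f Psi : is_big_cell Psi -> top_const n f ->
  top_power n (comorph Psi f).
Proof.
move=> [b [Fib' [Sw [B [/fibre_triangular f' s [a [b' [Tor [Fib [a0 t /fibre_triangular f'' ->]]]] ->]]]]]].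
rewrite !comorphM => /(top_const_borel f')[c c0 tf].
apply: (top_power_borel f''); apply: (top_power_borel (torus_triangular a0 t)).
exists c, 1, 0; split; rewrite ?oner_neq0 //.
by rewrite scale1r polyC0 addr0; exact: (topform_swap_const E s c0 tf).
Qed.

Lemma top_power_fibre n f s b Psi : is_fibre s Psi -> size s = b.+2 -> (0 < n)%N ->
  top_power n f -> exists2 n', (1 < n')%N & top_const n' (comorph Psi f).
Proof.
move=> /fibre_triangular tr sb n0 [c [a [d [c0 a0 tf]]]].
have e : c *: (a *: 'X + d%:P) ^+ (4 * n) =
    (c * a ^+ (4 * n)) *: ('X - (- (d / a))%:P) ^+ (4 * n).
  rewrite -scalerA -exprZn scalerDr; congr (_ *: (_ + _) ^+ _).
  by rewrite polyCN opprK -mul_polyC -polyCM mulrCA divff // mulr1.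
rewrite e in tf; have ca0 : c * a ^+ (4 * n) != 0 by rewrite mulf_neq0 ?expf_neq0.
have [c' c'0 tf'] := topform_fibre E tr sb ca0 tf.
exists (n + b.+1 * (4 * n))%N; last by exists c'.
by move: (leq_addr (b * (4 * n)) (4 * n)); rewrite mulSn; lia.
Qed.

Lemma factor_neither1 Psi : H1 Psi -> ~ H2 Psi -> is_big_cell Psi.
Proof.
by move=> /restrict_linear[_ [/is_borel_rho0 h|//]] /(_ h).
Qed.

Lemma factor_neither2 Psi : H2 Psi -> ~ H1 Psi -> exists s b a Tor Fib,
  [/\ a != 0, is_torus a Tor, is_fibre s Fib, size s = b.+2 & Psi = (Tor * Fib)%g].
Proof.
move=> /AutS0_rho0_torus_fibre[s [a [Tor [Fib [a0 t h ->]]]]] nH1.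
have [s1|s1] := leqP (size s) 1.
  case: nH1; apply: borel_restrict; exists a, s`_0, Tor, Fib; split=> //.
  by rewrite -(size1_polyC s1).
by exists s, (size s).-2, a, Tor, Fib; split=> //; lia.
Qed.

(** Neither alternative holds for u itself, which has a constant top form with n = 1. *)
Definition escaped f := (exists2 n, (0 < n)%N & top_power n f) \/
  (exists2 n, (1 < n)%N & top_const n f).

(** Comorphisms reverse products, so the first letter of the word acts first on f. A linear letter
    outside [AutS0_rho0] lies in the big cell and contains the swap; a fibred letter outside the
    linear group has a nonconstant s. Alternation makes each letter meet the shape it changes. *)
Lemma reduced_escapes w f : reduced H1 H2 w -> w <> [::] ->
  (if head true (unzip1 w) then exists2 n, (0 < n)%N & top_const n f
   else exists2 n, (0 < n)%N & top_power n f) -> escaped (comorph (word_prod w) f).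
Proof.
elim: w f => // -[b Psi] t IH f /= [hb nb alt rt] _ st.
have [st'|[b' st']] : (t = [::]) \/ (exists l t', t = l :: t') by case: (t) => [|l t']; [left|right; exists l, t'].
  rewrite st' /=; case: b hb nb st {alt} => /= hb nb [n n0 st].
    by left; exists n => //; exact: top_const_big_cell (factor_neither1 hb nb) st.
  have [s [b [a [Tor [Fib [a0 tor fib sb ->]]]]]] := factor_neither2 hb nb.
  right; rewrite ?comorphM; apply: (top_power_fibre fib sb n0).
  exact: top_power_borel (torus_triangular a0 tor) st.
have [t' et] := st'; apply: IH => //; first by rewrite et.
rewrite et /= in alt *; case: b hb nb st alt => /= hb nb [n n0 st]; case: b'.1 => // _.
  by exists n => //; exact: top_const_big_cell (factor_neither1 hb nb) st.
have [s [b [a [Tor [Fib [a0 tor fib sb ->]]]]]] := factor_neither2 hb nb.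
rewrite ?comorphM; have [|n' n'1 st2] := top_power_fibre fib sb n0 (f := comorph Tor f).
  exact: top_power_borel (torus_triangular a0 tor) st.
by exists n' => //; exact: ltnW.
Qed.

Lemma top_const_gen0 : top_const 1 (gen 0).
Proof.
exists 1; first exact: oner_neq0.
exists (fun i => if i == 1%N then 1 else 0); split=> //; first split.
- by move=> i; case: eqP => [->|_]; rewrite ?size_poly0 // size_poly1.
- exact: oner_neq0.
rewrite /comb !big_ord_recl !big_ord0 !coef0 !coef1 !scale0r !addr0 add0r scale1r.
by rewrite /= expr0 mulr1.
Qed.

Lemma not_escaped_gen0 : ~ escaped (gen 0).
Proof.
have [c c0 tc] := top_const_gen0; case=> [[n n0 [d [a [b [d0 a0 tp]]]]]|[n n1 [d d0 tp]]].
  have [en e] := topform_uniq E (@cindependent k C) tc tp.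
  have s2 : size (a *: 'X + b%:P) = 2%N.
    by rewrite size_polyDl size_scale ?size_polyX // ltnS size_polyC leq_b1.
  have := congr1 (fun p : {poly k} => (size p).-1) e.
  by rewrite size_polyC c0 size_scale // size_exp s2 -en.
have [en _] := topform_uniq E (@cindependent k C) tc tp.
by rewrite -en in n1.
Qed.

Lemma reduced_word_neq1 w : reduced H1 H2 w -> w <> [::] -> word_prod w <> 1%g.
Proof.
case: w => // -[b Psi] t rw _ e.
have tc := top_const_gen0.
have e1 : comorph (word_prod ((b, Psi) :: t)) (gen 0) = gen 0 by rewrite e.
case: b rw e e1 => rw e e1.
  have := @reduced_escapes _ (gen 0) rw; rewrite e1 => /(_ _ _)/not_escaped_gen0; apply=> //.
  by exists 1%N.
move: rw => /= [hb nb alt rt].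
case: t e e1 alt rt => [|l t] /= e e1 alt rt.
  by apply: nb; rewrite -[Psi]mulg1 e; have [] := restrict_subgroup k.
(* A leading fibred letter only multiplies u by a constant. The rest of the word, which starts with
   a linear letter, thus acts on a function of the same shape as u. *)
have [s [b [a [Tor [Fib [a0 tor fib sb eP]]]]]] := factor_neither2 hb nb.
have st : top_const 1 (comorph Psi (gen 0)).
  have [h0 _] := tor; have [h1 _] := fib.
  have -> : comorph Psi (gen 0) = comorph Tor (gen 0) by rewrite eP comorphM h0 comorphZ h1.
  exact: top_const_borel (torus_triangular a0 tor) tc.
have := @reduced_escapes (l :: t) (comorph Psi (gen 0)) rt.
rewrite /= e1 => /(_ _ _)/not_escaped_gen0; apply=> //=.
by case: l.1 alt {e e1 rt} => // _; exists 1%N.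
Qed.

End States.

Lemma AutS0_generated (Phi : AutS0 k) : generated H1 H2 Phi.
Proof.
have sub := generated_subgroup (restrict_subgroup k) (AutS0_rho0_subgroup k).
have in1 Psi : H1 Psi -> generated H1 H2 Psi.
  by move=> h; exists [:: (true, Psi)] => //=; rewrite mulg1.
have in2 Psi : H2 Psi -> generated H1 H2 Psi.
  by move=> h; exists [:: (false, Psi)] => //=; rewrite mulg1.
have [Gam hG h] := reduction sub (fun s Psi hs => in2 _ (is_fibre_rho0 hs))
  (fun Psi hs => in1 _ (swap_restrict hs)) Phi.
have [_ HM HV] := sub; rewrite -[Phi](mulgK Gam); apply: HM; last exact: HV.
exact: in2.
Qed.

Lemma AutS0_amalgam : is_amalgam H1 H2.
Proof.
have [C] := coordinateField_exists k; have [E] := degreeField_exists C.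
apply: amalgam_of_reduced.
- exact: restrict_subgroup.
- exact: AutS0_rho0_subgroup.
- exact: AutS0_generated.
- exact: reduced_word_neq1 E.
Qed.

End AmalgamOfAutS0.

Theorem proposition9 (k : fieldType) :
  [/\ is_amalgam (restrict_S0 (AutP2_Q0 k)) (AutS0_rho0 k),
      subgroup_iso (PGL k 2) (AutP2_Q0 k) /\
      AutP2_Q0 k =
        subgroup_gen ([set g | exists b : k, given_by g (unip_map b)] `|`
                      [set g | exists2 a : k, a != 0 & given_by g (torus_map a)] `|`
                      [set g | given_by g (swap_map k)])
    & (forall s : {poly k}, exists Psi : AutS0 k, restricts_to (fibre_map s) Psi) /\
      AutS0_rho0 k =
        subgroup_gen ([set Psi | exists s : {poly k}, restricts_to (fibre_map s) Psi]
                      `|` restrict_S0 (AutP2_Q0_p0 k))].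
Proof.
split; first exact: AutS0_amalgam.
  split; last exact: AutP2_Q0_gen.
  exists (@sym2_PGL k); split; [exact: sym2_PGLM|exact: sym2_PGL_inj|exact: sym2_range].
split; last exact: AutS0_rho0_gen.
move=> s; have [Psi [h _]] := fibre_exists s; exists Psi; exact: pulls_back_restricts.
Qed.
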